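(* Let $R\subset\mathbb R^N$ be a root system with multiplicity function $k\ge0$ and closed Weyl chamber $C$. Let $\lambda\in C$ be a regular drift vector and $x\in C$ arbitrary. Let $(X_t^\lambda)_{t\ge0}$ be the Bessel process on $C$ of type $R$ with multiplicity $k$, drift $\lambda$, and start in $x$. Then the random variables $(X_t^\lambda-t\lambda)/\sqrt t$ tend in distribution to the standard normal distribution $N(0,I_N)$ on $\mathbb R^N$ as $t\to\infty$.
   Context: Let $N\ge1$ and let $\mathbb R^N$ carry the usual scalar product $\langle\cdot,\cdot\rangle$ and norm $\|\cdot\|$. A root system $R$ is a finite set of vectors in $\mathbb R^N\setminus\{0\}$ such that the reflections $\sigma_\alpha$ on the hyperplanes $\alpha^\perp$ ($\alpha\in R$) generate a finite group $W$ of orthogonal transformations and $\sigma_\alpha(R)=R$ for all $\alpha\in R$. Fix a positive subsystem $R_+\subset R$ and the associated closed Weyl chamber $C=\{x\in\mathbb R^N:\langle x,\alpha\rangle\ge0\ \text{for all }\alpha\in R_+\}$. A multiplicity function is a $W$-invariant map $k:R\to[0,\infty)$. A vector is regular if it does not lie in the boundary of a Weyl chamber; for $\lambda\in C$ this means that $\lambda$ lies in the interior of $C$. The Dunkl operators are $T_\xi(k)f(x)=\partial_\xi f(x)+\sum_{\alpha\in R_+}k(\alpha)\langle\alpha,\xi\rangle\frac{f(x)-f(\sigma_\alpha(x))}{\langle\alpha,x\rangle}$. The Dunkl kernel $E_k:\mathbb C^N\times\mathbb C^N\to\mathbb C$ is characterized by the property that for each $w\in\mathbb C^N$ the function $f=E_k(\cdot,w)$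 is the unique holomorphic solution of $T_\xi(k)f=\langle\xi,w\rangle f$ for all $\xi\in\mathbb C^N$ with $f(0)=1$ (here $\langle\cdot,\cdot\rangle$ is extended bilinearly); one has $E_k(x,y)>0$ for $x,y\in\mathbb R^N$. The associated Bessel function is $J_k(z,w)=\frac1{|W|}\sum_{g\in W}E_k(z,gw)$. Put $w_k(x)=\prod_{\alpha\in R_+}|\langle\alpha,x\rangle|^{2k(\alpha)}$, $\gamma=\sum_{\alpha\in R_+}k(\alpha)$, and $c_k=\left(\int_{\mathbb R^N}e^{-\|y\|^2/2}w_k(y)\,dy\right)^{-1}$. The Bessel process of type $R$ with multiplicity $k$ and drift $\lambda\in C$ is the Feller diffusion on $C$ (with continuous paths) having transition probabilities $$K_t^{\lambda,k}(x,A)=\frac{|W|\,c_k\,e^{-\|\lambda\|^2t/2}}{t^{\gamma+N/2}}\int_A e^{-(\|x\|^2+\|y\|^2)/(2t)}\,\frac{J_k\left(\frac{x}{\sqrt t},\frac{y}{\sqrt t}\right)J_k(y,\lambda)}{J_k(x,\lambda)}\,w_k(y)\,dy$$ for $t>0$, $x\in C$ and Borel sets $A\subset C$. *)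

(* Defs.v *)
From HB Require Import structures.
From mathcomp Require Import all_boot all_order all_algebra finmap.
From mathcomp Require Import all_classical all_reals all_analysis.
From mathcomp Require Import measurable_realfun.
From mathcomp.real_closed Require Import complex.

Set Implicit Arguments. Unset Strict Implicit. Unset Printing Implicit Defensive.
Import Order.TTheory GRing.Theory Num.Theory numFieldNormedType.Exports.
Local Open Scope classical_set_scope. Local Open Scope ring_scope.

Definition borelRV (R : realType) (n : nat) : Type :=
  g_sigma_algebraType (@open 'rV[R]_n).
HB.instance Definition _ (R : realType) n := Measurable.on (borelRV R n).

Section borelRV_theory.
Context {R : realType}.

Lemma open_measurableRV n (A : set (borelRV R n)) :
  open (A : set 'rV[R]_n) -> measurable A.
Proof. exact: sub_sigma_algebra. Qed.

Lemma continuous_measurableRV n (f : 'rV[R]_n -> R) :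
  continuous f ->
  measurable_fun [set: borelRV R n] (f : borelRV R n -> measurableTypeR R).
Proof.
move=> cf; apply: (measurability (@RGenOInfty.G R)).
  exact: RGenOInfty.measurableE.
move=> _ [_ [x ->] <-]; rewrite setTI; apply: open_measurableRV.
by move/continuousP : cf => /(_ `]x, +oo[%classic); apply; exact: interval_open.
Qed.

Lemma measurable_fun_rowP d (T : measurableType d) n (f : T -> borelRV R n) :
  (forall i, measurable_fun [set: T]
     (fun x => (f x : 'rV[R]_n) ord0 i : measurableTypeR R)) ->
  measurable_fun [set: T] f.
Proof.
move=> mf; apply: (@measurability _ _ T (borelRV R n) setT f (@open 'rV[R]_n)) => //.
move=> _ [U oU <-]; rewrite setTI.
pose box (p : 'rV[rat]_n * rat) : set 'rV[R]_n :=
  [set v | forall i, ball (ratr (p.1 ord0 i) : R) (ratr p.2 : R) (v ord0 i)].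
pose D : set ('rV[rat]_n * rat) := [set p | box p `<=` U].
have -> : f @^-1` U = \bigcup_p (if `[< D p >] then f @^-1` box p else set0).
  apply/seteqP; split => x /=; last first.
    by move=> [p _]; case: asboolP => // Dp fx; exact: Dp.
  rewrite /preimage/= => Ufx.
  have /nbhs_ballP[e /= e0 eU] : nbhs (f x : 'rV[R]_n) U by exact: open_nbhs_nbhs.
  have [r] := rat_in_itvoo (divr_gt0 e0 (ltr0n R 2)).
  rewrite in_itv/= => /andP[r0 re].
  have H i : exists q : rat,
      (f x : 'rV[R]_n) ord0 i < (ratr q : R) < (f x : 'rV[R]_n) ord0 i + ratr r.
    have [|q] := @rat_in_itvoo R ((f x : 'rV[R]_n) ord0 i)
      ((f x : 'rV[R]_n) ord0 i + ratr r); first by rewrite ltrDl.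
    by rewrite in_itv/=; exists q.
  exists (\row_i projT1 (cid (H i)), r) => //.
  case: asboolP => [_ /= i|]; rewrite /ball/=.
    rewrite mxE; case: cid => q /= /andP[q1 q2].
    by rewrite gtr0_norm ?subr_gt0// ltrBlDl.
  case => v /= bv; apply: eU; split => // i j.
  have {}bv := bv j; rewrite (ord1 i); move: bv; rewrite /ball/= mxE.
  case: cid => q /= /andP[q1 q2] bv.
  rewrite (le_lt_trans (ler_distD (ratr q) _ _))//.
  rewrite [ltRHS](splitr e) ltrD//; last exact: lt_trans bv _.
  by rewrite distrC gtr0_norm ?subr_gt0// ltrBlDl (lt_trans q2)// ltrD2l.
apply: countable_bigcupT_measurable => // p.
case: asboolP => // _.
rewrite (_ : f @^-1` _ = \bigcap_(i in [set: 'I_n])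
  ((fun x => (f x : 'rV[R]_n) ord0 i) @^-1`
    ball (ratr (p.1 ord0 i) : R) (ratr p.2 : R))); last first.
  by apply/seteqP; split => x /= h; [move=> i _; exact: h|move=> i; exact: h].
apply: fin_bigcap_measurable => // i _; rewrite -[X in measurable X]setTI.
by apply: mf => //; apply: open_measurable; exact: ball_open.
Qed.

Definition consRV n (p : measurableTypeR R * borelRV R n) : borelRV R n.+1 :=
  row_mx (p.1 : R)%:M (p.2 : 'rV[R]_n).

Definition unconsRV n (v : borelRV R n.+1) : measurableTypeR R * borelRV R n :=
  ((v : 'rV[R]_(1 + n)) ord0 (lshift n ord0), rsubmx (v : 'rV[R]_(1 + n))).

Lemma consRVK n : cancel (@consRV n) (@unconsRV n).
Proof.
by case=> a v; rewrite /unconsRV /consRV/= row_mxKr row_mxEl mxE eqxx mulr1n.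
Qed.

Lemma measurable_consRV n : measurable_fun [set: _] (@consRV n).
Proof.
apply: measurable_fun_rowP => i.
case: (@split_ordP 1 n i) => j ->.
  rewrite (_ : (fun _ => _) = fst); first exact: measurable_fst.
  apply/funext => p; apply: etrans (row_mxEl _ _ _ _) _.
  by rewrite (ord1 j) mxE eqxx mulr1n.
rewrite (_ : (fun _ => _) = fun p => (p.2 : 'rV[R]_n) ord0 j); last first.
  by apply/funext => p; exact: row_mxEr.
apply: (@measurableT_comp _ _ _ _ _ _
  (fun v : borelRV R n => (v : 'rV[R]_n) ord0 j : measurableTypeR R)) => //.
by apply: continuous_measurableRV; exact: coord_continuous.
Qed.

Lemma measurable_unconsRV n : measurable_fun [set: _] (@unconsRV n).
Proof.
apply: measurable_fun_pair.
  by apply: continuous_measurableRV; exact: coord_continuous.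
apply: measurable_fun_rowP => i.
under eq_fun do rewrite mxE.
by apply: continuous_measurableRV; exact: coord_continuous.
Qed.

End borelRV_theory.

(* The product of the one-dimensional Lebesgue measure and mu, transported from
   R * R^n to R^(n+1). *)
Section lebesgueS.
Context {R : realType} (n : nat).
Variable mu : {sigma_finite_measure set (borelRV R n) -> \bar R}.
Local Open Scope ereal_scope.

Definition lebesgueS (A : set (borelRV R n.+1)) : \bar R :=
  (@lebesgue_measure R \x mu) (@consRV R n @^-1` A).

Let lebesgueS0 : lebesgueS set0 = 0.
Proof. by rewrite /lebesgueS preimage_set0 measure0. Qed.

Let lebesgueS_ge0 A : 0 <= lebesgueS A.
Proof. exact: measure_ge0. Qed.

Let lebesgueS_sigma_additive : semi_sigma_additive lebesgueS.
Proof.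
have mc A : measurable A -> measurable (@consRV R n @^-1` A).
  by move=> mA; rewrite -[X in measurable X]setTI; exact: measurable_consRV.
move=> F mF tF mUF; rewrite /lebesgueS preimage_bigcup.
apply: measure_semi_sigma_additive.
- by move=> i; exact: mc.
- apply/trivIsetP => /= i j _ _ ij; rewrite -preimage_setI.
  by move/trivIsetP : tF => /(_ _ _ _ _ ij) ->//; rewrite preimage_set0.
- by rewrite -preimage_bigcup; exact: mc.
Qed.

HB.instance Definition _ := isMeasure.Build _ _ _ lebesgueS
  lebesgueS0 lebesgueS_ge0 lebesgueS_sigma_additive.

Let lebesgueS_sigma_finite : sigma_finite setT lebesgueS.
Proof.
have /sigma_finiteP[F [TF ndF Foo]] := sigma_finiteT (@lebesgue_measure R).
have /sigma_finiteP[G [TG ndG Goo]] := sigma_finiteT mu.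
exists (fun k => @unconsRV R n @^-1` (F k `*` G k)).
  apply/seteqP; split => // v _.
  have : [set: measurableTypeR R] (unconsRV v).1 by [].
  rewrite TF => -[k _ Fk].
  have : [set: borelRV R n] (unconsRV v).2 by [].
  rewrite TG => -[l _ Gl].
  exists (maxn k l) => //; split.
    by move: Fk; exact/subsetPset/ndF/leq_maxl.
  by move: Gl; exact/subsetPset/ndG/leq_maxr.
move=> k; have [mF Fk] := Foo k; have [mG Gk] := Goo k; split.
  rewrite -[X in measurable X]setTI; apply: measurable_unconsRV => //.
  exact: measurableX.
rewrite /lebesgueS -comp_preimage (_ : _ \o _ = id) ?preimage_id.
  by rewrite product_measure1E// lte_mul_pinfty// ge0_fin_numE.
by apply/funext => p /=; rewrite consRVK.
Qed.

HB.instance Definition _ := Measure_isSigmaFinite.Build _ _ _ lebesgueS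
  lebesgueS_sigma_finite.
End lebesgueS.

Fixpoint lebesgueRV (R : realType) n :
    {sigma_finite_measure set (borelRV R n) -> \bar R} :=
  match n with
  | 0 => \d_((0 : 'rV[R]_0) : borelRV R 0)
  | n.+1 => lebesgueS (lebesgueRV R n)
  end.

(* The bilinear (not sesquilinear) scalar product; over R it is the usual one.
   The library norm `|x| on 'rV[R]_n is the sup norm, hence normE. *)
Definition dot (K : pzRingType) n (u v : 'rV[K]_n) : K :=
  \sum_(i < n) u ord0 i * v ord0 i.

Definition normE (R : rcfType) n (x : 'rV[R]_n) : R := Num.sqrt (dot x x).

Lemma continuous_dot (R : realType) n :
  continuous (fun x : 'rV[R]_n => dot x x).
Proof.
rewrite /dot; apply: (@continuous_big R 'I_n +%R 0 xpredT _ 'rV[R]_n).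
  exact: add_continuous.
by move=> i _ y; apply: (@continuousM R 'rV[R]_n (fun x => x ord0 i)
  (fun x => x ord0 i)); exact: coord_continuous.
Qed.

Section standard_normal.
Context {R : realType} (n : nat).
Local Open Scope ereal_scope.

Definition std_normal_pdf (y : 'rV[R]_n) : R :=
  ((2 * pi) `^ (- (n%:R / 2)) * expR (- (normE y ^+ 2 / 2)))%R.

Definition std_normal (A : set (borelRV R n)) : \bar R :=
  \int[lebesgueRV R n]_(y in A) (std_normal_pdf y)%:E.

Let std_normal_pdf_ge0 y : (0 <= std_normal_pdf y)%R.
Proof. by rewrite mulr_ge0 ?powR_ge0 ?expR_ge0. Qed.

Lemma measurable_std_normal_pdf :
  measurable_fun [set: borelRV R n]
    (std_normal_pdf : borelRV R n -> measurableTypeR R).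
Proof.
apply: continuous_measurableRV => y.
apply: (@continuousM R 'rV[R]_n (fun=> (2 * pi) `^ (- (n%:R / 2)))%R).
  exact: cst_continuous.
apply: (@continuous_comp _ _ _
  (fun x : 'rV[R]_n => - (normE x ^+ 2 / 2) : R)%R expR);
  last exact: continuous_expR.
rewrite (_ : (fun x => _) = fun x : 'rV[R]_n => - (dot x x / 2) : R)%R; last first.
  apply/funext => x; rewrite /normE sqr_sqrtr// sumr_ge0// => i _.
  by rewrite -expr2 sqr_ge0.
apply: (@continuousN _ R^o _ (fun x : 'rV[R]_n => dot x x / 2)%R).
apply: (@continuousM R 'rV[R]_n (fun x => dot x x) (fun=> 2^-1)%R); last first.
  exact: cst_continuous.
exact: continuous_dot.
Qed.

Let std_normal0 : std_normal set0 = 0.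
Proof. by rewrite /std_normal integral_set0. Qed.

Let std_normal_ge0 A : 0 <= std_normal A.
Proof. by apply: integral_ge0 => y _; rewrite lee_fin. Qed.

Let std_normal_sigma_additive : semi_sigma_additive std_normal.
Proof.
move=> F mF tF mUF; rewrite /std_normal ge0_integral_bigcup//=.
- by apply: is_cvg_ereal_nneg_natsum_cond => i _ _; exact: std_normal_ge0.
- apply/measurable_EFinP; apply: measurable_funTS.
  exact: measurable_std_normal_pdf.
- by move=> y _; rewrite lee_fin.
Qed.

HB.instance Definition _ := isMeasure.Build _ _ _ std_normal
  std_normal0 std_normal_ge0 std_normal_sigma_additive.
End standard_normal.

Section root_systems.
Context {R : realType} {N : nat}.
Implicit Types (Rts Rp : {fset 'rV[R]_N}) (k : 'rV[R]_N -> R).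

(* Linear maps act on row vectors on the right: sigma_a x is x *m refl_mx a. *)
Definition refl_mx (K : fieldType) (a : 'rV[K]_N) : 'M[K]_N :=
  1%:M - (2 / dot a a) *: (a^T *m a).

(* Products of reflections; no inverses are needed as reflections are
   involutions. *)
Definition weyl_group Rts : set 'M[R]_N :=
  [set g | exists2 s : seq 'rV[R]_N,
    {subset s <= Rts} & g = \prod_(a <- s) refl_mx a].

Definition is_root_system Rts : Prop :=
  [/\ 0 \notin Rts, finite_set (weyl_group Rts) &
    forall a, a \in Rts -> [fset b *m refl_mx a | b in Rts]%fset = Rts].

Definition is_positive_subsystem Rts Rp : Prop :=
  exists2 beta : 'rV[R]_N,
    (forall a, a \in Rts -> dot a beta != 0) &
    Rp = [fset a in Rts | 0 < dot a beta]%fset.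

Definition is_multiplicity Rts k : Prop :=
  (forall a, a \in Rts -> 0 <= k a) /\
  (forall g a, weyl_group Rts g -> a \in Rts -> k (a *m g) = k a).

Definition weyl_chamber Rp : set 'rV[R]_N :=
  [set x | forall a, a \in Rp -> 0 <= dot x a].

(* The Weyl chambers are the images of the fixed one under the group. *)
Definition regular_vector Rts Rp (x : 'rV[R]_N) : Prop :=
  forall g, weyl_group Rts g ->
    let D := (fun y => y *m g) @` weyl_chamber Rp in ~ (closure D `\` D°) x.

End root_systems.

Section dunkl_kernel.
Context {R : realType} {N : nat}.
(* R[i] seen as a numFieldType, from which it gets its topology. *)
Local Notation C := (Num.NumField.sort [the numFieldType of R[i]]).
Implicit Types (Rp : {fset 'rV[R]_N}) (k : 'rV[R]_N -> R).
Implicit Types (f : 'rV[C]_N -> C) (z w xi : 'rV[C]_N).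

Definition cplx {m n : nat} (A : 'M[R]_(m, n)) : 'M[C]_(m, n) :=
  map_mx (real_complex R) A.

(* (f z - f (sigma_a z)) / <a, z>, continuously extended to the hyperplane
   <a, z> = 0: as z - sigma_a z = (2 <a, z> / <a, a>) a, the quotient tends
   there to 2 / <a, a> times the derivative in direction a. *)
Definition refl_quotient (a : 'rV[C]_N) f z : C :=
  if dot a z == 0 then 2 / dot a a * 'D_a f z
  else (f z - f (z *m refl_mx a)) / dot a z.

Definition dunkl_op Rp k xi f z : C :=
  'D_xi f z +
  \sum_(a <- Rp) real_complex R (k a) * dot (cplx a) xi *
    refl_quotient (cplx a) f z.

(* Entire functions on C^N are those complex (Frechet) differentiable
   everywhere; [differentiable] and 'D are here over the field R[i]. *)
Definition dunkl_solution Rp k w f : Prop :=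
  [/\ forall z, differentiable f z,
      forall xi z, dunkl_op Rp k xi f z = dot xi w * f z &
      f 0 = 1].

Definition is_dunkl_kernel Rp k (E : 'rV[C]_N -> 'rV[C]_N -> C) : Prop :=
  forall w, unique (dunkl_solution Rp k w) (fun z => E z w).

End dunkl_kernel.

Section bessel_process.
Context {R : realType} {N : nat}.
Variables (Rts Rp : {fset 'rV[R]_N}) (k : 'rV[R]_N -> R).
Variable E : 'rV[R[i]]_N -> 'rV[R[i]]_N -> R[i].
Local Notation W := (weyl_group Rts).
Local Notation chamber := (weyl_chamber Rp).
Local Notation leb := (lebesgueRV R N).
Implicit Types (x y : 'rV[R]_N) (lambda : 'rV[R]_N) (f : 'rV[R]_N -> R).

Definition bessel_fun (z w : 'rV[R[i]]_N) : R[i] :=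
  (#|` fset_set W|%:R)^-1 * \sum_(g \in W) E z (w *m cplx g).

(* J_k is real-valued on real arguments. *)
Definition bessel_funR x y : R := complex.Re (bessel_fun (cplx x) (cplx y)).

Definition dunkl_weight y : R :=
  \prod_(a <- Rp) `|dot a y| `^ (2 * k a).

Definition dunkl_gamma : R := \sum_(a <- Rp) k a.

Definition dunkl_const : R :=
  (\int[leb]_y (expR (- (normE y ^+ 2 / 2)) * dunkl_weight y))^-1.

Definition bessel_density lambda (t : R) x y : R :=
  #|` fset_set W|%:R * dunkl_const * expR (- (normE lambda ^+ 2 * t / 2)) /
    t `^ (dunkl_gamma + N%:R / 2) *
  (expR (- ((normE x ^+ 2 + normE y ^+ 2) / (2 * t))) *
   (bessel_funR ((Num.sqrt t)^-1 *: x) ((Num.sqrt t)^-1 *: y) *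
    bessel_funR y lambda / bessel_funR x lambda) *
   dunkl_weight y).

Definition bessel_kernel lambda (t : R) x (A : set (borelRV R N)) : \bar R :=
  (\int[leb]_(y in A) (bessel_density lambda t x y)%:E)%E.

Definition bessel_semigroup lambda (t : R) f x : R :=
  \int[leb]_(y in chamber) (f y * bessel_density lambda t x y).

Definition C0_chamber f : Prop :=
  {within chamber, continuous f} /\
  forall e : R, 0 < e -> exists M : R, forall y,
    chamber y -> M <= normE y -> `|f y| < e.

(* The kernels are Markovian, satisfy the Chapman-Kolmogorov equations, and
   induce a strongly continuous semigroup on C_0 of the chamber. *)
Definition feller_transition lambda : Prop :=
  [/\ (forall (t : R) x (A : set (borelRV R N)), 0 < t -> chamber x ->
         measurable A -> A `<=` chamber ->
         (0 <= bessel_kernel lambda t x A)%E),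
      (forall (t : R) x, 0 < t -> chamber x ->
         bessel_kernel lambda t x chamber = 1%E),
      (forall (s t : R) x (A : set (borelRV R N)), 0 < s -> 0 < t -> chamber x ->
         measurable A -> A `<=` chamber ->
         bessel_kernel lambda (s + t) x A =
         (\int[leb]_(y in chamber)
            ((bessel_density lambda s x y)%:E * bessel_kernel lambda t y A))%E),
      (forall (t : R) f, 0 < t -> C0_chamber f ->
         C0_chamber (bessel_semigroup lambda t f)) &
      (forall f (e : R), C0_chamber f -> 0 < e ->
         \forall t \near 0^'+, forall x, chamber x ->
           `|bessel_semigroup lambda t f x - f x| < e)].

Definition natural_filtration (T : Type) (X : R -> T -> 'rV[R]_N) (s : R) :
    set (set T) :=
  <<s [set D | exists (u : R) (A : set (borelRV R N)),
        [/\ 0 <= u <= s, measurable A & D = X u @^-1` A]] >>.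

(* The last clause is the Markov property with respect to the natural
   filtration, i.e. P(X_(s+t) in A | F_s) = K_t(X_s, A). *)
Definition is_bessel_process lambda x d (T : measurableType d)
    (P : probability T R) (X : R -> T -> 'rV[R]_N) : Prop :=
  [/\ feller_transition lambda,
      (forall t : R, 0 <= t ->
         measurable_fun [set: T] (X t : T -> borelRV R N) /\
         forall w, chamber (X t w)),
      (forall w, {within `[0, +oo[, continuous (fun t : R => X t w)}),
      {ae P, forall w, X 0 w = x} &
      (forall (s t : R) (A : set (borelRV R N)) (B : set T),
         0 <= s -> 0 < t -> measurable A -> A `<=` chamber ->
         natural_filtration X s B ->
         P (B `&` X (s + t) @^-1` A) =
         (\int[P]_(w in B) bessel_kernel lambda t (X s w) A)%E)].

End bessel_process.

Definition tends_in_distribution (R : realType) n d (T : measurableType d)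
    (P : probability T R) (Z : R -> T -> 'rV[R]_n)
    (nu : {measure set (borelRV R n) -> \bar R}) : Prop :=
  forall f : 'rV[R]_n -> R, continuous f -> (exists M : R, forall y, `|f y| <= M) ->
    \int[P]_w f (Z t w) @[t --> +oo] --> \int[nu]_y f y.

(* Main.v *)
Require Import Defs.
From HB Require Import structures.
From mathcomp Require Import all_boot all_order all_algebra finmap.
From mathcomp Require Import all_classical all_reals all_analysis.
From mathcomp Require Import measurable_realfun ring lra.
From mathcomp.real_closed Require Import complex.
Set Implicit Arguments. Unset Strict Implicit. Unset Printing Implicit Defensive.
Import Order.TTheory GRing.Theory Num.Theory numFieldNormedType.Exports.
Local Open Scope classical_set_scope. Local Open Scope ring_scope.

(* Substituting y = t lambda + sqrt t z, the transition density becomes, up to a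
   factor depending on t and x only, the gaussian e^{-|z|^2/2} times
     J_k(x, v) w_k(v) psi(t v) / psi(t lambda),   v = lambda + z / sqrt t,
   where psi(y) = sum_g e^{-<y,lambda>} E_k(y, g lambda) is a multiple of
   e^{-<y,lambda>} J_k(y, lambda). As the law has total mass 1, no constant has
   to be computed: it suffices that this factor is dominated and tends to a
   positive constant. The precise asymptotics of J_k is not needed, only that
   psi varies slowly around t lambda. Along a ray s eta with eta close to lambda,
   the functions s |-> E_k(s eta, g lambda) solve a linear system with
   nonnegative off-diagonal coefficients; hence they are positive, and, since
   <eta, g lambda> < <eta, lambda> for g <> 1, the terms with g <> 1 are O(1/s)
   relative to the term g = 1. The reflection terms cancel in the gradient of
   psi, so grad psi = O(1/t) psi near t lambda, and psi(t v) / psi(t lambda) is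
   at most e^{c |z| / sqrt t} and at least the inverse of this. Far from
   t lambda one uses psi <= |W| on the chamber, which holds because
   <y, g lambda> <= <y, lambda> for y and lambda in C. *)

(** * Root systems and Weyl chambers *)

(** The characterisation of [E] treats each spectral parameter separately, so positivity, growth and
    continuity in the second argument all have to be extracted from the differential system.
    Uniqueness of its solution supplies the symmetries: scaling and reflections may be moved from
    one argument to the other. Moving a reflection from the space variable to the parameter is what
    makes the functions with parameters [w *m g] a closed finite system along a ray. The obstacle is
    that this system is singular at the starting point [s = 0], with coefficients of order [1/s],
    exactly where the initial values are known. An energy argument avoids the singularity: the
    singular terms contribute with a sign, and the remaining ones are bounded. Both the strict gap
    between [<eta, g lambda>] and [<eta, lambda>] and the inequality on the chamber rest on one fact
    about the group: an element that maps an interior point of the chamber into the chamber is the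
    identity. *)

Section dot_theory.
Context {K : comNzRingType} {n : nat}.
Implicit Types u v w : 'rV[K]_n.

Lemma dotE u v : dot u v = (u *m v^T) 0 0.
Proof. by rewrite mxE; apply: eq_bigr => i _; rewrite mxE. Qed.

Lemma dotC u v : dot u v = dot v u.
Proof. by apply: eq_bigr => i _; rewrite mulrC. Qed.

Lemma dotDl u v w : dot (u + v) w = dot u w + dot v w.
Proof. by rewrite !dotE mulmxDl mxE. Qed.

Lemma dotZl c u w : dot (c *: u) w = c * dot u w.
Proof. by rewrite !dotE -scalemxAl mxE. Qed.

Lemma dotNl u w : dot (- u) w = - dot u w.
Proof. by rewrite -scaleN1r dotZl mulN1r. Qed.

Lemma dotBl u v w : dot (u - v) w = dot u w - dot v w.
Proof. by rewrite dotDl dotNl. Qed.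

Lemma dotDr u v w : dot w (u + v) = dot w u + dot w v.
Proof. by rewrite dotC dotDl !(dotC w). Qed.

Lemma dotZr c u w : dot w (c *: u) = c * dot w u.
Proof. by rewrite dotC dotZl dotC. Qed.

Lemma dotNr u w : dot w (- u) = - dot w u.
Proof. by rewrite dotC dotNl dotC. Qed.

Lemma dotBr u v w : dot w (u - v) = dot w u - dot w v.
Proof. by rewrite dotDr dotNr. Qed.

Lemma dot0l u : dot 0 u = 0.
Proof. by rewrite -(scale0r u) dotZl mul0r. Qed.

Lemma dot0r u : dot u 0 = 0.
Proof. by rewrite dotC dot0l. Qed.

Lemma dot_mulmxl u v (A : 'M[K]_n) : dot (u *m A) v = dot u (v *m A^T).
Proof. by rewrite !dotE trmx_mul trmxK mulmxA. Qed.

Lemma dot_orthogonal u v (A : 'M[K]_n) :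
  A *m A^T = 1%:M -> dot (u *m A) (v *m A) = dot u v.
Proof. by move=> AA; rewrite dot_mulmxl -mulmxA AA mulmx1. Qed.

End dot_theory.

Section dot_real.
Context {R : realType} {n : nat}.
Implicit Types u v w : 'rV[R]_n.

Lemma dot_ge0 u : 0 <= dot u u.
Proof. by apply: sumr_ge0 => i _; rewrite -expr2 sqr_ge0. Qed.

Lemma dot_eq0 u : (dot u u == 0) = (u == 0).
Proof.
apply/idP/eqP => [|->]; last by rewrite dot0l.
rewrite /dot psumr_eq0 => [/allP u0|i _]; last by rewrite -expr2 sqr_ge0.
apply/rowP => i; rewrite mxE; apply/eqP; rewrite -sqrf_eq0 expr2.
by apply: u0; rewrite mem_index_enum.
Qed.

Lemma dot_gt0 u : (0 < dot u u) = (u != 0).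
Proof. by rewrite lt_neqAle eq_sym dot_eq0 dot_ge0 andbT. Qed.

Lemma normE_ge0 u : 0 <= normE u.
Proof. exact: sqrtr_ge0. Qed.

Lemma normE_sqr u : normE u ^+ 2 = dot u u.
Proof. by rewrite /normE sqr_sqrtr// dot_ge0. Qed.

Lemma normEZ c u : normE (c *: u) = `|c| * normE u.
Proof.
by rewrite /normE dotZl dotZr mulrA -expr2 sqrtrM ?sqr_ge0// sqrtr_sqr.
Qed.

Lemma normEN u : normE (- u) = normE u.
Proof. by rewrite /normE dotNl dotNr opprK. Qed.

Lemma normE_orthogonal u (A : 'M[R]_n) :
  A *m A^T = 1%:M -> normE (u *m A) = normE u.
Proof. by move=> AA; rewrite /normE dot_orthogonal. Qed.

Lemma CauchySchwarz_normE u v : `|dot u v| <= normE u * normE v.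
Proof.
rewrite -(@ler_pXn2r _ 2) ?nnegrE// ?mulr_ge0 ?normE_ge0//.
rewrite real_normK ?num_real// exprMn !normE_sqr.
have [->|v0] := eqVneq v 0; first by rewrite !dot0r expr0n mulr0.
have vv : 0 < dot v v by rewrite dot_gt0.
have := dot_ge0 (dot v v *: u - dot u v *: v).
rewrite !(dotBl, dotBr, dotZl, dotZr) (dotC v u) => h.
by rewrite -subr_ge0 -(pmulr_rge0 _ vv); lra.
Qed.

Lemma ler_normED u v : normE (u + v) <= normE u + normE v.
Proof.
rewrite -(@ler_pXn2r _ 2) ?nnegrE// ?addr_ge0 ?normE_ge0//.
rewrite sqrrD !normE_sqr !(dotDl, dotDr) (dotC v u).
have := le_trans (ler_norm _) (CauchySchwarz_normE u v); lra.
Qed.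

End dot_real.

Section reflections.
Context {K : fieldType} {n : nat}.
Implicit Types (a u v : 'rV[K]_n) (g : 'M[K]_n).

Lemma mulmx_refl u a : u *m refl_mx a = u - (2 / dot a a * dot u a) *: a.
Proof.
rewrite /refl_mx mulmxBr mulmx1 -scalemxAr mulmxA; congr (_ - _).
by rewrite [u *m _]mx11_scalar -dotE mul_scalar_mx scalerA.
Qed.

Lemma tr_refl a : (refl_mx a)^T = refl_mx a.
Proof. by rewrite /refl_mx !raddfB/= trmx1 linearZ/= trmx_mul trmxK. Qed.

Lemma refl_eqN a : dot a a != 0 -> a *m refl_mx a = - a.
Proof.
move=> a0; rewrite mulmx_refl divfK// scaler_nat mulr2n opprD addrA subrr.
by rewrite add0r.
Qed.

Lemma reflK a : dot a a != 0 -> refl_mx a *m refl_mx a = 1%:M.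
Proof.
move=> a0; apply/row_matrixP => i; rewrite rowE (rowE _ 1%:M) mulmx1 mulmxA.
rewrite [LHS]mulmx_refl dot_mulmxl tr_refl refl_eqN// dotNr mulmx_refl mulrN.
by rewrite scaleNr opprK subrK.
Qed.

Lemma reflZ c a : c != 0 -> refl_mx (c *: a) = refl_mx a.
Proof.
have E : (c *: a)^T = c *: a^T by rewrite linearZ.
move=> c0; rewrite /refl_mx dotZl dotZr E.
rewrite -scalemxAl -scalemxAr !scalerA.
congr (_ - _ *: _).
(* Over a general field a nonzero [a] may be isotropic; then [2 / dot a a] is 0 by the convention on
   inverses and both matrices are the identity. *)
have [->|a0] := eqVneq (dot a a) 0; first by rewrite !mulr0 invr0 mulr0 !mul0r.
by field; rewrite c0 a0.
Qed.

Lemma refl_conj a g : g *m g^T = 1%:M ->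
  refl_mx a *m g = g *m refl_mx (a *m g).
Proof.
move=> gg; rewrite /refl_mx dot_orthogonal// trmx_mul mulmxBl mulmxBr.
by rewrite mul1mx mulmx1 -scalemxAl -scalemxAr !mulmxA gg mul1mx.
Qed.

End reflections.

Lemma fset_argmax (R : realType) (K : choiceType) (A : {fset K}) (f : K -> R) a :
  a \in A -> exists2 b, b \in A & forall c, c \in A -> f c <= f b.
Proof.
move=> aA; pose a0 : A := [` aA]%fset.
case: (@arg_maxP _ _ _ a0 xpredT (fun i => f (val i)) isT) => b _ bP.
by exists (val b) => [|c cA]; [exact: valP|exact: (bP [` cA]%fset)].
Qed.

Section root_systems_theory.
Context {R : realType} {N : nat}.
Variables (Rts Rp : {fset 'rV[R]_N}) (beta : 'rV[R]_N).
Hypothesis rootR : is_root_system Rts.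
Hypothesis beta_regular : forall a, a \in Rts -> dot a beta != 0.
Hypothesis RpE : Rp = [fset a in Rts | 0 < dot a beta]%fset.
Local Notation W := (weyl_group Rts).
Implicit Types (a b c x y : 'rV[R]_N) (g : 'M[R]_N) (s : seq 'rV[R]_N).

Lemma root_neq0 a : a \in Rts -> a != 0.
Proof. by case: rootR => R0 _ _ aR; apply: contraNneq R0 => <-. Qed.

Lemma root_dot_gt0 a : a \in Rts -> 0 < dot a a.
Proof. by move=> /root_neq0; rewrite dot_gt0. Qed.

Lemma root_dot_neq0 a : a \in Rts -> dot a a != 0.
Proof. by move=> /root_dot_gt0/lt0r_neq0. Qed.

Lemma root_refl a b : a \in Rts -> b \in Rts -> b *m refl_mx a \in Rts.
Proof.
by case: rootR => _ _ h aR bR; rewrite -[in X in _ \in X](h a aR); apply/imfsetP; exists b.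
Qed.

Lemma root_opp a : a \in Rts -> - a \in Rts.
Proof. by move=> aR; rewrite -refl_eqN ?root_dot_neq0 ?root_refl. Qed.

Lemma mem_posroot a : (a \in Rp) = (a \in Rts) && (0 < dot a beta).
Proof. by rewrite RpE !inE. Qed.

Lemma posroot_root a : a \in Rp -> a \in Rts.
Proof. by rewrite mem_posroot => /andP[]. Qed.

Lemma posroot_gt0 a : a \in Rp -> 0 < dot a beta.
Proof. by rewrite mem_posroot => /andP[]. Qed.

Lemma posrootN a : a \in Rts -> (- a \in Rp) = (a \notin Rp).
Proof.
move=> aR; rewrite !mem_posroot root_opp// aR/= dotNl oppr_gt0 -leNgt.
by rewrite le_eqVlt (negbTE (beta_regular aR)).
Qed.

Lemma weyl1 : W 1%:M.
Proof. by exists [::] => //; rewrite big_nil. Qed.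

Lemma weyl_mul g h : W g -> W h -> W (g *m h).
Proof.
move=> [s sR ->] [t tR ->]; exists (s ++ t); last by rewrite big_cat.
by move=> a; rewrite mem_cat => /orP[/sR|/tR].
Qed.

Lemma weyl_refl a : a \in Rts -> W (refl_mx a).
Proof.
by move=> aR; exists [:: a]; [move=> b; rewrite inE => /eqP->|rewrite big_seq1].
Qed.

Lemma weyl_ind (Q : 'M[R]_N -> Prop) : Q 1%:M ->
  (forall a g, a \in Rts -> Q g -> Q (refl_mx a *m g)) ->
  forall g, W g -> Q g.
Proof.
move=> Q1 QM g [s + ->]; elim: s => [_|a s IHs asR]; first by rewrite big_nil.
rewrite big_cons; apply: QM; first by apply: asR; rewrite mem_head.
by apply: IHs => b bs; apply: asR; rewrite inE bs orbT.
Qed.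

Lemma weyl_orthogonal g : W g -> g *m g^T = 1%:M.
Proof.
move: g; apply: weyl_ind => [|a g aR gg]; first by rewrite trmx1 mulmx1.
by rewrite trmx_mul tr_refl mulmxA -(mulmxA _ g) gg mulmx1 reflK ?root_dot_neq0.
Qed.

Lemma weyl_tr g : W g -> W g^T.
Proof.
move: g; apply: weyl_ind => [|a g aR Wg]; first by rewrite trmx1; exact: weyl1.
by rewrite trmx_mul tr_refl; apply: weyl_mul => //; exact: weyl_refl.
Qed.

Lemma weyl_root g a : W g -> a \in Rts -> a *m g \in Rts.
Proof.
(* [weyl_ind] peels reflections off on the left, which a row vector meets first; after transposition
   the peeled reflection acts last. *)
move=> + aR => /weyl_tr; rewrite -{2}(trmxK g); move: {g}(g^T).
apply: weyl_ind => [|b g bR gR]; first by rewrite trmx1 mulmx1.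
by rewrite trmx_mul tr_refl mulmxA root_refl.
Qed.

Lemma weyl_finite : finite_set W.
Proof. by case: rootR. Qed.

Lemma mem_weyl g : (g \in fset_set W) = (g \in W).
Proof. by rewrite in_fset_set//; exact: weyl_finite. Qed.

(* Spanning an extreme ray of the cone generated by the positive roots; as R
   need not be reduced, several simple roots may be proportional. *)
Definition simple_root a := a \in Rp /\ forall b c (r : R),
  b \in Rp -> c \in Rp -> 0 < r -> b + c = r *: a -> exists t, b = t *: a.

(** Here [b] and [- b *m refl_mx a] are positive roots whose sum is a multiple of [a]. Pairing with
    [beta] shows that the multiple is positive, so extremality of [a] makes [b] proportional to
    [a]. *)
Lemma simple_refl a b : simple_root a -> b \in Rp -> b *m refl_mx a \notin Rp ->
  refl_mx b = refl_mx a.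
Proof.
move=> [aRp sa] bRp bsN.
have [aR bR] := (posroot_root aRp, posroot_root bRp).
have bs : - (b *m refl_mx a) \in Rp by rewrite posrootN ?root_refl.
suff [t bE] : exists t, b = t *: a.
  rewrite bE reflZ//; apply: contraTneq bRp => t0.
  by rewrite bE t0 scale0r mem_posroot dot0l ltxx andbF.
have E : b - b *m refl_mx a = (2 / dot a a * dot b a) *: a.
  by rewrite mulmx_refl opprB addrC subrK.
apply: (sa _ _ _ bRp bs _ E).
have := posroot_gt0 bRp; have := posroot_gt0 bs.
move: (congr1 (fun z => dot z beta) E); rewrite /= dotDl dotZl => + h1 h2.
by have := posroot_gt0 aRp; move: h1 h2; nra.
Qed.

(** Scale the positive roots into the hyperplane [<., beta> = 1]. Those maximising [<., x>] lie on a
    face of their convex hull, and a point of that face farthest from the origin is extreme. Hence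
    two successive maximisations, of [<a, x> / h a] and then of [<a, a> / h a ^+ 2]. *)
Lemma simple_root_gt0 x d : d \in Rp -> 0 < dot d x ->
  exists2 a, simple_root a & 0 < dot a x.
Proof.
move=> dRp dx; pose h a := dot a beta.
have h0 a : a \in Rp -> 0 < h a by exact: posroot_gt0.
have [a1 a1Rp a1max] := fset_argmax (fun a => dot a x / h a) dRp.
pose m1 := dot a1 x / h a1.
have le1 b : b \in Rp -> dot b x <= m1 * h b.
  by move=> bRp; rewrite -ler_pdivrMr ?h0// a1max.
pose F := [fset a in Rp | dot a x == m1 * h a]%fset.
have a1F : a1 \in F by rewrite !inE a1Rp /m1 divfK ?lt0r_neq0 ?h0 ?eqxx.
have [a aF amax] := fset_argmax (fun a => dot a a / h a ^+ 2) a1F.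
have Fh b : b \in F -> b \in Rp /\ dot b x = m1 * h b.
  by rewrite !inE => /andP[-> /eqP ->].
have [aRp ax] := Fh _ aF.
have m10 : 0 < m1 by apply: lt_le_trans (a1max _ dRp); rewrite divr_gt0// h0.
exists a; last by rewrite ax mulr_gt0// h0.
pose m2 := dot a a / h a ^+ 2.
have le2 b : b \in F -> dot b b <= m2 * h b ^+ 2.
  by move=> bF; rewrite -ler_pdivrMr ?exprn_gt0 ?h0 ?(proj1 (Fh _ bF))// amax.
split=> // b c r bRp cRp r0 bcE.
have hE : h b + h c = r * h a by rewrite /h -dotDl bcE dotZl.
have xE : dot b x + dot c x = r * dot a x by rewrite -dotDl bcE dotZl.
have [bx cx] := (le1 _ bRp, le1 _ cRp).
have xE' : dot b x + dot c x = m1 * h b + m1 * h c.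
  by rewrite xE ax mulrCA -hE mulrDr.
have bF : b \in F by rewrite !inE bRp; apply/eqP; lra.
have cF : c \in F by rewrite !inE cRp; apply/eqP; lra.
have [lb lc] := (le2 _ bF, le2 _ cF).
have E2 : dot b b + 2 * dot b c + dot c c = m2 * (h b + h c) ^+ 2.
  rewrite hE exprMn mulrCA /m2 divfK ?expf_neq0 ?lt0r_neq0 ?h0//.
  have -> : r ^+ 2 * dot a a = dot (r *: a) (r *: a) by rewrite dotZl dotZr mulrA.
  by rewrite -bcE !(dotDl, dotDr) (dotC c b); ring.
have [hb hc] := (h0 _ bRp, h0 _ cRp).
have bc : m2 * (h b * h c) <= dot b c by move: lb lc E2; nra.
(* Strict convexity of the norm: [a / h a] lies between [b / h b] and [c / h c], neither of which is
   longer, so the two coincide. *)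
have : dot (h c *: b - h b *: c) (h c *: b - h b *: c) <= 0.
  rewrite !(dotBl, dotBr, dotZl, dotZr) (dotC c b).
  have l1 := ler_wpM2l (sqr_ge0 (h c)) lb.
  have l2 := ler_wpM2l (sqr_ge0 (h b)) lc.
  have l3 := ler_wpM2l (ltW (mulr_gt0 hb hc)) bc.
  by move: l1 l2 l3; lra.
rewrite le_eqVlt ltNge dot_ge0 orbF dot_eq0 subr_eq0 => /eqP bcE'.
exists (r * h b / (h b + h c)).
apply: (@scalerI _ _ (h b + h c)); first by rewrite lt0r_neq0// addr_gt0.
rewrite scalerA mulrC divfK ?lt0r_neq0 ?addr_gt0// mulrC -scalerA -bcE.
by rewrite scalerDl scalerDr bcE'.
Qed.

(** * Words in simple reflections and the exchange property *)

Definition simple_word (s : seq 'rV[R]_N) := forall a, a \in s -> simple_root a.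

Local Notation "\refl s" := (\prod_(a <- s) refl_mx a) (at level 10).

Lemma simple_word_weyl s : simple_word s -> W (\refl s).
Proof. by move=> ss; exists s => // a /ss[/posroot_root]. Qed.

Lemma simple_word_cat s t : simple_word s -> simple_word t -> simple_word (s ++ t).
Proof. by move=> ss tt a; rewrite mem_cat => /orP[/ss|/tt]. Qed.

(** Some simple [a] has [<a, b> > 0]. Either reflecting [b] in [a] lowers its height [<b, beta>],
    and the reflection in [b] is conjugate by that in [a] to one already expressed, or the two
    reflections agree. Heights being real, the induction counts the positive roots of smaller
    height. *)
Lemma simple_word_posrefl b : b \in Rp ->
  exists2 s, simple_word s & refl_mx b = \refl s.
Proof.
pose below b := [fset c in Rp | (dot c beta < dot b beta)%R]%fset.
have [n] := ubnP #|` below b|; elim: n b => // n IHn b bn bRp.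
have bb : 0 < dot b b by apply/root_dot_gt0/posroot_root.
have [a sa ab] := simple_root_gt0 bRp bb.
have saw : simple_word [:: a] by move=> c; rewrite inE => /eqP->.
have [aRp aR] : a \in Rp /\ a \in Rts by case: sa => aRp _; rewrite posroot_root.
have [bsRp|/(simple_refl sa bRp)->] := boolP (b *m refl_mx a \in Rp); last first.
  by exists [:: a] => //; rewrite big_seq1.
have [|s ss sE] := IHn (b *m refl_mx a) _ bsRp.
  move: bn; rewrite ltnS; apply: leq_trans; apply: fproper_ltn_card.
  have lt : dot (b *m refl_mx a) beta < dot b beta.
    rewrite mulmx_refl dotBl gtrBl dotZl mulr_gt0 ?posroot_gt0//.
    by rewrite mulr_gt0 ?divr_gt0// ?root_dot_gt0// dotC.
  apply/andP; split.
    by apply/fsubsetP => c; rewrite !inE => /andP[->] /lt_trans; apply.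
  by apply/fsubsetPn; exists (b *m refl_mx a); rewrite !inE bsRp ?lt ?ltxx.
exists ([:: a] ++ s ++ [:: a]); first by do 2?apply: simple_word_cat.
rewrite !big_cat !big_seq1/= -sE /=.
have ra : refl_mx a *m refl_mx a = 1%:M by rewrite reflK ?root_dot_neq0.
have := @refl_conj _ _ b (refl_mx a); rewrite tr_refl => /(_ ra) E.
apply: (@etrans _ _ (refl_mx a *m (refl_mx (b *m refl_mx a) *m refl_mx a))) => //.
by rewrite mulmxA -E -mulmxA ra mulmx1.
Qed.

Lemma weyl_simple_word g : W g -> exists2 s, simple_word s & g = \refl s.
Proof.
move: g; apply: weyl_ind => [|a g aR [s ss ->]].
  by exists [::] => //; rewrite big_nil.
suff [t tt ->] : exists2 t, simple_word t & refl_mx a = \refl t.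
  by exists (t ++ s); [exact: simple_word_cat|rewrite big_cat].
have [/simple_word_posrefl//|] := boolP (a \in Rp).
rewrite -posrootN// => /simple_word_posrefl.
by rewrite -scaleN1r reflZ ?oppr_eq0 ?oner_eq0.
Qed.

(** Follow [a] through the prefixes of the word. At a letter [b] where the image turns from positive
    to non-positive, that image has the same reflection as [b] by [simple_refl]. Moving the
    reflection in [a] through the prefix therefore cancels the letter. *)
Lemma exchange a s : simple_root a -> simple_word s -> a *m \refl s \notin Rp ->
  exists t, [/\ simple_word t, (size t < size s)%N &
                refl_mx a *m \refl s = \refl t].
Proof.
move=> sa; elim/last_ind: s => [|s b IHs] ss.
  by rewrite big_nil mulmx1; case: sa => ->.
have {}ss : simple_word s /\ simple_root b.
  by split=> [c cs|]; apply: ss; rewrite mem_rcons inE ?cs ?orbT ?eqxx.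
case: ss => ss sb; rewrite -cats1 big_cat big_seq1/= => asb.
have [asRp|/(IHs ss)[t [tt ts tE]]] := boolP (a *m \refl s \in Rp); last first.
  exists (t ++ [:: b]); split.
  - by apply: simple_word_cat => // c; rewrite inE => /eqP->.
  - by rewrite !size_cat ltn_add2r.
  - by rewrite big_cat big_seq1/= -tE; exact: mulmxA.
exists s; split => //; first by rewrite size_cat addn1.
have bE : refl_mx (a *m \refl s) = refl_mx b.
  by apply: simple_refl => //; rewrite -mulmxA.
rewrite (mulmxA (refl_mx a) (\refl s)) refl_conj; last first.
  exact/weyl_orthogonal/simple_word_weyl.
by rewrite bE -mulmxA reflK ?mulmx1// root_dot_neq0// posroot_root//; case: sb.
Qed.

(** Descent on the length of a word for [g]: if it begins with [a], positivity of [a *m g] means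
    that the rest of the word makes [a] negative, and [exchange] yields a shorter word for [g]. *)
Lemma weyl_posroot_stable g : W g -> (forall a, a \in Rp -> a *m g \in Rp) ->
  g = 1%:M.
Proof.
move=> /weyl_simple_word[s ss ->]; have [n] := ubnP (size s).
elim: n s ss => // n IHn [|a s] ss; first by rewrite big_nil.
rewrite ltnS big_cons => sn pos.
have sa : simple_root a by apply: ss; rewrite mem_head.
have {}ss : simple_word s by move=> c cs; apply: ss; rewrite inE cs orbT.
have aRp : a \in Rp by case: sa.
have : a *m \refl s \notin Rp.
  have := pos _ aRp; rewrite mulmxA refl_eqN ?root_dot_neq0 ?posroot_root//.
  rewrite mulNmx posrootN//; apply: weyl_root; last exact: posroot_root.
  exact: simple_word_weyl.
move=> /(exchange sa ss)[t [tt ts tE]].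
have gE : refl_mx a * \refl s = \refl t by [].
by rewrite gE in pos *; apply: IHn => //; exact: leq_trans ts (ltnW sn).
Qed.

(** If [x] were orthogonal to [a], the points [x - r a] with small [r > 0] would lie outside the
    chamber, making [x] a boundary point. This turns the topological notion of regularity into
    strict inequalities. *)
Lemma regular_dot_gt0 x : weyl_chamber Rp x -> regular_vector Rts Rp x ->
  forall a, a \in Rp -> 0 < dot x a.
Proof.
move=> Cx regx a aRp; rewrite lt_neqAle Cx// andbT eq_sym; apply/eqP => xa.
have := regx 1%:M weyl1; rewrite (_ : [set _ | _ in _] = weyl_chamber Rp).
  apply; split; first exact: subset_closure.
  move=> /nbhs_ballP[e /= e0 xeC].
  pose M := `|a| + 1; have M0 : 0 < M by rewrite ltr_wpDl.
  have /xeC/(_ a aRp) : ball x e (x - (e / (2 * M)) *: a).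
    rewrite -ball_normE/= opprB addrC subrK normrZ gtr0_norm; last first.
      by rewrite divr_gt0// mulr_gt0.
    rewrite mulrAC ltr_pdivrMr ?mulr_gt0// ltr_pM2l// /M.
    by have := normr_ge0 a; lra.
  rewrite dotBl xa sub0r dotZl oppr_ge0 leNgt mulr_gt0//.
    by rewrite divr_gt0// mulr_gt0.
  by rewrite root_dot_gt0// posroot_root.
apply/seteqP; split=> [_ [y Cy <-]|y Cy]; first by rewrite mulmx1.
by exists y => //; rewrite mulmx1.
Qed.

(** If [a *m g^T] were negative for a positive [a], strict positivity of [x] would give
    [<x *m g, a> < 0]. So [g^T] preserves the positive roots. *)
Lemma weyl_chamber_stable x g : (forall a, a \in Rp -> 0 < dot x a) ->
  W g -> weyl_chamber Rp (x *m g) -> g = 1%:M.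
Proof.
move=> x0 Wg Cxg; rewrite -(trmxK g) -[RHS]trmx1; congr (_^T).
apply: weyl_posroot_stable => [|a aRp]; first exact: weyl_tr.
have agR : a *m g^T \in Rts.
  by apply: weyl_root; [exact: weyl_tr|exact: posroot_root].
have := Cxg _ aRp; rewrite dot_mulmxl; apply: contraTT => agN.
by rewrite -posrootN// in agN; rewrite -ltNge -oppr_gt0 -dotNr x0.
Qed.

(** Among the images [x *m h] at least as good as [x *m g], take the one with the largest product
    with [beta]. Were it on the wrong side of a wall, reflecting it there would not decrease the
    product with [y] and would increase that with [beta]. So it lies in the chamber and [h] is the
    identity. *)
Lemma dot_weyl_le x y g : (forall a, a \in Rp -> 0 < dot x a) ->
  weyl_chamber Rp y -> W g -> dot y (x *m g) <= dot y x.
Proof.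
move=> x0 Cy Wg.
pose F := [fset h in fset_set W | (dot y (x *m g) <= dot y (x *m h))%R]%fset.
have gF : g \in F by rewrite !inE lexx andbT mem_weyl mem_set.
have [h] := fset_argmax (fun h => dot (x *m h) beta) gF.
rewrite !inE mem_weyl => /andP[/set_mem Wh hF] hmax.
suff h1 : h = 1%:M by rewrite h1 mulmx1 in hF.
apply: (weyl_chamber_stable x0 Wh) => a aRp; rewrite leNgt; apply/negP => xha.
have aR := posroot_root aRp.
have c0 : 2 / dot a a * dot (x *m h) a < 0.
  by rewrite pmulr_rlt0// divr_gt0// root_dot_gt0.
have := hmax (h *m refl_mx a).
rewrite !inE mem_weyl mem_set/=; last by apply: weyl_mul => //; exact: weyl_refl.
rewrite mulmxA mulmx_refl dotBr dotBl dotZr dotZl.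
have := Cy _ aRp; have := posroot_gt0 aRp.
set t := 2 / _ * _ in c0 *; move=> b0 ya.
have ta : t * dot y a <= 0 by rewrite mulr_le0_ge0// ltW.
have tb : t * dot a beta < 0 by rewrite pmulr_llt0.
rewrite (le_trans hF) => [/(_ isT)|]; last by lra.
by lra.
Qed.

End root_systems_theory.

(** * The Dunkl kernel on real arguments *)

Lemma continuous_mx (T : topologicalType) (K : numFieldType) m n
    (f : T -> 'M[K]_(m, n)) :
  (forall i j, continuous (fun x => f x i j)) -> continuous f.
Proof.
move=> cf x; apply/cvg_ballP => e e0.
have : \forall y \near x, forall i j, ball (f x i j) e (f y i j).
  apply: filter_forall => i; apply: filter_forall => j.
  exact: (cvg_ball (cf i j x)).
by rewrite near_simpl/=; apply: filterS => y; exact.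
Qed.

Section complex_topology.
Context {R : realType}.
Local Notation C := (Num.NumField.sort [the numFieldType of R[i]]).

Lemma continuous_real_complex : continuous (real_complex R : R -> C).
Proof.
move=> x; apply/cvgrPdist_lt => e e0.
have [e0' eE] : 0 < complex.Re e /\ e = real_complex R (complex.Re e).
  by move: e e0 => [r i]; rewrite ltcE/= => /andP[/eqP -> ->].
have : \forall y \near x, `|x - y| < complex.Re e.
  exact: (@cvgr_dist_lt _ _ _ (nbhs x) _ id).
apply: filterS => y xy; rewrite -rmorphB/= normc_def/= expr0n/= addr0 sqrtr_sqr.
by rewrite eE ltcR.
Qed.

Lemma continuous_Re : continuous (@complex.Re R : C -> R).
Proof.
move=> x; apply/(cvgrPdist_lt (FF := nbhs_filter (x : C))) => e e0.
have e0' : 0 < real_complex R e by rewrite ltcR.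
have := nbhsx_ballx (x : C) _ e0'.
apply: (@filterS _ _ (nbhs_filter (x : C))) => y; rewrite -ball_normE/= -raddfB/= -ltcR => /(le_lt_trans _); apply.
exact: normc_ge_Re.
Qed.

Lemma Re_realM (r : R) (z : R[i]) :
  complex.Re (real_complex R r * z) = r * complex.Re z.
Proof. by case: z => a b; rewrite /= mul0r subr0. Qed.

Lemma cplxM m n p (A : 'M[R]_(m, n)) (B : 'M[R]_(n, p)) :
  cplx (A *m B) = cplx A *m cplx B.
Proof. exact: map_mxM. Qed.

Lemma cplxZ n (r : R) (u : 'rV[R]_n) : cplx (r *: u) = real_complex R r *: cplx u.
Proof. exact: map_mxZ. Qed.

Lemma cplx_dot n (u v : 'rV[R]_n) :
  dot (cplx u) (cplx v) = real_complex R (dot u v).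
Proof.
by rewrite /dot rmorph_sum/=; apply: eq_bigr => i _; rewrite !mxE rmorphM.
Qed.

Lemma cplx_refl n (u : 'rV[R]_n) : refl_mx (cplx u) = cplx (refl_mx u).
Proof.
rewrite /refl_mx /cplx map_mxB map_mx1 map_mxZ map_mxM map_trmx; congr (_ - _ *: _).
by rewrite cplx_dot rmorphM fmorphV rmorph_nat.
Qed.

Lemma continuous_cplx n : continuous (@cplx R 1 n : 'rV[R]_n -> 'rV[C]_n).
Proof.
apply: continuous_mx => i j; rewrite (_ : (fun _ => _) =
  real_complex R \o (fun u : 'rV[R]_n => u i j)); last first.
  by apply/funext => u; rewrite /= mxE.
move=> u; apply: continuous_comp; first exact: coord_continuous.
exact: continuous_real_complex.
Qed.

(** Restriction of the complex difference quotient to real increments. From here on all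
    differentiation is over the reals. *)
Lemma is_derive_Re_line n (F : 'rV[C]_n -> C) (y xi : 'rV[R]_n) (s : R) :
  differentiable F (cplx (y + s *: xi)) ->
  is_derive s (1 : R) (fun t : R => complex.Re (F (cplx (y + t *: xi))))
    (complex.Re ('D_(cplx xi) F (cplx (y + s *: xi)))).
Proof.
move=> dF; set p := cplx (y + s *: xi).
have dv : derivable F p (cplx xi) by exact: diff_derivable.
suff h : (fun h : R => h^-1 *: ((fun t : R => complex.Re (F (cplx (y + t *: xi))))
     (h *: (1 : R) + s) - complex.Re (F p))) @ 0^' -->
    complex.Re ('D_(cplx xi) F p).
  by apply: DeriveDef; [apply/cvg_ex; eexists; exact: h|exact: cvg_lim h].
have cC : real_complex R h @[h --> (0 : R)^'] --> (0 : C)^'.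
  move=> A A0; change (nbhs (0 : R) [set h | h != 0 -> A (real_complex R h)]).
  have /(_ [set z | z != 0 -> A z]) := @continuous_real_complex 0.
  rewrite rmorph0 => /(_ A0) h0A.
  apply: (@filterS _ (nbhs (0 : R)) _
    [set h | real_complex R h != 0 -> A (real_complex R h)] _ _ h0A) => h hA h0.
  apply: hA.
  by rewrite fmorph_eq0.
have := cvg_comp _ _ (cvg_comp _ _ cC dv) (@continuous_Re ('D_(cplx xi) F p)).
apply: cvg_trans; apply: near_eq_cvg.
near=> h.
have -> : y + (h *: (1 : R) + s) *: xi = h *: xi + (y + s *: xi).
  by rewrite (_ : h *: (1 : R) = h) ?scalerDl 1?addrCA//; exact: mulr1.
have -> : cplx (h *: xi + (y + s *: xi)) = real_complex R h *: cplx xi + p.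
  by rewrite -cplxZ /cplx map_mxD.
by rewrite /= -fmorphV /GRing.scale/= Re_realM raddfB.
Unshelve. all: by end_near. Qed.

End complex_topology.

Lemma derive_comp_mulmx (K : numFieldType) n (f : 'rV[K]_n -> K) (A : 'M[K]_n) v z :
  'D_v (fun z => f (z *m A)) z = 'D_(v *m A) f (z *m A).
Proof.
rewrite /derive.
suff -> : (fun h => h^-1 *: (((fun z => f (z *m A)) \o shift z) (h *: v) - f (z *m A))) =
  (fun h => h^-1 *: ((f \o shift (z *m A)) (h *: (v *m A)) - f (z *m A))) by [].
by apply/funext => h /=; rewrite mulmxDl scalemxAl.
Qed.

Lemma differentiable_comp_mulmx (K : numFieldType) n (f : 'rV[K]_n -> K)
    (A : 'M[K]_n) z :
  differentiable f (z *m A) -> differentiable (fun z => f (z *m A)) z.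
Proof.
move=> df; apply: (@differentiable_comp _ _ _ _ (mulmxr A) f z) => //.
apply: linear_differentiable; apply: continuous_mx => i j.
rewrite (_ : (fun _ => _) = fun u : 'rV[K]_n => \sum_l u i l * A l j); last first.
  by apply/funext => u; rewrite mxE.
apply: (@continuous_big K 'I_n +%R 0 xpredT _ 'rV[K]_n).
  exact: add_continuous.
move=> l _ u; apply: (@continuousM K 'rV[K]_n (fun x => x i l) (fun=> A l j)).
  exact: coord_continuous.
exact: cst_continuous.
Qed.

Section posroot_sums.
Context {R : realType} {N : nat}.
Variables (Rts Rp : {fset 'rV[R]_N}).
Hypothesis rootR : is_root_system Rts.
Hypothesis posR : is_positive_subsystem Rts Rp.

Lemma sum_posroot (K : zmodType) (F : 'rV[R]_N -> K) :
  (forall a, a \in Rts -> F (- a) = F a) ->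
  \sum_(a <- Rts) F a = (\sum_(a <- Rp) F a) *+ 2.
Proof.
case: posR => beta b0 RpE FN.
rewrite (bigID (mem Rp))/= mulr2n; congr (_ + _).
  rewrite -big_filter; apply: perm_big; apply: uniq_perm => [||a].
  - by rewrite filter_uniq// fset_uniq.
  - exact: fset_uniq.
  - rewrite mem_filter; apply: andb_idr; exact: (posroot_root RpE).
rewrite -big_filter (perm_big [seq - a | a <- Rp])/=; last first.
  apply: uniq_perm => [||a].
  - by rewrite filter_uniq// fset_uniq.
  - by rewrite map_inj_uniq ?fset_uniq//; exact: oppr_inj.
  - rewrite mem_filter; apply/andP/mapP => [[aN aR]|[b bRp ->]].
      by exists (- a); rewrite ?opprK// (posrootN rootR b0 RpE).
    have bR := posroot_root RpE bRp.
    by rewrite -(posrootN rootR b0 RpE) ?(root_opp rootR)// opprK.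
rewrite big_map big_seq [RHS]big_seq; apply: eq_bigr => a /(posroot_root RpE).
exact: FN.
Qed.

(** A reflection permutes all roots but not the positive ones. For an even summand the sum over [Rp]
    is half the sum over [Rts], which is invariant. *)
Lemma sum_posroot_refl (K : numFieldType) (F : 'rV[R]_N -> K) b : b \in Rts ->
  (forall a, a \in Rts -> F (- a) = F a) ->
  \sum_(a <- Rp) F (a *m refl_mx b) = \sum_(a <- Rp) F a.
Proof.
move=> bR FN; apply: (@mulIf _ 2%:R); first by rewrite pnatr_eq0.
rewrite !mulr_natr -!sum_posroot//; last first.
  by move=> a aR; rewrite mulNmx FN// (root_refl rootR).
rewrite -(big_map (fun a => a *m refl_mx b) xpredT F); apply: perm_big.
have rK : involutive (fun a : 'rV[R]_N => a *m refl_mx b).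
  by move=> a; rewrite -mulmxA reflK ?mulmx1// (root_dot_neq0 rootR).
apply: uniq_perm => [||a].
- by rewrite map_inj_uniq ?fset_uniq//; exact: inv_inj.
- exact: fset_uniq.
- apply/mapP/idP => [[c cR ->]|aR]; first by rewrite (root_refl rootR).
  by exists (a *m refl_mx b); rewrite ?(root_refl rootR)// rK.
Qed.

End posroot_sums.

(** * Symmetries of the Dunkl kernel and its equations along real lines *)

Section dunkl_kernel_theory.
Context {R : realType} {N : nat}.
Local Notation C := (Num.NumField.sort [the numFieldType of R[i]]).
Variables (Rts Rp : {fset 'rV[R]_N}) (k : 'rV[R]_N -> R).
Variable E : 'rV[C]_N -> 'rV[C]_N -> C.
Hypothesis rootR : is_root_system Rts.
Hypothesis posR : is_positive_subsystem Rts Rp.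
Hypothesis multk : is_multiplicity Rts k.
Hypothesis dunklE : is_dunkl_kernel Rp k E.
Implicit Types (y xi w : 'rV[R]_N).

Lemma mult_refl a b : a \in Rts -> b \in Rts -> k (a *m refl_mx b) = k a.
Proof. by move=> aR bR; apply: (proj2 multk) => //; exact: weyl_refl. Qed.

Lemma multN a : a \in Rts -> k (- a) = k a.
Proof.
by move=> aR; rewrite -(refl_eqN (root_dot_neq0 rootR aR)) mult_refl.
Qed.

Lemma mult_ge0 a : a \in Rp -> 0 <= k a.
Proof.
by case: posR => b b0 RpE aRp; apply: (proj1 multk); exact: (posroot_root RpE).
Qed.

(** By uniqueness: [z |-> E (c *: z) w] solves the system with parameter [c *: w], since derivatives
    and reflection quotients both pick up the factor [c]. *)
Lemma dunkl_kernelZ (c : C) (z w : 'rV[C]_N) : c != 0 -> E (c *: z) w = E z (c *: w).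
Proof.
move=> c0; have [_ uniq] := dunklE (c *: w).
have [dE opE E0] := (dunklE w).1.
suff /uniq/(congr1 (@^~ z))/esym : dunkl_solution Rp k (c *: w) (fun z => E (c *: z) w) by [].
have mE u : u *m c%:M = c *: u by rewrite mul_mx_scalar.
have fE : (fun z => E (c *: z) w) = fun z => E (z *m c%:M) w.
  by apply/funext => u; rewrite mE.
have dZ v u : 'D_v (fun z => E (c *: z) w) u = c * 'D_v (E ^~ w) (c *: u).
  by rewrite fE (@derive_comp_mulmx _ _ (E ^~ w)) !mE !deriveE// linearZ.
split=> [u|xi u|]; last by rewrite scaler0.
  by rewrite fE; exact: (@differentiable_comp_mulmx _ _ (E ^~ w)).
rewrite dotZr -mulrA -opE /dunkl_op dZ mulrDr; congr (_ + _).
rewrite mulr_sumr; apply: eq_bigr => a _; rewrite [RHS]mulrCA; congr (_ * _).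
rewrite /refl_quotient dotZr mulf_eq0 (negbTE c0)/=.
case: ifPn => a0; first by rewrite dZ mulrCA.
by rewrite scalemxAl invfM mulrCA mulVKf.
Qed.

(** By uniqueness again. Composition with the reflection permutes the roots in the Dunkl operator,
    and the sum over [Rp] survives because each summand is even in the root. *)
Lemma dunkl_kernel_refl (z w : 'rV[C]_N) b : b \in Rts ->
  E (z *m cplx (refl_mx b)) (w *m cplx (refl_mx b)) = E z w.
Proof.
move=> bR; set S := cplx _.
have SS : S *m S^T = 1%:M.
  by rewrite /S /cplx map_trmx tr_refl -map_mxM reflK ?map_mx1// (root_dot_neq0 rootR).
have [_ uniq] := dunklE w; have [dE opE E0] := (dunklE (w *m S)).1.
suff /uniq/(congr1 (@^~ z))/esym : dunkl_solution Rp k w (fun z => E (z *m S) (w *m S)) by [].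
split=> [u|xi u|]; last by rewrite mul0mx.
  exact: (@differentiable_comp_mulmx _ _ (E ^~ (w *m S))).
rewrite -(dot_orthogonal xi w SS) -opE /dunkl_op.
rewrite (@derive_comp_mulmx _ _ (E ^~ (w *m S))); congr (_ + _).
pose F a := real_complex R (k a) * dot (cplx a) (xi *m S) *
  refl_quotient (cplx a) (E ^~ (w *m S)) (u *m S).
rewrite -[RHS](sum_posroot_refl rootR posR (F := F) bR); last first.
  move=> a aR; rewrite /F multN// /refl_quotient /cplx map_mxN -/(cplx a).
  have -> : refl_mx (- cplx a) = refl_mx (cplx a).
    by rewrite -scaleN1r reflZ// oppr_eq0 oner_eq0.
  rewrite !dotNl dotNr opprK oppr_eq0.
  rewrite mulrN mulNr -mulrN; congr (_ * _).
  by case: ifPn => _; [rewrite !deriveE// linearN mulrN opprK|rewrite invrN mulrN opprK].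
rewrite big_seq [RHS]big_seq; apply: eq_bigr => a aRp.
have aR : a \in Rts by case: posR => b' _ RpE; exact: (posroot_root RpE).
rewrite /F mult_refl// cplxM -/S dot_orthogonal// /refl_quotient !dot_orthogonal//.
rewrite (@derive_comp_mulmx _ _ (E ^~ (w *m S))).
by rewrite -!mulmxA refl_conj.
Qed.

(** The Dunkl system has real coefficients at real arguments, so the real part obeys the same
    equations. The parameter comes first, which makes [U w] a function of the space variable. *)
Definition dunkl_real w y : R := complex.Re (E (cplx y) (cplx w)).
Local Notation U := dunkl_real.

Lemma dunkl_real0 w : U w 0 = 1.
Proof.
rewrite /U; have -> : cplx (0 : 'rV[R]_N) = 0 by rewrite /cplx map_mx0.
by case: (dunklE (cplx w)).1 => _ _ ->.
Qed.

Lemma dunkl_realZ (c : R) w y : c != 0 -> U w (c *: y) = U (c *: w) y.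
Proof.
by move=> c0; rewrite /U !cplxZ dunkl_kernelZ// fmorph_eq0.
Qed.

Lemma dunkl_real_refl w y b : b \in Rts ->
  U w (y *m refl_mx b) = U (w *m refl_mx b) y.
Proof.
move=> bR; rewrite /U -(dunkl_kernel_refl (cplx y) _ bR) -!cplxM -mulmxA.
by rewrite reflK ?mulmx1// (root_dot_neq0 rootR).
Qed.

Lemma dunkl_real_continuous w : continuous (U w).
Proof.
have [dE _ _] := (dunklE (cplx w)).1.
move=> y; apply: (@continuous_comp _ _ _ (fun y => E (cplx y) (cplx w)) (@complex.Re R)).
  apply: (@continuous_comp _ _ _ (@cplx R 1 N) (E ^~ (cplx w))).
    exact: continuous_cplx.
  by apply: differentiable_continuous.
exact: continuous_Re.
Qed.

(** The reflected value [U w (p *m refl_mx a)] is rewritten as [U (w *m refl_mx a) p], so that all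
    functions are evaluated at the same point. The reflection quotient [q] is described only through
    its product with [<a, p>], in a form that holds on the walls too. *)
Lemma is_derive_dunkl_real w y xi (s : R) (p := y + s *: xi) :
  exists2 q : 'rV[R]_N -> R,
    is_derive s (1 : R) (fun t => U w (y + t *: xi))
      (dot xi w * U w p - \sum_(a <- Rp) k a * dot a xi * q a) &
    forall a, a \in Rp -> dot a p * q a = U w p - U (w *m refl_mx a) p.
Proof.
have [dE opE _] := (dunklE (cplx w)).1.
exists (fun a => complex.Re (refl_quotient (cplx a) (E ^~ (cplx w)) (cplx p))).
  have := @is_derive_Re_line _ _ _ y xi s (dE (cplx (y + s *: xi))).
  congr is_derive; have := opE (cplx xi) (cplx p); rewrite /dunkl_op -/p.
  move/(canRL (addrK _))/(congr1 (@complex.Re R)) => ->.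
  rewrite raddfB/= cplx_dot Re_realM; congr (_ - _).
  rewrite raddf_sum; apply: eq_bigr => a _.
  by rewrite /= cplx_dot -mulrA !Re_realM mulrA.
move=> a aRp.
have aR : a \in Rts by case: posR => b' _ RpE; exact: (posroot_root RpE).
rewrite -dunkl_real_refl// /refl_quotient cplx_dot fmorph_eq0.
case: ifPn => [/eqP ap|ap].
  by rewrite ap mul0r mulmx_refl (dotC p) ap mulr0 scale0r subr0 subrr.
rewrite -Re_realM mulrCA divff ?fmorph_eq0// mulr1 raddfB/=.
by rewrite cplx_refl -cplxM.
Qed.

(** On a ray, position and direction are proportional, so [<a, y> q a] is [1/s] times a difference
    of two values. The walls leave no singularity; the one at [s = 0] is cleared by multiplying by
    [s]. *)
Lemma is_derive_dunkl_real_ray w y (s : R) : 0 < s ->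
  exists2 D, is_derive s (1 : R) (fun t => U w (t *: y)) D &
  s * D = s * dot y w * U w (s *: y) -
    \sum_(a <- Rp) k a * (U w (s *: y) - U (w *m refl_mx a) (s *: y)).
Proof.
move=> s0; have [q] := is_derive_dunkl_real w 0 y s; rewrite add0r => Dq qE.
eexists; first by move: Dq; congr is_derive; apply/funext => t; rewrite add0r.
rewrite mulrBr mulrA; congr (_ - _).
rewrite big_seq [RHS]big_seq big_distrr/=; apply: eq_bigr => a aRp.
by rewrite -qE// dotZr; ring.
Qed.

Lemma is_derive_dunkl_real_line w y xi (s : R) (p := y + s *: xi) :
  (forall a, a \in Rp -> dot a p != 0) ->
  is_derive s (1 : R) (fun t => U w (y + t *: xi))
    (dot xi w * U w p - \sum_(a <- Rp) k a * dot a xi / dot a p *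
       (U w p - U (w *m refl_mx a) p)).
Proof.
move=> p0; have [q] := is_derive_dunkl_real w y xi s.
move=> + qE; congr is_derive; congr (_ - _).
rewrite big_seq [RHS]big_seq; apply: eq_bigr => a aRp.
by rewrite -qE// -/p; field; exact: p0.
Qed.

End dunkl_kernel_theory.

(** * Estimates along rays *)

Section calculus.
Context {R : realType}.
Implicit Types (f g : R -> R) (s a b c : R).

Lemma is_derive_derive1 f s d : is_derive s (1 : R) f d ->
  is_derive s (1 : R) f ((derive1 f) s) /\ (derive1 f) s = d.
Proof.
move=> fd; have E : (derive1 f) s = d by rewrite derive1E derive_val.
by rewrite E.
Qed.

Lemma derive_le0_nonincreasing f a b : a <= b -> continuous f ->
  (forall s, a < s < b -> exists2 d, is_derive s (1 : R) f d & d <= 0) ->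
  f b <= f a.
Proof.
rewrite le_eqVlt => /predU1P[-> //|ab] cf f'.
have [||c] := @MVT R f (derive1 f) a b ab.
- move=> s; rewrite in_itv/= => /f'[d fd _].
  by have [] := is_derive_derive1 fd.
- exact: continuous_subspaceT.
- rewrite in_itv/= => /f'[d fd d0]; rewrite (is_derive_derive1 fd).2 => fE.
  by rewrite -subr_le0 fE mulr_le0_ge0// subr_ge0 ltW.
Qed.

Lemma is_derive_mulf f g s df dg : is_derive s (1 : R) f df ->
  is_derive s (1 : R) g dg ->
  is_derive s (1 : R) (fun t => f t * g t) (df * g s + f s * dg).
Proof.
move=> fd gd; apply: (is_derive_eq (is_deriveM fd gd)).
by rewrite /GRing.scale/= addrC mulrC.
Qed.

Lemma is_derive_addf f g s df dg : is_derive s (1 : R) f df ->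
  is_derive s (1 : R) g dg ->
  is_derive s (1 : R) (fun t => f t + g t) (df + dg).
Proof. by move=> fd gd; exact: is_deriveD. Qed.

Lemma is_derive_subf f g s df dg : is_derive s (1 : R) f df ->
  is_derive s (1 : R) g dg ->
  is_derive s (1 : R) (fun t => f t - g t) (df - dg).
Proof. by move=> fd gd; exact: is_deriveB. Qed.

Lemma is_derive_cstf c s : is_derive s (1 : R) (fun=> c) 0.
Proof. exact: is_derive_cst. Qed.

Lemma is_derive_idf s : is_derive s (1 : R) (fun t => t) 1.
Proof. exact: is_derive_id. Qed.

Lemma is_derive_mulcf c f s df : is_derive s (1 : R) f df ->
  is_derive s (1 : R) (fun t => c * f t) (c * df).
Proof.
move=> fd; apply: (is_derive_eq (is_derive_mulf (is_derive_cstf c s) fd)).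
by rewrite mul0r add0r.
Qed.

Lemma is_derive_expRM c s :
  is_derive s (1 : R) (fun t => expR (c * t)) (c * expR (c * s)).
Proof.
have h := is_derive_mulcf c (is_derive_idf s).
have := is_derive1_comp (is_derive_expR (c * s)) h.
by rewrite mulr1 mulrC.
Qed.

Lemma continuous_expRM c : continuous (fun t : R => expR (c * t)).
Proof.
move=> s; apply: (@continuous_comp _ _ _ (fun t => c * t) expR).
  exact: mulrl_continuous.
exact: continuous_expR.
Qed.

Lemma is_derive_bigsum (I : eqType) (r : seq I) (F : I -> R -> R) F' s :
  (forall i, i \in r -> is_derive s (1 : R) (F i) (F' i)) ->
  is_derive s (1 : R) (fun t => \sum_(i <- r) F i t) (\sum_(i <- r) F' i).
Proof.
elim: r => [|i r IHr] h.
  rewrite big_nil; have -> : (fun t => \sum_(i <- [::]) F i t) = fun=> 0.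
    by apply/funext => t; rewrite big_nil.
  exact: is_derive_cstf.
rewrite big_cons; have -> : (fun t => \sum_(j <- i :: r) F j t) =
    fun t => F i t + \sum_(j <- r) F j t.
  by apply/funext => t; rewrite big_cons.
apply: is_derive_addf; first by apply: h; rewrite mem_head.
by apply: IHr => j jr; apply: h; rewrite inE jr orbT.
Qed.

Lemma continuous_bigsum (T : topologicalType) (I : eqType) (r : seq I)
    (F : I -> T -> R) :
  (forall i, i \in r -> continuous (F i)) ->
  continuous (fun t => \sum_(i <- r) F i t).
Proof.
elim: r => [|i r IHr] h.
  have -> : (fun t => \sum_(i <- [::]) F i t) = fun=> 0.
    by apply/funext => t; rewrite big_nil.
  exact: cst_continuous.
have -> : (fun t => \sum_(j <- i :: r) F j t) =
    fun t => F i t + \sum_(j <- r) F j t.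
  by apply/funext => t; rewrite big_cons.
move=> t; apply: cvgD; first by apply: h; rewrite mem_head.
by apply: IHr => j jr; apply: h; rewrite inE jr orbT.
Qed.

(** The derivative is asked for in the open interval only, so that the interval may start at the
    singular point 0. The rate [c] may have any sign. *)
Lemma gronwall f a b c : a <= b -> continuous f ->
  (forall s, a < s < b -> exists2 d, is_derive s (1 : R) f d & d <= c * f s) ->
  f b <= f a * expR (c * (b - a)).
Proof.
move=> ab cf f'.
have : f b * expR (- c * b) <= f a * expR (- c * a).
  apply: (@derive_le0_nonincreasing (fun t => f t * expR (- c * t))) => //.
    by move=> t; apply: cvgM; [exact: cf|exact: continuous_expRM].
  move=> s /f'[d fd dle]; eexists.
    exact: is_derive_mulf fd (is_derive_expRM _ _).
  rewrite (mulrA (f s)) -mulrDl pmulr_lle0 ?expR_gt0//; lra.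
move=> h; rewrite mulrBr addrC expRD mulrA -mulNr.
by rewrite -ler_pdivrMr ?expR_gt0// -expRN -mulNr.
Qed.

Lemma is_derive_quadratic f s L c :
  (forall h, `|f (s + h) - f s - L * h| <= c * h ^+ 2) ->
  is_derive s (1 : R) f L.
Proof.
move=> H.
have c0 : 0 <= c by have := le_trans (normr_ge0 _) (H 1); rewrite expr1n mulr1.
suff h : (fun h : R => h^-1 *: (f (h *: (1 : R) + s) - f s)) @ 0^' --> L.
  by apply: DeriveDef; [apply/cvg_ex; eexists; exact: h|exact: cvg_lim h].
apply/cvgrPdist_le => e e0; near=> h.
have h0 : h != 0 by near: h; exact: nbhs_dnbhs_neq.
rewrite (_ : h *: (1 : R) = h); last exact: mulr1.
rewrite /GRing.scale/= (addrC h) distrC.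
have -> : h^-1 * (f (s + h) - f s) - L = h^-1 * (f (s + h) - f s - L * h).
  by field.
rewrite normrM normfV ler_pdivrMl ?normr_gt0//.
rewrite (le_trans (H h))// -real_normK ?num_real// expr2 mulrCA ler_wpM2l//.
suff : `|h| <= e / (c + 1).
  rewrite ler_pdivlMr ?ltr_wpDl// => he; have := normr_ge0 h; lra.
near: h; apply: dnbhs0_le; rewrite divr_gt0// ltr_wpDl//.
Unshelve. all: by end_near. Qed.

(** Squaring makes the negative part differentiable at the origin, as the energy method requires. *)
Lemma is_derive_sqr_min0 x :
  is_derive x (1 : R) (fun t => Num.min t 0 ^+ 2) (2 * Num.min x 0).
Proof.
apply: (@is_derive_quadratic _ _ _ 1) => h; rewrite mul1r ler_norml.
by apply/andP; split; have [] := leP x 0; have [] := leP (x + h) 0; nra.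
Qed.

Lemma is_derive_sqr_min0_comp f s d : is_derive s (1 : R) f d ->
  is_derive s (1 : R) (fun t => Num.min (f t) 0 ^+ 2) (2 * Num.min (f s) 0 * d).
Proof. exact: is_derive1_comp (is_derive_sqr_min0 (f s)). Qed.

Lemma continuous_sqr_min0 (T : topologicalType) (f : T -> R) : continuous f ->
  continuous (fun t => Num.min (f t) 0 ^+ 2).
Proof.
move=> cf t; apply: (@continuous_comp _ _ _ f (fun t => Num.min t 0 ^+ 2)).
  exact: cf.
have /differentiable_continuous h :
    differentiable (fun t : R => Num.min t 0 ^+ 2) (f t).
  by apply/derivable1_diffP; have [] := is_derive_sqr_min0 (f t).
exact: h.
Qed.

End calculus.

(** * Comparison principle and exponential bounds for the Dunkl kernel *)

Section dunkl_estimates.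
Context {R : realType} {N : nat}.
Local Notation C := (Num.NumField.sort [the numFieldType of R[i]]).
Variables (Rts Rp : {fset 'rV[R]_N}) (k : 'rV[R]_N -> R).
Variable E : 'rV[C]_N -> 'rV[C]_N -> C.
Hypothesis rootR : is_root_system Rts.
Hypothesis posR : is_positive_subsystem Rts Rp.
Hypothesis multk : is_multiplicity Rts k.
Hypothesis dunklE : is_dunkl_kernel Rp k E.
Local Notation U := (dunkl_real E).
Local Notation WF := (fset_set (weyl_group Rts)).
Implicit Types (w y lambda eta : 'rV[R]_N) (g : 'M[R]_N) (s t : R).

Lemma fset_weyl_refl g a : g \in WF -> a \in Rp -> g *m refl_mx a \in WF.
Proof.
rewrite !(mem_weyl rootR) => /set_mem Wg aRp; rewrite mem_set//.
apply: weyl_mul => //; apply: weyl_refl.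
by case: posR => b _ RpE; exact: (posroot_root RpE).
Qed.

Lemma fset_weyl1 : 1%:M \in WF.
Proof. by rewrite (mem_weyl rootR) mem_set//; exact: weyl1. Qed.

Lemma fset_weyl_orthogonal g : g \in WF -> g *m g^T = 1%:M.
Proof. by rewrite (mem_weyl rootR) => /set_mem; exact: weyl_orthogonal. Qed.

Lemma sum_weyl_refl a (F : 'M[R]_N -> R) : a \in Rp ->
  \sum_(g <- WF) F (g *m refl_mx a) = \sum_(g <- WF) F g.
Proof.
move=> aRp.
rewrite -(big_map (fun g => g *m refl_mx a) xpredT F); apply: perm_big.
have rK : involutive (fun g : 'M[R]_N => g *m refl_mx a).
  move=> g; rewrite -mulmxA reflK ?mulmx1// (root_dot_neq0 rootR)//.
  by case: posR => b _ RpE; exact: (posroot_root RpE).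
apply: uniq_perm => [||g].
- by rewrite map_inj_uniq ?fset_uniq//; exact: inv_inj.
- exact: fset_uniq.
- apply/mapP/idP => [[h hW ->]|gW]; first exact: fset_weyl_refl.
  by exists (g *m refl_mx a); [exact: fset_weyl_refl|rewrite rK].
Qed.

(** Since [g |-> g *m refl_mx a] is an involution of the group, symmetrising turns twice the inner
    sum into a sum of squares of the differences. *)
Lemma dirichlet_ge0 (m : 'M[R]_N -> R) :
  0 <= \sum_(g <- WF) \sum_(a <- Rp) k a * (m g * (m g - m (g *m refl_mx a))).
Proof.
rewrite exchange_big/= big_seq; apply: sumr_ge0 => a aRp.
rewrite -big_distrr/= mulr_ge0 ?(mult_ge0 posR multk)//.
rewrite -(@pmulr_rge0 _ 2)// mulr_sumr.
have -> : \sum_(g <- WF) 2 * (m g * (m g - m (g *m refl_mx a))) =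
    \sum_(g <- WF) (m g - m (g *m refl_mx a)) ^+ 2.
  apply/eqP; rewrite -subr_eq0 -sumrB; apply/eqP.
  rewrite (eq_bigr (fun g => m g ^+ 2 - m (g *m refl_mx a) ^+ 2)) => [|g _].
    by rewrite sumrB (sum_weyl_refl (fun g => m g ^+ 2))// subrr.
  by ring.
by apply: sumr_ge0 => g _; exact: sqr_ge0.
Qed.

(* Energy estimate for the negative parts: the reflection term is a negative
   semidefinite Dirichlet form because k is nonnegative. *)
Lemma weyl_comparison (D : 'M[R]_N -> R -> R) (b : 'M[R]_N -> R) (A : R) :
  (forall g, g \in WF -> continuous (D g)) ->
  (forall g, g \in WF -> b g <= A) ->
  (forall g, g \in WF -> 0 <= D g 0) ->
  (forall g s, g \in WF -> 0 < s -> exists2 d, is_derive s (1 : R) (D g) d &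
     s * b g * D g s - \sum_(a <- Rp) k a * (D g s - D (g *m refl_mx a) s) <= s * d) ->
  forall g s, g \in WF -> 0 <= s -> 0 <= D g s.
Proof.
move=> Dc bA D0 D' g s gW s0.
pose m g s := Num.min (D g s) 0.
have m_le0 h t : m h t <= 0 by rewrite ge_min lexx orbT.
have m_leD h t : m h t <= D h t by rewrite ge_min lexx.
have mD h t : m h t * D h t = m h t ^+ 2.
  by rewrite /m expr2; case: ltP => _; rewrite ?mul0r.
pose en t := \sum_(g <- WF) m g t ^+ 2.
have en0 : en 0 = 0.
  rewrite /en big_seq big1// => h hW; rewrite /m; have := D0 _ hW.
  by move=> /min_idPr ->; rewrite expr0n.
have : en s <= en 0 * expR (2 * A * (s - 0)).
  apply: gronwall => //.
    by apply: continuous_bigsum => h hW; apply: continuous_sqr_min0; exact: Dc.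
  move=> t /andP[t0 _].
  exists (\sum_(g <- WF) 2 * m g t * derive1 (D g) t).
    apply: is_derive_bigsum => h hW; apply: is_derive_sqr_min0_comp.
    by have [d hd _] := D' h t hW t0; have [] := is_derive_derive1 hd.
  rewrite -(ler_pM2l t0) mulr_sumr.
  have le1 h : h \in WF -> t * (2 * m h t * derive1 (D h) t) <=
      2 * t * A * m h t ^+ 2 -
      2 * \sum_(a <- Rp) k a * (m h t * (m h t - m (h *m refl_mx a) t)).
    move=> hW; have [d hd dle] := D' h t hW t0.
    rewrite (is_derive_derive1 hd).2.
    have -> : t * (2 * m h t * d) = 2 * (m h t * (t * d)) by ring.
    have -> : 2 * t * A * m h t ^+ 2 = 2 * (t * A * m h t ^+ 2) by ring.
    rewrite -mulrBr ler_pM2l//; apply: le_trans (ler_wnM2l (m_le0 h t) dle) _.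
    rewrite mulrBr lerB//.
      rewrite mulrCA mD ler_wpM2r ?sqr_ge0// ler_wpM2l ?(ltW t0)//.
      exact: bA.
    (* On the diagonal [m * D = m ^+ 2]; in the reflected term [D] may be replaced by its negative
       part, because [m h t <= 0] and [m <= D]. *)
    rewrite mulr_sumr big_seq [leRHS]big_seq; apply: ler_sum => a aRp.
    rewrite [leRHS]mulrCA ler_wpM2l ?(mult_ge0 posR multk)//.
    rewrite !mulrBr mD -expr2 lerD2l lerN2.
    exact: ler_wnM2l.
  rewrite big_seq; apply: le_trans (ler_sum _ le1) _; rewrite -big_seq.
  rewrite sumrB -!mulr_sumr -/(en t) mulrA (mulrC t) -[leRHS]subr0 mulrAC.
  apply: lerB; last by rewrite mulr_ge0// dirichlet_ge0.
  by rewrite le_eqVlt; apply/orP; left; apply/eqP; ring.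
rewrite en0 mul0r => en_le0; have : m g s ^+ 2 = 0.
  apply/eqP; rewrite eq_le sqr_ge0 andbT (le_trans _ en_le0)//.
  rewrite /en (big_fsetD1 g gW)/= lerDl sumr_ge0// => h _; exact: sqr_ge0.
by move/eqP; rewrite sqrf_eq0 => /eqP mgs; have := m_leD g s; rewrite mgs.
Qed.

Lemma continuous_dunkl_ray w y : continuous (fun s : R => U w (s *: y)).
Proof.
move=> s; apply: (@continuous_comp _ _ _ (fun s => s *: y) (U w)).
  exact: scalel_continuous.
exact: (dunkl_real_continuous dunklE).
Qed.

Lemma dot_weyl_normE y w g : g \in WF -> `|dot y (w *m g)| <= normE y * normE w.
Proof.
move=> gW; apply: le_trans (CauchySchwarz_normE _ _) _.
by rewrite normE_orthogonal//; exact: fset_weyl_orthogonal.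
Qed.

Lemma ray_eqn w y g s : g \in WF -> 0 < s ->
  exists2 d, is_derive s (1 : R) (fun t => U (w *m g) (t *: y)) d &
  s * d = s * dot y (w *m g) * U (w *m g) (s *: y) -
   \sum_(a <- Rp) k a * (U (w *m g) (s *: y) - U (w *m (g *m refl_mx a)) (s *: y)).
Proof.
move=> gW s0.
have [d dd dE] := is_derive_dunkl_real_ray rootR posR multk dunklE (w *m g) y s0.
by exists d => //; rewrite dE; congr (_ - _); apply: eq_bigr => a _; rewrite mulmxA.
Qed.

(** Taking [e^{-Ms}] for every component makes all reflection differences vanish and leaves a
    subsolution, because every rate is at least [-M]. The upper bound below uses the supersolution
    [e^{Ms}] in the same way. *)
Lemma dunkl_real_weyl_ge w y M g s :
  (forall g, g \in WF -> - M <= dot y (w *m g)) -> g \in WF -> 0 <= s ->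
  expR (- M * s) <= U (w *m g) (s *: y).
Proof.
move=> MP gW s0; rewrite -subr_ge0.
apply: (@weyl_comparison (fun g s => U (w *m g) (s *: y) - expR (- M * s))
  (fun g => dot y (w *m g)) (normE y * normE w)) => //.
- by move=> h hW t; apply: cvgB; [exact: continuous_dunkl_ray|exact: continuous_expRM].
- by move=> h hW; exact: le_trans (ler_norm _) (dot_weyl_normE _ _ hW).
- by move=> h hW; rewrite scale0r (dunkl_real0 dunklE) mulr0 expR0 subrr.
move=> h t hW t0; have [d dd dE] := ray_eqn w y hW t0.
eexists; first exact: is_derive_subf dd (is_derive_expRM _ _).
rewrite (mulrBr t d) dE; set S := \sum_(a <- Rp) _; set S' := \sum_(a <- Rp) _.
have -> : S = S' by apply: eq_bigr => a _; congr (_ * _); ring.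
rewrite -subr_ge0.
rewrite [leRHS](_ : _ = t * expR (- M * t) * (dot y (w *m h) + M)); last by ring.
by rewrite !mulr_ge0 ?expR_ge0 ?(ltW t0)//; have := MP _ hW; lra.
Qed.

Lemma dunkl_real_weyl_le w y M g s :
  (forall g, g \in WF -> dot y (w *m g) <= M) -> g \in WF -> 0 <= s ->
  U (w *m g) (s *: y) <= expR (M * s).
Proof.
move=> MP gW s0; rewrite -subr_ge0.
apply: (@weyl_comparison (fun g s => expR (M * s) - U (w *m g) (s *: y))
  (fun g => dot y (w *m g)) M) => //.
- by move=> h hW t; apply: cvgB; [exact: continuous_expRM|exact: continuous_dunkl_ray].
- by move=> h hW; rewrite scale0r (dunkl_real0 dunklE) mulr0 expR0 subrr.
move=> h t hW t0; have [d dd dE] := ray_eqn w y hW t0.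
eexists; first exact: is_derive_subf (is_derive_expRM _ _) dd.
rewrite (mulrBr t _ d) dE; set S := \sum_(a <- Rp) _; set S' := \sum_(a <- Rp) _.
have -> : S' = - S by rewrite -sumrN; apply: eq_bigr => a _; ring.
rewrite -subr_ge0.
rewrite [leRHS](_ : _ = t * expR (M * t) * (M - dot y (w *m h))); last by ring.
by rewrite !mulr_ge0 ?expR_ge0 ?(ltW t0)//; have := MP _ hW; lra.
Qed.

(** This is the source of continuity in the spectral parameter. The difference solves the system of
    [w'] with a source of size at most [dl e^{Ms}], and [dl s e^{Ms}] is a supersolution for such a
    source. The sign [e] yields both halves of the absolute value. *)
Lemma dunkl_real_diff_weyl w w' y M dl g s :
  (forall g, g \in WF -> - M <= dot y (w *m g) <= M) ->
  (forall g, g \in WF -> dot y (w' *m g) <= M) ->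
  (forall g, g \in WF -> `|dot y ((w' - w) *m g)| <= dl) ->
  g \in WF -> 0 <= s ->
  `|U (w' *m g) (s *: y) - U (w *m g) (s *: y)| <= dl * s * expR (M * s).
Proof.
move=> wM w'M wdl gW s0.
have wM' h : h \in WF -> dot y (w *m h) <= M by move=> /wM/andP[].
have wMN h : h \in WF -> - M <= dot y (w *m h) by move=> /wM/andP[].
suff H (e : R) : e ^+ 2 = 1 ->
    0 <= dl * s * expR (M * s) + e * (U (w' *m g) (s *: y) - U (w *m g) (s *: y)).
  have := H 1; have := H (- 1).
  rewrite sqrrN expr1n => /(_ erefl) h1 /(_ erefl) h2.
  by rewrite ler_norml; apply/andP; split; lra.
move=> e2.
apply: (@weyl_comparison (fun g s => dl * s * expR (M * s) +
    e * (U (w' *m g) (s *: y) - U (w *m g) (s *: y)))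
  (fun g => dot y (w' *m g)) M) => //.
- move=> h hW t; apply: cvgD.
    apply: cvgM; last exact: continuous_expRM.
    exact: mulrl_continuous.
  apply: cvgM; first exact: cvg_cst.
  by apply: cvgB; exact: continuous_dunkl_ray.
- by move=> h hW; rewrite !scale0r !(dunkl_real0 dunklE) subrr !mulr0 mul0r addr0.
move=> h t hW t0.
have [d dd dE] := ray_eqn w y hW t0; have [d' dd' dE'] := ray_eqn w' y hW t0.
have Dp := is_derive_mulf (is_derive_mulcf dl (is_derive_idf t)) (is_derive_expRM M t).
eexists; first exact: is_derive_addf Dp (is_derive_mulcf e (is_derive_subf dd' dd)).
set u := U (w *m h) _ in dE *; set u' := U (w' *m h) _ in dE' *.
set S := \sum_(a <- Rp) _ in dE; set S' := \sum_(a <- Rp) _ in dE'.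
set S'' := \sum_(a <- Rp) _.
have -> : S'' = e * (S' - S).
  rewrite mulrBr !mulr_sumr -sumrB; apply: eq_bigr => a _.
  by rewrite -/u -/u'; ring.
have -> : t * (dl * 1 * expR (M * t) + dl * t * (M * expR (M * t)) + e * (d' - d)) =
  t * dl * expR (M * t) + t * M * (dl * t * expR (M * t)) + e * (t * d' - t * d).
  by ring.
rewrite dE dE' -subr_ge0.
have -> : dot y (w' *m h) = dot y (w *m h) + dot y ((w' - w) *m h).
  by rewrite mulmxBl dotBr addrC subrK.
rewrite [leRHS](_ : _ = t * ((M - (dot y (w *m h) + dot y ((w' - w) *m h))) *
   (dl * t * expR (M * t)) + (dl * expR (M * t) + e * dot y ((w' - w) *m h) * u))); last first.
  by ring.
have dl0 : 0 <= dl by apply: le_trans (wdl _ hW).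
rewrite mulr_ge0 ?(ltW t0)// addr_ge0//.
  rewrite !mulr_ge0 ?expR_ge0 ?(ltW t0)//.
  by have := w'M _ hW; rewrite mulmxBl dotBr; lra.
have u0 : 0 <= u by apply: le_trans (dunkl_real_weyl_ge wMN hW (ltW t0)); exact: expR_ge0.
have uM : u <= expR (M * t) by exact: dunkl_real_weyl_le (ltW t0).
have /ler_normlP[] : `|e * dot y ((w' - w) *m h)| <= dl.
  rewrite normrM (_ : `|e| = 1) ?mul1r ?wdl//.
  by apply/eqP; rewrite -(@eqrXn2 _ 2)// ?expr1n ?real_normK ?num_real// e2.
have := expR_ge0 (M * t); move: (expR _) uM => X; move: (e * dot _ _) => Y; nra.
Qed.

Lemma dunkl_real_ge w y : expR (- (normE y * normE w)) <= U w y.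
Proof.
have := @dunkl_real_weyl_ge w y (normE y * normE w) 1%:M 1.
rewrite mulmx1 scale1r mulr1; apply => //; last exact: fset_weyl1.
by move=> g /(dot_weyl_normE y w)/ler_normlP[]; lra.
Qed.

Lemma dunkl_real_gt0 w y : 0 < U w y.
Proof. exact: lt_le_trans (expR_gt0 _) (dunkl_real_ge w y). Qed.

Lemma dunkl_real_le w y M : (forall g, g \in WF -> dot y (w *m g) <= M) ->
  forall g, g \in WF -> U (w *m g) y <= expR M.
Proof.
move=> MP g gW; have := dunkl_real_weyl_le MP gW ler01.
by rewrite scale1r mulr1.
Qed.

Lemma dunkl_real_le_normE w y : U w y <= expR (normE y * normE w).
Proof.
rewrite -{1}[w]mulmx1; apply: dunkl_real_le; last exact: fset_weyl1.
by move=> g /(dot_weyl_normE y w)/ler_normlP[].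
Qed.

Lemma dunkl_real_diff w w' y :
  `|U w' y - U w y| <=
  normE y * normE (w' - w) * expR (normE y * (normE w + normE w')).
Proof.
have := @dunkl_real_diff_weyl w w' y (normE y * (normE w + normE w'))
  (normE y * normE (w' - w)) 1%:M 1.
rewrite !mulmx1 !scale1r !mulr1; apply => //; last exact: fset_weyl1.
- move=> g gW; rewrite -ler_norml (le_trans (dot_weyl_normE _ _ gW))//.
  by rewrite ler_wpM2l ?normE_ge0// lerDl normE_ge0.
- move=> g gW; rewrite (le_trans (ler_norm _))// (le_trans (dot_weyl_normE _ _ gW))//.
  by rewrite ler_wpM2l ?normE_ge0// lerDr normE_ge0.
- by move=> g gW; exact: dot_weyl_normE.
Qed.

End dunkl_estimates.

(** * Slow variation of the Bessel function in the direction of the drift *)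

Lemma open_cone (R : realType) n (x : 'rV[R]_n) (F : seq 'rV[R]_n) :
  (forall v, v \in F -> 0 < dot x v) ->
  exists dl c : R, [/\ 0 < dl, 0 < c &
    forall y, normE (y - x) <= dl -> forall v, v \in F -> c <= dot y v].
Proof.
elim: F => [|v F IHF] xF; first by exists 1, 1; split.
have [|dl [c [dl0 c0 H]]] := IHF.
  by move=> u uF; apply: xF; rewrite inE uF orbT.
have xv : 0 < dot x v by apply: xF; rewrite mem_head.
have v1 : 0 < 2 * (normE v + 1) by rewrite mulr_gt0// ltr_wpDl ?normE_ge0.
exists (Num.min dl (dot x v / (2 * (normE v + 1)))), (Num.min c (dot x v / 2)).
split; [by rewrite lt_min dl0 divr_gt0|by rewrite lt_min c0 divr_gt0|].
move=> y; rewrite le_min => /andP[ydl yv] u; rewrite inE => /predU1P[->|uF].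
  rewrite ge_min; apply/orP; right.
  have /ler_normlP[h _] := CauchySchwarz_normE (y - x) v.
  move: yv; rewrite ler_pdivlMr// => yv.
  have := normE_ge0 v; have := normE_ge0 (y - x).
  by move: h; rewrite dotBl; nra.
by rewrite ge_min (H _ ydl _ uF).
Qed.

Section dunkl_asymptotics.
Context {R : realType} {N : nat}.
Local Notation C := (Num.NumField.sort [the numFieldType of R[i]]).
Variables (Rts Rp : {fset 'rV[R]_N}) (k : 'rV[R]_N -> R).
Variable E : 'rV[C]_N -> 'rV[C]_N -> C.
Hypothesis rootR : is_root_system Rts.
Hypothesis posR : is_positive_subsystem Rts Rp.
Hypothesis multk : is_multiplicity Rts k.
Hypothesis dunklE : is_dunkl_kernel Rp k E.
Variable lambda : 'rV[R]_N.
Hypothesis lambda_gt0 : forall a, a \in Rp -> 0 < dot lambda a.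
Local Notation U := (dunkl_real E).
Local Notation WF := (fset_set (weyl_group Rts)).
Local Notation WF' := (WF `\ 1%:M)%fset.
Local Notation gam := (dunkl_gamma Rp k).
Implicit Types (y xi eta : 'rV[R]_N) (g : 'M[R]_N) (s t : R).

Let U_gt0 w y : 0 < U w y := dunkl_real_gt0 rootR posR multk dunklE w y.

Lemma gamma_ge0 : 0 <= gam.
Proof.
rewrite /dunkl_gamma big_seq; apply: sumr_ge0 => a.
exact: (mult_ge0 posR multk).
Qed.

Lemma sum_weyl1 (F : 'M[R]_N -> R) :
  \sum_(g <- WF) F g = F 1%:M + \sum_(g <- WF') F g.
Proof. by rewrite (big_fsetD1 1%:M)//; exact: fset_weyl1. Qed.

(** As [g] is orthogonal, the product is half the squared norm of [lambda - lambda *m g], which is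
    nonzero because [lambda] has trivial stabiliser. *)
Lemma dot_weyl_lt g : g \in WF' -> 0 < dot lambda (lambda - lambda *m g).
Proof.
rewrite !inE => /andP[g1 gW].
have Wg : weyl_group Rts g by move: gW; rewrite (mem_weyl rootR) => /set_mem.
have : 0 < dot (lambda - lambda *m g) (lambda - lambda *m g).
  rewrite dot_gt0 subr_eq0; apply: contra_neq g1 => lg.
  case: posR => beta b0 RpE.
  apply: (weyl_chamber_stable rootR b0 RpE lambda_gt0 Wg) => a aRp.
  by rewrite -lg ltW// lambda_gt0.
rewrite !(dotBl, dotBr) dot_orthogonal ?(weyl_orthogonal rootR)//.
by rewrite (dotC (lambda *m g)); lra.
Qed.

(** Let [V0] be the component [g = 1], [V1] the sum of the others and [c0] the gap in the rates.
    Then [V1' <= (<eta, lambda> - c0) V1 + (gam / s) V0] and [V0' >= (<eta, lambda> - gam / s) V0],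
    so [V1] settles at the order [gam / (c0 s)] relative to [V0]. Precisely, [Q = s V1 - K V0] is
    nonpositive at [s1] and stays so by [gronwall]. *)
Lemma dunkl_cone_estimate : exists dl K s1 : R, [/\ 0 < dl, 0 <= K, 0 < s1 &
  forall eta s, normE (eta - lambda) <= dl -> s1 <= s ->
    (forall a, a \in Rp -> 0 < dot eta a) /\
    \sum_(g <- WF') U (lambda *m g) (s *: eta) <= K / s * U lambda (s *: eta)].
Proof.
have [|dl [c0 [dl0 c0_gt0 cone]]] := @open_cone R N lambda
    (enum_fset Rp ++ [seq lambda - lambda *m g | g <- WF']).
  move=> v; rewrite mem_cat => /orP[|/mapP[g gW ->]]; first exact: lambda_gt0.
  exact: dot_weyl_lt.
have gam0 := gamma_ge0.
pose M s := s * (normE lambda + dl) * normE lambda.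
(* Beyond [s1] one has [t c0 >= 2 + 4 gam]: the 2 pays for differentiating the factor [s] in [Q],
   the [4 gam] for the loss of [V0] by reflections. *)
pose s1 := (2 + 4 * gam) / c0.
have s10 : 0 < s1 by rewrite divr_gt0//; lra.
(* [K1] bounds [s1 V1 / V0] at [s1] uniformly in the cone, as [V1 <= #|WF'| e^{M s1}] and
   [V0 >= e^{- M s1}] there. In [K], the summand [4 gam / c0] absorbs what flows from [V0] into
   [V1]. *)
pose K1 := s1 * (#|` WF'|%:R * expR (M s1) * expR (M s1)).
have K10 : 0 <= K1 by rewrite mulr_ge0 ?(ltW s10)// !mulr_ge0 ?expR_ge0.
pose K := 4 * gam / c0 + K1.
have K0 : 0 <= K by rewrite addr_ge0// divr_ge0 ?(ltW c0_gt0)// mulr_ge0.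
exists dl, K, s1; split=> // eta s eta_dl s1s.
have s0 : 0 < s by exact: lt_le_trans s1s.
have etaRp a : a \in Rp -> 0 < dot eta a.
  move=> aRp; apply: lt_le_trans c0_gt0 _; apply: cone => //.
  by rewrite mem_cat aRp.
split=> //; rewrite mulrAC ler_pdivlMr// mulrC.
have etaW g : g \in WF' -> dot eta (lambda *m g) <= dot eta lambda - c0.
  move=> gW; rewrite lerBrDr addrC -lerBrDr -dotBr; apply: cone => //.
  by rewrite mem_cat; apply/orP; right; apply/mapP; exists g.
pose V0 s := U lambda (s *: eta).
pose V1 s := \sum_(g <- WF') U (lambda *m g) (s *: eta).
pose Q s := s * V1 s - K * V0 s.
have V00 t : 0 <= V0 t by exact/ltW/U_gt0.
have V10 t : 0 <= V1 t by apply: sumr_ge0 => g _; exact/ltW/U_gt0.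
suff : Q s <= Q s1 * expR ((dot eta lambda - c0 / 2) * (s - s1)).
  move=> /le_trans Qs; rewrite -subr_le0; apply: Qs.
  rewrite mulr_le0_ge0 ?expR_ge0// subr_le0.
  have etaN : normE (s1 *: eta) * normE lambda <= M s1.
    rewrite normEZ gtr0_norm// /M -2!mulrA ler_wpM2l ?(ltW s10)//.
    rewrite ler_wpM2r ?normE_ge0// -[eta](subrK lambda) addrC.
    by rewrite (le_trans (ler_normED _ _))// lerD2l.
  have V1le : V1 s1 <= #|` WF'|%:R * expR (M s1).
    rewrite /V1 big_seq; apply: (@le_trans _ _ (\sum_(g <- WF' | g \in WF') expR (M s1))).
      apply: ler_sum => g; rewrite !inE => /andP[_ gW].
      apply: le_trans (dunkl_real_le_normE rootR posR multk dunklE _ _) _.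
      by rewrite ler_expR normE_orthogonal//; exact: (fset_weyl_orthogonal rootR gW).
    by rewrite -big_seq big_const_seq count_predT iter_addr_0 mulr_natl.
  have V0ge : 1 <= expR (M s1) * V0 s1.
    rewrite -ler_pdivrMl ?expR_gt0// mulr1 -expRN.
    apply: le_trans (dunkl_real_ge rootR posR multk dunklE _ _).
    by rewrite ler_expR lerN2.
  apply: (@le_trans _ _ (K1 * V0 s1)); last first.
    by rewrite ler_wpM2r// /K lerDr divr_ge0 ?(ltW c0_gt0)// mulr_ge0.
  rewrite /K1 -[leRHS]mulrA; apply: ler_wpM2l; first exact: ltW.
  apply: le_trans V1le _; rewrite -[leRHS]mulrA.
  by rewrite ler_peMr// mulr_ge0// expR_ge0.
apply: gronwall => //.
  move=> t; apply: cvgB.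
    apply: cvgM; first exact: cvg_id.
    by apply: continuous_bigsum => g _; exact: (continuous_dunkl_ray dunklE).
  by apply: cvgM; [exact: cvg_cst|exact: (continuous_dunkl_ray dunklE)].
move=> t /andP[s1t _]; have t0 : 0 < t by exact: lt_trans s1t.
have eqn g : g \in WF -> exists2 d,
    is_derive t (1 : R) (fun t => U (lambda *m g) (t *: eta)) d &
    t * d = t * dot eta (lambda *m g) * U (lambda *m g) (t *: eta)
      - gam * U (lambda *m g) (t *: eta)
      + \sum_(a <- Rp) k a * U (lambda *m (g *m refl_mx a)) (t *: eta).
  move=> gW; have [d dd dE] := ray_eqn rootR posR multk dunklE lambda eta gW t0.
  exists d => //; rewrite dE -addrA; congr (_ + _).
  rewrite /dunkl_gamma mulr_suml -sumrN -sumrN -big_split/=.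
  by apply: eq_bigr => a _; ring.
have [d0 dd0 d0E] := eqn _ (fset_weyl1 rootR); rewrite mulmx1 in dd0 d0E.
pose d g := derive1 (fun t => U (lambda *m g) (t *: eta)) t.
have dd1 : is_derive t (1 : R) V1 (\sum_(g <- WF') d g).
  apply: is_derive_bigsum => g; rewrite !inE => /andP[_ gW].
  by have [d' dd' _] := eqn _ gW; have [] := is_derive_derive1 dd'.
eexists.
  exact: is_derive_subf (is_derive_mulf (is_derive_idf t) dd1) (is_derive_mulcf K dd0).
have d0ge : t * dot eta lambda * V0 t - gam * V0 t <= t * d0.
  rewrite d0E lerDl big_seq; apply: sumr_ge0 => a aRp.
  by rewrite mulr_ge0 ?(mult_ge0 posR multk)// ltW// U_gt0.
have d1le : t * (\sum_(g <- WF') d g) <=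
    t * (dot eta lambda - c0) * V1 t + gam * V0 t.
  have : t * (\sum_(g <- WF') d g) <=
      \sum_(g <- WF') (t * (dot eta lambda - c0) * U (lambda *m g) (t *: eta)
      - gam * U (lambda *m g) (t *: eta)
      + \sum_(a <- Rp) k a * U (lambda *m (g *m refl_mx a)) (t *: eta)).
    rewrite mulr_sumr big_seq [leRHS]big_seq; apply: ler_sum => g gW'.
    have gW : g \in WF by move: gW'; rewrite !inE => /andP[].
    have [d' dd' dE] := eqn _ gW; rewrite /d (is_derive_derive1 dd').2 dE.
    rewrite lerD2r lerD2r ler_wpM2r ?(ltW (U_gt0 _ _))//.
    by rewrite ler_wpM2l ?(ltW t0)// etaW.
  move/le_trans; apply; rewrite big_split/= sumrB -!mulr_sumr -/(V1 t) -addrA lerD2l.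
  suff : \sum_(g <- WF') \sum_(a <- Rp) k a * U (lambda *m (g *m refl_mx a)) (t *: eta)
     <= gam * (V0 t + V1 t) by lra.
  rewrite exchange_big/= /dunkl_gamma mulr_suml big_seq [leRHS]big_seq.
  apply: ler_sum => a aRp; rewrite -mulr_sumr ler_wpM2l ?(mult_ge0 posR multk)//.
  (* For fixed [a] the reflected terms run through the group with one element omitted, so they sum
     to at most [V0 + V1]. *)
  have -> : V0 t + V1 t = \sum_(g <- WF) U (lambda *m g) (t *: eta).
    by rewrite sum_weyl1 mulmx1.
  rewrite -(sum_weyl_refl rootR posR _ aRp) [leRHS]sum_weyl1 lerDr.
  exact/ltW/U_gt0.
rewrite -(ler_pM2l t0).
have tc0 : 2 + 4 * gam <= t * c0 by rewrite -ler_pdivrMr// ltW.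
have Kc0 : 4 * gam <= K * c0.
  by rewrite /K (mulrDl (4 * gam / c0)) divfK ?lt0r_neq0// lerDl mulr_ge0// ltW.
have h1 : t * (t * \sum_(g <- WF') d g) <=
    t * (t * (dot eta lambda - c0) * V1 t + gam * V0 t).
  by rewrite ler_wpM2l// ltW.
have h2 : K * (t * dot eta lambda * V0 t - gam * V0 t) <= K * (t * d0).
  by rewrite ler_wpM2l.
have h3 : 0 <= t * V1 t * (t * c0 - 2) by rewrite !mulr_ge0 ?(ltW t0)//; lra.
have h4 : 0 <= t * V0 t * (K * c0 - 4 * gam) by rewrite !mulr_ge0 ?(ltW t0)//; lra.
have h5 : 0 <= K * V0 t * (t * c0 - 4 * gam) by rewrite !mulr_ge0//; lra.
rewrite /Q -subr_ge0.
set D1 := \sum_(g <- WF') d g in h1 h2 *.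
rewrite [leRHS](_ : _ =
  (t * (t * (dot eta lambda - c0) * V1 t + gam * V0 t) - t * (t * D1)) +
  (K * (t * d0) - K * (t * dot eta lambda * V0 t - gam * V0 t)) +
  (t * V1 t * (t * c0 - 2)) / 2 + (t * V0 t * (K * c0 - 4 * gam)) / 4 +
  (K * V0 t * (t * c0 - 4 * gam)) / 4); last by field.
by lra.
Qed.

Definition dunkl_psi y := expR (- dot y lambda) * \sum_(g <- WF) U (lambda *m g) y.
Local Notation psi := dunkl_psi.

Lemma dunkl_psi_ge1 y : expR (- dot y lambda) * U lambda y <= psi y.
Proof.
rewrite ler_wpM2l ?expR_ge0// sum_weyl1 mulmx1 lerDl sumr_ge0// => g _.
exact/ltW/U_gt0.
Qed.

Lemma dunkl_psi_gt0 y : 0 < psi y.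
Proof.
apply: lt_le_trans (dunkl_psi_ge1 y); by rewrite mulr_gt0 ?expR_gt0 ?U_gt0.
Qed.

Lemma dunkl_psi_le y : weyl_chamber Rp y -> psi y <= #|` WF|%:R.
Proof.
move=> Cy; rewrite /psi expRN mulrC ler_pdivrMr ?expR_gt0// big_seq.
apply: (@le_trans _ _ (\sum_(g <- WF | g \in WF) expR (dot y lambda))).
  apply: ler_sum => g gW.
  apply: (dunkl_real_le rootR posR multk dunklE) => // h.
  rewrite (mem_weyl rootR) => /set_mem Wh.
  by case: posR => beta b0 RpE; exact: (dot_weyl_le rootR b0 RpE).
by rewrite -big_seq big_const_seq count_predT iter_addr_0 mulr_natl.
Qed.

(** The component [g = 1] satisfies [V0' >= - (gam / t) V0], and [gam / t <= e] from [s2] on;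
    [gronwall] is applied to [- V0]. This bounds the denominator [psi (t lambda)] from below when
    the numerator is taken far from the ray, where any small exponential loss is acceptable. *)
Lemma dunkl_psi_ray_ge (e : R) : 0 < e ->
  exists c s2 : R, [/\ 0 < c, 0 < s2 &
   forall t, s2 <= t -> c * expR (- (e * t)) <= psi (t *: lambda)].
Proof.
move=> e0; pose s2 := gam / e + 1.
have s20 : 0 < s2 by rewrite ltr_wpDl// divr_ge0 ?gamma_ge0// ltW.
pose V0 t := expR (- dot lambda lambda * t) * U lambda (t *: lambda).
have V00 t : 0 < V0 t by rewrite mulr_gt0 ?expR_gt0 ?U_gt0.
exists (V0 s2), s2; split=> // t s2t.
have t0 : 0 < t by exact: lt_le_trans s2t.
apply: (@le_trans _ _ (V0 t)); last first.
  rewrite (_ : V0 t = expR (- dot (t *: lambda) lambda) * U lambda (t *: lambda)).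
    exact: dunkl_psi_ge1.
  by rewrite /V0 dotZl; congr (expR _ * _); ring.
apply: (@le_trans _ _ (V0 s2 * expR (- e * (t - s2)))).
  by rewrite ler_wpM2l ?(ltW (V00 _))// ler_expR; nra.
rewrite -lerN2 -(mulNr (V0 s2)).
apply: (@gronwall _ (fun t => - V0 t)) => //.
  move=> s; apply: cvgN; apply: cvgM; first exact: continuous_expRM.
  exact: (continuous_dunkl_ray dunklE).
move=> s /andP[s2s _]; have s0 : 0 < s by exact: lt_trans s2s.
have [d dd dE] := ray_eqn rootR posR multk dunklE lambda lambda (fset_weyl1 rootR) s0.
rewrite mulmx1 in dd dE.
exists (- (- dot lambda lambda * expR (- dot lambda lambda * s) * U lambda (s *: lambda)
     + expR (- dot lambda lambda * s) * d)).
  by apply: is_deriveN; exact: is_derive_mulf (is_derive_expRM _ _) dd.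
rewrite -(ler_pM2l s0).
set X := expR (- dot lambda lambda * s); have X0 : 0 <= X by exact: expR_ge0.
have sd : s * dot lambda lambda * U lambda (s *: lambda) - gam * U lambda (s *: lambda) <= s * d.
  rewrite dE lerD2l lerN2 /dunkl_gamma mulr_suml big_seq [leRHS]big_seq.
  apply: ler_sum => a aRp; rewrite ler_wpM2l ?(mult_ge0 posR multk)//.
  by rewrite gerBl ltW// U_gt0.
have gs : gam <= e * s.
  have : s2 * e <= s * e by rewrite ler_wpM2r ?ltW.
  by rewrite /s2 mulrDl divfK ?lt0r_neq0//; lra.
have h1 : X * (s * dot lambda lambda * U lambda (s *: lambda) -
   gam * U lambda (s *: lambda)) <= X * (s * d) by rewrite ler_wpM2l.
have h2 : 0 <= X * U lambda (s *: lambda) * (e * s - gam).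
  by rewrite !mulr_ge0 ?(ltW (U_gt0 _ _))// subr_ge0.
by rewrite /V0 -/X; move: h1 h2; lra.
Qed.

(** Integrate the logarithmic derivative over the segment from [t lambda] to [t lambda + xi]; its
    points are [t eta] with [eta] in the cone. Differentiating [e^{-<y, lambda>}] cancels the term
    [g = 1]. The others carry coefficients of size at most [2 |lambda| |xi|] and sum to at most
    [K / t] times the whole, whence the constant. *)
Lemma dunkl_psi_slow_variation : exists dl c s1 : R, [/\ 0 < dl, 0 <= c, 0 < s1 &
  forall t xi, s1 <= t -> normE xi <= dl * t ->
    [/\ weyl_chamber Rp (t *: lambda + xi),
    psi (t *: lambda) * expR (- (c * normE xi / t)) <= psi (t *: lambda + xi) &
    psi (t *: lambda + xi) <= psi (t *: lambda) * expR (c * normE xi / t)]].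
Proof.
have [dl [K [s1 [dl0 K0 s10 H]]]] := dunkl_cone_estimate.
exists dl, (2 * normE lambda * K), s1; split=> //.
  by rewrite !mulr_ge0 ?normE_ge0.
move=> t xi s1t xi_dl; have t0 : 0 < t by exact: lt_le_trans s1t.
pose p s := t *: lambda + s *: xi.
pose B := 2 * normE lambda * K * normE xi / t.
have pE : p 1 = t *: lambda + xi by rewrite /p scale1r.
have p0 : p 0 = t *: lambda by rewrite /p scale0r addr0.
have cpsi : continuous (fun s => psi (p s)).
  have cp : continuous p.
    move=> s; apply: cvgD; first exact: cvg_cst.
    exact: scalel_continuous.
  have -> : (fun s => psi (p s)) = fun s => expR (- dot (t *: lambda) lambda) *
      expR (- dot xi lambda * s) * \sum_(g <- WF) U (lambda *m g) (p s).
    by apply/funext => s; rewrite /psi /p -expRD dotDl !dotZl; congr (expR _ * _); ring.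
  move=> s; apply: cvgM.
    by apply: cvgM; [exact: cvg_cst|exact: continuous_expRM].
  apply: continuous_bigsum => g _ {}s.
  apply: (@continuous_comp _ _ _ p (U (lambda *m g))); first exact: cp.
  exact: (dunkl_real_continuous dunklE).
have dpsi s : 0 < s < 1 -> exists2 d, is_derive s (1 : R) (fun s => psi (p s)) d &
    `|d| <= B * psi (p s).
  move=> /andP[s0 s1'].
  pose eta := lambda + (s / t) *: xi.
  have pseta : p s = t *: eta.
    by rewrite /p /eta scalerDr scalerA mulrC divfK ?lt0r_neq0.
  have eta_dl : normE (eta - lambda) <= dl.
    rewrite /eta addrC addKr normEZ gtr0_norm ?divr_gt0// mulrAC ler_pdivrMr//.
    by rewrite (le_trans _ xi_dl)// ler_piMl ?normE_ge0// ltW.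
  have [etaRp Hle] := H _ _ eta_dl s1t; rewrite -pseta in Hle.
  have pRp a : a \in Rp -> dot a (p s) != 0.
    by move=> aRp; rewrite pseta dotZr dotC mulf_neq0 ?lt0r_neq0 ?etaRp.
  have Dg g : is_derive s (1 : R) (fun s => U (lambda *m g) (p s)) _ :=
    is_derive_dunkl_real_line rootR posR multk dunklE (lambda *m g) pRp.
  have DS := is_derive_bigsum (fun g (_ : g \in enum_fset WF) => Dg g).
  have DE : is_derive s (1 : R) (fun s => expR (- dot (p s) lambda))
      (- dot xi lambda * expR (- dot (p s) lambda)).
    have -> : (fun s => expR (- dot (p s) lambda)) = fun s =>
        expR (- dot (t *: lambda) lambda) * expR (- dot xi lambda * s).
      by apply/funext => u; rewrite /p -expRD dotDl !dotZl; congr expR; ring.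
    apply: (is_derive_eq (is_derive_mulcf _ (is_derive_expRM _ _))).
    by rewrite mulrCA -expRD /p dotDl !dotZl; congr (_ * expR _); ring.
  eexists; first exact: is_derive_mulf DE DS.
  rewrite sumrB.
  (* For each [a] the prefactor does not depend on [g], and [g |-> g *m refl_mx a] permutes the
     group, so the differences sum to 0. *)
  have -> : \sum_(g <- WF) \sum_(a <- Rp) k a * dot a xi / dot a (p s) *
      (U (lambda *m g) (p s) - U (lambda *m g *m refl_mx a) (p s)) = 0.
    rewrite exchange_big/= big_seq big1// => a aRp; rewrite -mulr_sumr sumrB.
    rewrite (eq_bigr (fun g => U (lambda *m (g *m refl_mx a)) (p s))
      (P := xpredT) (F1 := fun g => U (lambda *m g *m refl_mx a) (p s))); last first.
      by move=> g _; rewrite mulmxA.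
    by rewrite (sum_weyl_refl rootR posR (fun g => U (lambda *m g) (p s)) aRp) subrr mulr0.
  rewrite subr0 /psi; set X := expR _.
  have -> : - dot xi lambda * X * (\sum_(g <- WF) U (lambda *m g) (p s)) +
      X * (\sum_(g <- WF) dot xi (lambda *m g) * U (lambda *m g) (p s)) =
      X * \sum_(g <- WF') dot xi (lambda *m g - lambda) * U (lambda *m g) (p s).
    rewrite (mulrC _ X) -mulrA -mulrDr; congr (_ * _).
    rewrite mulr_sumr -big_split/= sum_weyl1 mulmx1 -mulrDl addNr mul0r add0r.
    by apply: eq_bigr => g _; rewrite dotBr; ring.
  have X0 : 0 < X by exact: expR_gt0.
  rewrite normrM gtr0_norm// [leRHS]mulrCA ler_pM2l//.
  apply: le_trans (ler_norm_sum _ _ _) _.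
  have le1 g : g \in WF' -> `|dot xi (lambda *m g - lambda) * U (lambda *m g) (p s)|
      <= 2 * normE lambda * normE xi * U (lambda *m g) (p s).
    rewrite !inE => /andP[_ gW]; rewrite normrM (gtr0_norm (U_gt0 _ _)).
    rewrite ler_wpM2r ?(ltW (U_gt0 _ _))// (le_trans (CauchySchwarz_normE _ _))//.
    rewrite mulrC ler_wpM2r ?normE_ge0// (le_trans (ler_normED _ _))//.
    by rewrite normEN normE_orthogonal ?(fset_weyl_orthogonal rootR gW)//; lra.
  rewrite big_seq; apply: le_trans (ler_sum _ le1) _; rewrite -big_seq -mulr_sumr.
  have -> : B = 2 * normE lambda * normE xi * (K / t) by rewrite /B; ring.
  rewrite -[leRHS]mulrA ler_wpM2l ?mulr_ge0 ?normE_ge0// (le_trans Hle)//.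
  rewrite ler_wpM2l ?divr_ge0 ?(ltW t0)// sum_weyl1 mulmx1 lerDl sumr_ge0// => g _.
  exact/ltW/U_gt0.
have -> : 2 * normE lambda * K * normE xi / t = B by [].
rewrite -pE -p0; split.
- have [|etaRp _] := H (lambda + t^-1 *: xi) t _ s1t.
    by rewrite addrC addKr normEZ gtr0_norm ?invr_gt0// mulrC ler_pdivrMr.
  move=> a /etaRp /(mulr_gt0 t0); rewrite -dotZl scalerDr scalerA divff ?lt0r_neq0//.
  by rewrite scale1r pE => /ltW.
- rewrite -lerN2 -(mulNr (psi (p 0))) (_ : - B = - B * (1 - 0)); last by ring.
  apply: (@gronwall _ (fun s => - psi (p s)) 0 1 (- B)) => //.
    by move=> s; apply: cvgN; exact: cpsi.
  move=> s /dpsi[d dd /ler_normlP[dle _]]; exists (- d); first exact: is_deriveN.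
  by rewrite mulrNN.
- rewrite [in leRHS](_ : B = B * (1 - 0)); last by ring.
  apply: (@gronwall _ (fun s => psi (p s))) => // s /dpsi[d dd /ler_normlP[_ dle]].
  by exists d.
Qed.

End dunkl_asymptotics.

(** * Lebesgue measure and gaussian integrals on row vectors *)

Section change_of_measure.
Local Open Scope ereal_scope.
Context d (T : measurableType d) (R : realType).
Variables (nu mu : {measure set T -> \bar R}) (p : T -> R).
Hypotheses (mp : measurable_fun setT (p : T -> measurableTypeR R)).
Hypothesis p0 : forall x, (0 <= p x)%R.
Hypothesis nuE : forall A, measurable A -> nu A = \int[mu]_(x in A) (p x)%:E.

Import HBNNSimple.

(** Holds for indicators by [nuE], for simple functions by linearity, then by monotone convergence.
    It serves both the law of the process and [std_normal], each known only through its values on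
    sets. *)
Lemma ge0_integral_density (f : T -> \bar R) : measurable_fun setT f ->
  (forall x, 0 <= f x) -> \int[nu]_x f x = \int[mu]_x (f x * (p x)%:E).
Proof.
move=> mf f0; pose h := nnsfun_approx measurableT mf.
have mpE : measurable_fun setT (EFin \o p) by exact/measurable_EFinP.
have hf x : (EFin \o h n) x @[n --> \oo] --> f x.
  by apply: cvg_nnsfun_approx.
have -> : \int[nu]_x f x = limn (fun n => \int[nu]_x (h n x)%:E).
  rewrite -monotone_convergence//.
  - by apply: eq_integral => x _; apply/esym/cvg_lim => //; exact: hf.
  - by move=> n; exact/measurable_EFinP/measurable_funP.
  - by move=> n x _; rewrite lee_fin.
  - by move=> x _ m n mn; rewrite lee_fin; exact/lefP/nd_nnsfun_approx.
have -> : \int[mu]_x (f x * (p x)%:E) =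
    limn (fun n => \int[mu]_x ((h n x)%:E * (p x)%:E)).
  rewrite -monotone_convergence//.
  - apply: eq_integral => x _; apply/esym/cvg_lim => //; apply: cvgeZr => //.
    exact: hf.
  - move=> n; apply: emeasurable_funM => //.
    exact/measurable_EFinP/measurable_funP.
  - by move=> n x _; rewrite mule_ge0// lee_fin.
  - move=> x _ m n mn; rewrite lee_wpmul2r// ?lee_fin//.
    exact/lefP/nd_nnsfun_approx.
congr (limn _); apply/funext => n.
have mh r : measurable (h n @^-1` [set r]) by [].
transitivity (\sum_(r \in range (h n)) \int[nu]_x (r * \1_(h n @^-1` [set r]) x)%:E).
  rewrite -ge0_integral_fsum//.
  - by apply: eq_integral => x _; rewrite fimfunE -fsumEFin.
  - by move=> r; apply/measurable_EFinP; exact: measurable_funM.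
  - by move=> r x _; exact: nnfun_muleindic_ge0.
transitivity (\sum_(r \in range (h n))
    \int[mu]_x ((r * \1_(h n @^-1` [set r]) x)%:E * (p x)%:E)); last first.
  rewrite -ge0_integral_fsum//.
  - apply: eq_integral => x _; rewrite fimfunE -fsumEFin// ge0_mule_fsuml// => r.
    exact: nnfun_muleindic_ge0.
  - move=> r; apply: emeasurable_funM => //; apply/measurable_EFinP.
    exact: measurable_funM.
  - move=> r x _; apply: mule_ge0; last by rewrite lee_fin.
    exact: nnfun_muleindic_ge0.
apply: eq_fsbigr => r rh.
have r0 : (0 <= r)%R by move: rh; rewrite inE => -[x _ <-].
under eq_integral do rewrite EFinM.
rewrite integralZl_indic_nnsfun// integral_indic// setIT nuE//.
under [RHS]eq_integral do rewrite EFinM -muleA.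
rewrite ge0_integralZl//.
- congr (_ * _); rewrite integral_mkcond; apply: eq_integral => x _.
  by rewrite patchE indicE; case: ifP => _; rewrite ?mul1e ?mul0e.
- apply: emeasurable_funM => //; exact/measurable_EFinP.
- by move=> x _; rewrite mule_ge0// lee_fin.
Qed.

End change_of_measure.

Section lebesgue_affine.
Context {R : realType}.
Local Open Scope ereal_scope.

(** Lebesgue measure and [c] times its image under the affine map agree on half-open intervals,
    hence on all Borel sets. *)
Lemma ge0_integral_lebesgue_affine (f : measurableTypeR R -> \bar R) (c v : R) :
  (0 < c)%R -> measurable_fun setT f -> (forall x, 0 <= f x) ->
  \int[@lebesgue_measure R]_x f x =
  c%:E * \int[@lebesgue_measure R]_x f (c * x + v)%R.
Proof.
move=> c0 mf f0; pose phi (x : measurableTypeR R) : measurableTypeR R := (c * x + v)%R.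
have mphi : measurable_fun setT phi.
  by apply: measurable_funD => //; exact: measurable_funM.
pose cnn := NngNum (ltW c0).
pose push_ : {measure set (measurableTypeR R) -> \bar R} :=
  pushforward (@lebesgue_measure R) phi.
pose mu : {measure set _ -> \bar R} := mscale cnn (push_ mphi).
have muE A : measurable A -> @lebesgue_measure R A = mu A.
  apply: lebesgue_measure_unique => _ [[a b] _ <-].
  rewrite /= /mu/= /mscale/= /pushforward/=.
  rewrite (_ : phi @^-1` `]a, b] = `](a - v) / c, (b - v) / c]%classic)%R; last first.
    apply/seteqP; split => x/=; rewrite !in_itv/= /phi ltr_pdivrMr// ler_pdivlMr//;
    by rewrite ltrBlDr lerBrDr (mulrC x).
  rewrite !lebesgue_measure_itv/= !lte_fin ltr_pM2r ?invr_gt0// ltrD2r.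
  case: ifPn => _; last by rewrite mule0.
  by rewrite -!EFinD -EFinM; congr EFin; field; rewrite lt0r_neq0.
rewrite (eq_measure_integral mu) => [|A mA _]; last exact: muE.
rewrite ge0_integral_mscale//; congr (_ * _).
by rewrite ge0_integral_pushforward// preimage_setT.
Qed.

Lemma ge0_integral_lebesgueS n (mu : {sigma_finite_measure set (borelRV R n) -> \bar R})
    (f : borelRV R n.+1 -> \bar R) :
  measurable_fun setT f -> (forall x, 0 <= f x) ->
  \int[lebesgueS mu]_x f x =
  \int[@lebesgue_measure R]_a \int[mu]_u f (consRV (a, u)).
Proof.
move=> mf f0; have mc := @measurable_consRV R n.
pose push_ : {measure set (borelRV R n.+1) -> \bar R} :=
  pushforward (@lebesgue_measure R \x mu)%E (@consRV R n).
rewrite (eq_measure_integral (push_ mc))//.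
rewrite ge0_integral_pushforward// preimage_setT.
rewrite (@fubini_tonelli1 _ _ _ _ _ (@lebesgue_measure R) mu (f \o @consRV R n))//.
  exact: measurableT_comp.
by move=> x; exact: f0.
Qed.

End lebesgue_affine.

Section lebesgueRV_theory.
Context {R : realType}.
Local Open Scope ereal_scope.

Lemma dot_consRV n (a : R) (u : 'rV[R]_n) :
  dot (consRV (a, u) : 'rV[R]_n.+1) (consRV (a, u)) = (a ^+ 2 + dot u u)%R.
Proof.
rewrite /dot (@big_split_ord _ _ _ 1 n) big_ord1 /=; congr (_ + _)%R.
  by rewrite /consRV (@row_mxEl _ 1 1 n) mxE eqxx mulr1n expr2.
by apply: eq_bigr => i _; rewrite /consRV (@row_mxEr _ 1 1 n).
Qed.

Lemma consRV_affine n (a c : R) (u : 'rV[R]_n) (v : 'rV[R]_(1 + n)) :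
  consRV ((c * a + v ord0 (lshift n ord0))%R, (c *: u + rsubmx v)%R) =
  (c *: (consRV (a, u) : 'rV[R]_(1 + n)) + v)%R :> 'rV[R]_(1 + n).
Proof.
apply/rowP => i; rewrite /consRV; case: (split_ordP i) => j ->.
  rewrite (@row_mxEl _ 1 1 n) [RHS]mxE [X in _ = (X + _)%R]mxE.
  by rewrite (@row_mxEl _ 1 1 n) (ord1 j) !mxE eqxx !mulr1n.
rewrite (@row_mxEr _ 1 1 n) [RHS]mxE [X in _ = (X + _)%R]mxE.
by rewrite (@row_mxEr _ 1 1 n) !mxE.
Qed.

Lemma measurable_affineRV n (c : R) (v : 'rV[R]_n) :
  measurable_fun setT ((fun z => c *: z + v)%R : borelRV R n -> borelRV R n).
Proof.
apply: measurable_fun_rowP => i.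
rewrite (_ : (fun _ => _) = (fun z : borelRV R n => c * (z : 'rV[R]_n) ord0 i + v ord0 i)%R).
  apply: measurable_funD => //; apply: measurable_funM => //.
  by apply: continuous_measurableRV; exact: coord_continuous.
by apply/funext => z; rewrite !mxE.
Qed.

Lemma ge0_integral_lebesgueRV_affine n (f : borelRV R n -> \bar R) (c : R)
    (v : 'rV[R]_n) :
  (0 < c)%R -> measurable_fun setT f -> (forall x, 0 <= f x) ->
  \int[lebesgueRV R n]_x f x =
  (c ^+ n)%:E * \int[lebesgueRV R n]_x f (c *: (x : 'rV[R]_n) + v)%R.
Proof.
move=> c0; elim: n f v => [|n IHn] f v mf f0.
  rewrite expr0 mul1e /= !integral_dirac//; last first.
    exact: measurableT_comp mf (measurable_affineRV c v).
  by rewrite (_ : (c *: 0 + v)%R = 0%R)//; apply/rowP => -[].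
have mfa w : measurable_fun setT (fun x : borelRV R n.+1 => f (c *: (x : 'rV[R]_n.+1) + w)%R).
  exact: measurableT_comp mf (measurable_affineRV c w).
have cn0 m : 0 <= (c ^+ m)%:E by rewrite lee_fin exprn_ge0// ltW.
rewrite /= !ge0_integral_lebesgueS//.
pose v' : 'rV[R]_n := rsubmx (v : 'rV[R]_(1 + n)).
pose v0 : R := (v : 'rV[R]_(1 + n)) ord0 (lshift n ord0).
pose h (p : measurableTypeR R * borelRV R n) := f (consRV (p.1, (c *: (p.2 : 'rV[R]_n) + v')%R)).
have mh : measurable_fun setT h.
  apply: measurableT_comp mf _; apply: measurableT_comp (@measurable_consRV R n) _.
  apply: measurable_fun_pair; first exact: measurable_fst.
  exact: measurableT_comp (measurable_affineRV c v') measurable_snd.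
pose G a := \int[lebesgueRV R n]_u h (a, u).
have mG : measurable_fun setT (G : measurableTypeR R -> \bar R).
  apply: (@measurable_fun_fubini_tonelli_F _ _ _ _ _ (lebesgueRV R n) h) => //.
  by move=> x; exact: f0.
have G0 a : 0 <= G a by apply: integral_ge0 => u _; exact: f0.
transitivity (\int[@lebesgue_measure R]_a ((c ^+ n)%:E * G a)).
  apply: eq_integral => a _; rewrite (IHn _ v')//.
  apply: measurableT_comp mf _; apply: measurableT_comp (@measurable_consRV R n) _.
  exact: measurable_fun_pair.
rewrite ge0_integralZl// (ge0_integral_lebesgue_affine v0 c0 mG G0) muleA.
rewrite -EFinM -exprSr; congr (_ * _); apply: eq_integral => a _.
apply: eq_integral => u _; rewrite /h; congr f; exact: consRV_affine.
Qed.

Lemma measurable_gaussRV n (c : R) :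
  measurable_fun [set: borelRV R n]
   ((fun z : 'rV[R]_n => expR (- (normE z ^+ 2 / c)))%R : borelRV R n -> measurableTypeR R).
Proof.
apply: measurableT_comp => //; apply: measurableT_comp => //.
apply: measurable_funM => //.
rewrite (_ : (fun _ => _) = (fun x : 'rV[R]_n => dot x x)).
  by apply: continuous_measurableRV; exact: continuous_dot.
by apply/funext => x; rewrite normE_sqr.
Qed.

Lemma measurable_gauss_half :
  measurable_fun setT (fun a : measurableTypeR R => (expR (- (a ^+ 2 / 2)))%:E).
Proof.
apply: measurableT_comp => //; apply: measurableT_comp => //.
by apply: measurableT_comp => //; apply: measurable_funM.
Qed.

Lemma integral_gauss_half :
  \int[@lebesgue_measure R]_a (expR (- (a ^+ 2 / 2)))%:E = (Num.sqrt (2 * pi))%:E.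
Proof.
have s0 : (0 < Num.sqrt 2 :> R)%R by rewrite sqrtr_gt0.
rewrite (ge0_integral_lebesgue_affine 0%R s0 measurable_gauss_half); last first.
  by move=> a; rewrite lee_fin expR_ge0.
rewrite sqrtrM// EFinM -integralT_gauss; congr (_ * _).
apply: eq_integral => a _; congr (expR _)%:E.
by rewrite addr0 exprMn sqr_sqrtr// mulrAC divff// mul1r.
Qed.

Lemma integral_gaussRV n :
  \int[lebesgueRV R n]_z (expR (- (normE z ^+ 2 / 2)))%:E = (Num.sqrt (2 * pi) ^+ n)%:E.
Proof.
have mg m : measurable_fun [set: borelRV R m]
    (fun z : 'rV[R]_m => (expR (- (normE z ^+ 2 / 2)))%:E).
  by apply/measurable_EFinP; exact: measurable_gaussRV.
elim: n => [|n IHn].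
  rewrite /= integral_dirac//; last exact: mg.
  rewrite diracE mem_set// mul1e normE_sqr dot0l mul0r oppr0 expr0.
  by rewrite expR0.
rewrite /= (ge0_integral_lebesgueS _ (mg n.+1)); last first.
  by move=> x; rewrite lee_fin expR_ge0.
transitivity (\int[@lebesgue_measure R]_a ((Num.sqrt (2 * pi) ^+ n)%:E *
    (expR (- (a ^+ 2 / 2)))%:E)).
  apply: eq_integral => a _; rewrite muleC -IHn -ge0_integralZl//.
  apply: eq_integral => u _; rewrite -EFinM; congr EFin.
  by rewrite -expRD !normE_sqr dot_consRV; congr expR; field.
rewrite ge0_integralZl//; last exact: measurable_gauss_half.
by rewrite integral_gauss_half -EFinM -exprSr.
Qed.

Lemma integrable_gaussRV n (c : R) : (0 < c)%R ->
  (lebesgueRV R n).-integrable setT (fun z => (expR (- (normE z ^+ 2 / c)))%:E).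
Proof.
move=> c0; have mg := @measurable_gaussRV n c.
apply/integrableP; split; first exact/measurable_EFinP.
under eq_integral do rewrite gee0_abs ?lee_fin ?expR_ge0//.
have s0 : (0 < Num.sqrt (c / 2))%R by rewrite sqrtr_gt0 divr_gt0.
rewrite (ge0_integral_lebesgueRV_affine 0%R s0); last 2 first.
- exact/measurable_EFinP.
- by move=> z; rewrite lee_fin expR_ge0.
under eq_integral => z _.
  rewrite addr0 normEZ exprMn ger0_norm ?sqrtr_ge0// sqr_sqrtr ?divr_ge0 ?(ltW c0)//.
  rewrite (_ : c / 2 * normE z ^+ 2 / c = normE z ^+ 2 / 2)%R; last first.
    by field; rewrite lt0r_neq0.
  over.
by rewrite integral_gaussRV -EFinM ltry.
Qed.

Lemma std_normal_pdfE n (y : 'rV[R]_n) :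
  std_normal_pdf y = ((Num.sqrt (2 * pi) ^+ n)^-1 * expR (- (normE y ^+ 2 / 2)))%R.
Proof.
rewrite /std_normal_pdf powRN; congr (_^-1 * _)%R.
rewrite [(n%:R / 2)%R]mulrC powRrM powR12_sqrt ?mulr_ge0 ?pi_ge0//.
by rewrite powR_mulrn.
Qed.

End lebesgueRV_theory.

(** * The transition density *)

Lemma continuous_normE (R : realType) n : continuous (@normE R n).
Proof.
move=> y; apply: (@continuous_comp _ _ _ (fun y : 'rV[R]_n => dot y y) Num.sqrt).
  exact: continuous_dot.
exact: sqrt_continuous.
Qed.

Lemma continuous_mulf (R : realType) (T : topologicalType) (f g : T -> R) :
  continuous f -> continuous g -> continuous (fun x => f x * g x).
Proof. by move=> cf cg x; apply: cvgM; [exact: cf|exact: cg]. Qed.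

Lemma continuous_dotr (R : realType) n (a : 'rV[R]_n) : continuous (dot a).
Proof.
rewrite /dot; apply: continuous_bigsum => i _; apply: continuous_mulf.
  exact: cst_continuous.
exact: coord_continuous.
Qed.

Lemma continuous_mulmxr (R : realType) n (A : 'M[R]_n) :
  continuous (fun y : 'rV[R]_n => y *m A).
Proof.
apply: continuous_mx => i j.
rewrite (_ : (fun _ => _) = fun y : 'rV[R]_n => \sum_l y i l * A l j); last first.
  by apply/funext => u; rewrite mxE.
apply: continuous_bigsum => l _; apply: continuous_mulf.
  exact: coord_continuous.
exact: cst_continuous.
Qed.

Lemma continuous_subr (R : realType) n (v : 'rV[R]_n) :
  continuous (fun y : 'rV[R]_n => y - v).
Proof.
apply: continuous_mx => i j.
rewrite (_ : (fun _ => _) = fun y : 'rV[R]_n => y i j - v i j); last first.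
  by apply/funext => u; rewrite !mxE.
move=> y; apply: (@continuousB R R^o 'rV[R]_n (fun y => y i j) (fun=> v i j)).
  exact: coord_continuous.
exact: cst_continuous.
Qed.

Lemma powR_le_expR (R : realType) (u p : R) : 0 <= u -> 0 <= p ->
  u `^ p <= expR (p * u).
Proof.
move=> u0 p0; rewrite /powR; case: ifPn => [_|u1].
  case: eqP => _; last exact: expR_ge0.
  by rewrite -[leLHS]expR0 ler_expR mulr_ge0.
rewrite ler_expR ler_wpM2l//.
have ugt0 : 0 < u by rewrite lt_neqAle eq_sym u1.
by rewrite -ler_expR lnK ?posrE// (le_trans _ (expR_ge1Dx _))// lerDr.
Qed.

Lemma cvg_powR (R : realType) (T : Type) (F : set_system T) {FF : Filter F}
    (f : T -> R) (u p : R) : 0 < u ->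
  f x @[x --> F] --> u -> f x `^ p @[x --> F] --> u `^ p.
Proof.
move=> u0 fu.
have -> : u `^ p = expR (p * ln u) by rewrite /powR gt_eqF.
have h : expR (p * ln (f x)) @[x --> F] --> expR (p * ln u).
  apply: (cvg_comp _ expR); last exact: continuous_expR.
  apply: cvgM; first exact: cvg_cst.
  by apply: (cvg_comp _ (@ln R)); [exact: fu|exact: continuous_ln].
apply: cvg_trans h; apply: near_eq_cvg.
have : \forall x \near F, 0 < f x by exact: (cvgr_gt u).
by apply: filterS => x fx; rewrite /powR gt_eqF.
Qed.

Lemma cvg_invsqrt_pinfty (R : realType) : (Num.sqrt t)^-1 @[t --> +oo] --> (0 : R).
Proof.
apply/cvgrPdist_lt => e e0; near=> t.
have t0 : 0 < t by near: t; apply: nbhs_pinfty_gt; exact: num_real.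
have st : 0 < Num.sqrt t by rewrite sqrtr_gt0.
rewrite sub0r normrN gtr0_norm ?invr_gt0// invf_plt ?posrE//.
have e1 : 0 <= e^-1 by rewrite invr_ge0 ltW.
rewrite -(@ltr_pXn2r _ 2) ?nnegrE ?sqrtr_ge0// sqr_sqrtr ?ltW//.
by near: t; apply: nbhs_pinfty_gt; exact: num_real.
Unshelve. all: by end_near. Qed.

Section bessel_density_theory.
Context {R : realType} {N : nat}.
Local Notation C := (Num.NumField.sort [the numFieldType of R[i]]).
Variables (Rts Rp : {fset 'rV[R]_N}) (k : 'rV[R]_N -> R).
Variable E : 'rV[C]_N -> 'rV[C]_N -> C.
Hypothesis rootR : is_root_system Rts.
Hypothesis posR : is_positive_subsystem Rts Rp.
Hypothesis multk : is_multiplicity Rts k.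
Hypothesis dunklE : is_dunkl_kernel Rp k E.
Local Notation U := (dunkl_real E).
Local Notation WF := (fset_set (weyl_group Rts)).
Local Notation J := (bessel_funR Rts E).
Local Notation weight := (dunkl_weight Rp k).
Implicit Types (x y z v : 'rV[R]_N) (g : 'M[R]_N) (s t : R).

Lemma card_weyl_gt0 : 0 < #|` WF|%:R :> R.
Proof. by rewrite ltr0n cardfs_gt0; apply/fset0Pn; exists 1%:M; exact: fset_weyl1. Qed.

Lemma bessel_funRE x y : J x y = #|` WF|%:R^-1 * \sum_(g <- WF) U (y *m g) x.
Proof.
rewrite /bessel_funR /bessel_fun fsbig_finite; last exact: (weyl_finite rootR).
have -> : (#|` WF|%:R : R[i])^-1 = real_complex R (#|` WF|%:R^-1).
  by rewrite fmorphV rmorph_nat.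
rewrite Re_realM raddf_sum/=; congr (_ * _); apply: eq_bigr => g _.
by rewrite -cplxM.
Qed.

Lemma bessel_funR_gt0 x y : 0 < J x y.
Proof.
rewrite bessel_funRE mulr_gt0 ?invr_gt0 ?card_weyl_gt0//.
rewrite (sum_weyl1 rootR) ltr_pwDl//; first exact: (dunkl_real_gt0 rootR posR multk dunklE).
by apply: sumr_ge0 => g _; apply/ltW; exact: (dunkl_real_gt0 rootR posR multk dunklE).
Qed.

Lemma bessel_funR_le x y : J x y <= expR (normE x * normE y).
Proof.
rewrite bessel_funRE ler_pdivrMl ?card_weyl_gt0//.
rewrite big_seq; apply: (@le_trans _ _ (\sum_(g <- WF | g \in WF) expR (normE x * normE y))).
  apply: ler_sum => g gW; apply: (dunkl_real_le rootR posR multk dunklE) => // h hW.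
  exact: le_trans (ler_norm _) (dot_weyl_normE rootR _ _ hW).
by rewrite -big_seq big_const_seq count_predT iter_addr_0 mulr_natl.
Qed.

Lemma bessel_funRZ (c d : R) x y : c != 0 -> J (c *: x) (d *: y) = J x ((c * d) *: y).
Proof.
move=> c0; rewrite !bessel_funRE; congr (_ * _); apply: eq_bigr => g _.
by rewrite (dunkl_realZ dunklE)// -!scalemxAl scalerA.
Qed.

Lemma continuous_dunkl_real2 y : continuous (fun w => U w y).
Proof.
move=> w; pose B w' := normE y * normE (w' - w) * expR (normE y * (normE w + normE w')).
have cB : B w' @[w' --> w] --> 0.
  have -> : 0 = B w by rewrite /B subrr /normE dot0l sqrtr0 mulr0 mul0r.
  have c1 : continuous (fun w' : 'rV[R]_N => normE (w' - w)).
    move=> u; apply: (@continuous_comp _ _ _ (fun w' : 'rV[R]_N => w' - w) (@normE R N)).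
      exact: continuous_subr.
    exact: continuous_normE.
  have c2 : continuous (fun w' : 'rV[R]_N => normE y * (normE w + normE w')).
    apply: continuous_mulf; first exact: cst_continuous.
    move=> u; apply: (@continuousD R R^o 'rV[R]_N (fun=> normE w) (@normE R N)).
      exact: cst_continuous.
    exact: continuous_normE.
  have c3 : continuous (fun w' : 'rV[R]_N => expR (normE y * (normE w + normE w'))).
    move=> u; apply: (@continuous_comp _ _ _
      (fun w' : 'rV[R]_N => normE y * (normE w + normE w')) expR); first exact: c2.
    exact: continuous_expR.
  have c4 := continuous_mulf (@cst_continuous 'rV[R]_N R (normE y)) c1.
  exact: (continuous_mulf c4 c3).
apply/(cvgrPdist_lt (FF := nbhs_filter (w : 'rV[R]_N))) => e e0.
have wB : \forall w' \near (w : 'rV[R]_N), B w' < e.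
  exact: (@cvgr_lt _ _ _ (nbhs_filter (w : 'rV[R]_N)) B 0 cB e e0).
apply: (@filterS _ _ (nbhs_filter (w : 'rV[R]_N)) _ _ _ wB) => w'.
apply: le_lt_trans; rewrite distrC.
exact: (dunkl_real_diff rootR posR multk dunklE).
Qed.

Lemma continuous_bessel_funR2 x : continuous (J x).
Proof.
have -> : J x = fun y => #|` WF|%:R^-1 * \sum_(g <- WF) U (y *m g) x.
  by apply/funext => y; exact: bessel_funRE.
apply: continuous_mulf; first exact: cst_continuous.
apply: continuous_bigsum => g _ y.
apply: (@continuous_comp _ _ _ (fun y => y *m g) (fun w => U w x)).
  exact: continuous_mulmxr.
exact: continuous_dunkl_real2.
Qed.

Lemma weight_ge0 y : 0 <= weight y.
Proof. by rewrite /dunkl_weight; apply: prodr_ge0 => a _; exact: powR_ge0. Qed.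

Lemma weight_gt0 y : (forall a, a \in Rp -> 0 < dot y a) -> 0 < weight y.
Proof.
move=> y0; rewrite /dunkl_weight big_seq; apply: prodr_gt0 => a aRp.
by rewrite powR_gt0// dotC gtr0_norm y0.
Qed.

Lemma weightZ c y : 0 <= c ->
  weight (c *: y) = (\prod_(a <- Rp) c `^ (2 * k a)) * weight y.
Proof.
move=> c0; rewrite /dunkl_weight -big_split/=; apply: eq_bigr => a _.
by rewrite dotZr normrM (ger0_norm c0) powRM.
Qed.

Lemma weight_le : exists2 c, 0 <= c & forall y, weight y <= expR (c * normE y).
Proof.
exists (\sum_(a <- Rp) 2 * k a * normE a).
  rewrite big_seq; apply: sumr_ge0 => a aRp.
  by rewrite !mulr_ge0 ?normE_ge0// (mult_ge0 posR multk).
move=> y; rewrite mulr_suml expR_sum /dunkl_weight big_seq [leRHS]big_seq.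
apply: ler_prod => a aRp; rewrite powR_ge0/=.
have ka : 0 <= 2 * k a by rewrite mulr_ge0// (mult_ge0 posR multk).
apply: le_trans (powR_le_expR _ ka) _ => //.
by rewrite ler_expR -[leRHS]mulrA ler_wpM2l// CauchySchwarz_normE.
Qed.

Lemma cvg_weight (T : Type) (F : set_system T) {FF : Filter F}
    (f : T -> 'rV[R]_N) y : (forall a, a \in Rp -> 0 < dot y a) ->
  f x @[x --> F] --> y -> weight (f x) @[x --> F] --> weight y.
Proof.
rewrite /dunkl_weight => y0 fy.
have {y0} : forall a, a \in enum_fset Rp -> 0 < dot y a by [].
elim: (enum_fset Rp) => [|a r IHr] y0.
  under eq_fun do rewrite big_nil.
  by rewrite big_nil; exact: cvg_cst.
under eq_fun do rewrite big_cons.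
rewrite big_cons; apply: cvgM; last first.
  by apply: IHr => // b br; apply: y0; rewrite inE br orbT.
have ya : 0 < dot a y by rewrite dotC y0// mem_head.
apply: cvg_powR; first by rewrite normr_gt0 lt0r_neq0.
apply: cvg_norm; apply: (cvg_comp f (dot a)); first exact: fy.
exact: continuous_dotr.
Qed.

Lemma measurable_dot (a : 'rV[R]_N) :
  measurable_fun [set: borelRV R N] (dot a : borelRV R N -> measurableTypeR R).
Proof.
by apply: continuous_measurableRV; exact: continuous_dotr.
Qed.

Lemma measurable_weight :
  measurable_fun [set: borelRV R N] (weight : borelRV R N -> measurableTypeR R).
Proof.
rewrite /dunkl_weight; elim: (enum_fset Rp) => [|a r IHr].
  by under eq_fun do rewrite big_nil; exact: measurable_cst.
under eq_fun do rewrite big_cons.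
apply: measurable_funM => //; apply: measurableT_comp (measurable_powR _) _.
by apply: measurableT_comp => //; exact: measurable_dot.
Qed.

Lemma measurable_chamber : measurable (weyl_chamber Rp : set (borelRV R N)).
Proof.
rewrite (_ : weyl_chamber Rp = \bigcap_(a in [set` Rp]) (dot a @^-1` `[0, +oo[%classic)).
  apply: fin_bigcap_measurable => // a _; rewrite -[X in measurable X]setTI.
  exact: measurable_dot.
apply/seteqP; split => [y Cy a /= aRp|y Cy a aRp].
  by rewrite in_itv/= andbT dotC; exact: Cy.
by have := Cy a aRp; rewrite /= in_itv/= andbT dotC.
Qed.

End bessel_density_theory.

(** * Pointwise limit and domination of the rescaled density *)

Section bessel_density_asymptotics.
Context {R : realType} {N : nat}.
Local Notation C := (Num.NumField.sort [the numFieldType of R[i]]).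
Variables (Rts Rp : {fset 'rV[R]_N}) (k : 'rV[R]_N -> R).
Variable E : 'rV[C]_N -> 'rV[C]_N -> C.
Hypothesis rootR : is_root_system Rts.
Hypothesis posR : is_positive_subsystem Rts Rp.
Hypothesis multk : is_multiplicity Rts k.
Hypothesis dunklE : is_dunkl_kernel Rp k E.
Variables lambda x : 'rV[R]_N.
Hypothesis lambda_gt0 : forall a, a \in Rp -> 0 < dot lambda a.
Local Notation WF := (fset_set (weyl_group Rts)).
Local Notation J := (bessel_funR Rts E).
Local Notation weight := (dunkl_weight Rp k).
Local Notation psi := (dunkl_psi Rts E lambda).
Local Notation density := (bessel_density Rts Rp k E lambda).
Implicit Types (y z v : 'rV[R]_N) (s t : R).

Lemma bessel_funR_psi y :
  J y lambda = #|` WF|%:R^-1 * (expR (dot y lambda) * psi y).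
Proof.
rewrite (bessel_funRE E rootR) /dunkl_psi expRN mulrA divff ?mul1r//.
by rewrite gt_eqF// expR_gt0.
Qed.

(* The density at t lambda + sqrt t z, divided by the gaussian factor and by
   constants depending on t and x only. *)
Definition gauss_ratio t z : R :=
  J x (lambda + (Num.sqrt t)^-1 *: z) * weight (lambda + (Num.sqrt t)^-1 *: z) *
  (psi (Num.sqrt t *: z + t *: lambda) / psi (t *: lambda)).

(** Homogeneity turns [J (x / sqrt t) (y / sqrt t)] into [J x (y / t)], and [y / t] is
    [lambda + z / sqrt t]. Only [0 <= B] is recorded; that the factor is nonzero will follow from
    the total mass 1. *)
Lemma bessel_density_gauss t : 0 < t -> exists2 B : R, 0 <= B &
  forall z, density t x (Num.sqrt t *: z + t *: lambda) =
    B * (gauss_ratio t z * expR (- (normE z ^+ 2 / 2))).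
Proof.
move=> t0; set s := Num.sqrt t.
have s0 : 0 < s by rewrite sqrtr_gt0.
have ss : s * s = t by rewrite -expr2 sqr_sqrtr// ltW.
have psi0 : 0 < psi (t *: lambda) by exact: (dunkl_psi_gt0 rootR posR multk dunklE).
have Jl0 := bessel_funR_gt0 rootR posR multk dunklE x lambda.
pose B1 := #|` WF|%:R * dunkl_const Rp k * expR (- (normE lambda ^+ 2 * t / 2)) /
    t `^ (dunkl_gamma Rp k + N%:R / 2).
pose w1 := \prod_(a <- Rp) t `^ (2 * k a).
exists (B1 * (expR (- (normE x ^+ 2 / (2 * t)) + t * dot lambda lambda / 2) *
   (#|` WF|%:R^-1 * psi (t *: lambda) / J x lambda) * w1)).
  have B10 : 0 <= B1.
    apply: divr_ge0; last exact: powR_ge0.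
    apply: mulr_ge0; last exact: expR_ge0.
    apply: mulr_ge0 => //; rewrite invr_ge0; apply: Rintegral_ge0 => y _.
    by rewrite mulr_ge0 ?expR_ge0 ?weight_ge0.
  apply: mulr_ge0 => //; apply: mulr_ge0; last first.
    by apply: prodr_ge0 => a _; exact: powR_ge0.
  apply: mulr_ge0; first exact: expR_ge0.
  apply: divr_ge0; last exact: ltW.
  by apply: mulr_ge0; [rewrite invr_ge0|exact: ltW].
move=> z; set y := s *: z + t *: lambda.
have yE : y = t *: (lambda + s^-1 *: z).
  by rewrite /y scalerDr scalerA addrC -ss mulfK ?lt0r_neq0.
have yE' : (s^-1 * s^-1) *: y = lambda + s^-1 *: z.
  by rewrite yE scalerA -invfM ss mulVf ?scale1r// lt0r_neq0.
rewrite /bessel_density (bessel_funRZ rootR dunklE) ?invr_eq0 ?lt0r_neq0// yE'.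
rewrite (bessel_funR_psi y) -/B1 -[RHS]mulrA; congr (_ * _).
have -> : weight y = w1 * weight (lambda + s^-1 *: z).
  by rewrite yE weightZ// ltW.
(* Completing the square: [|y|^2 / (2t) - <y, lambda> = |z|^2 / 2 - t |lambda|^2 / 2]. *)
have EE : expR (- ((normE x ^+ 2 + normE y ^+ 2) / (2 * t))) * expR (dot y lambda) =
    expR (- (normE x ^+ 2 / (2 * t)) + t * dot lambda lambda / 2) *
    expR (- (normE z ^+ 2 / 2)).
  rewrite -!expRD; congr expR.
  have -> : normE y ^+ 2 = t * dot z z + 2 * s * t * dot z lambda + t ^+ 2 * dot lambda lambda.
    rewrite normE_sqr /y !(dotDl, dotDr, dotZl, dotZr) (dotC lambda z) -ss; ring.
  rewrite !normE_sqr /y dotDl !dotZl; field.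
  exact: lt0r_neq0.
rewrite /gauss_ratio -/s -/y.
rewrite [LHS](_ : _ = expR (- ((normE x ^+ 2 + normE y ^+ 2) / (2 * t))) *
   expR (dot y lambda) * (J x (lambda + s^-1 *: z) * #|` WF|%:R^-1 * psi y /
   J x lambda * w1 * weight (lambda + s^-1 *: z))); last by ring.
rewrite EE; field.
by rewrite (lt0r_neq0 psi0) (lt0r_neq0 Jl0) (lt0r_neq0 (card_weyl_gt0 rootR)).
Qed.

Lemma gauss_ratio_ge0 t z : 0 <= gauss_ratio t z.
Proof.
rewrite mulr_ge0 ?divr_ge0//.
- by rewrite mulr_ge0 ?weight_ge0//; apply/ltW; exact: (bessel_funR_gt0 rootR posR multk dunklE).
- by apply/ltW; exact: (dunkl_psi_gt0 rootR posR multk dunklE).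
- by apply/ltW; exact: (dunkl_psi_gt0 rootR posR multk dunklE).
Qed.

Lemma scaled_norm t z : 0 < t ->
  normE (Num.sqrt t *: z) / t = normE z * (Num.sqrt t)^-1.
Proof.
move=> t0; have s0 : 0 < Num.sqrt t by rewrite sqrtr_gt0.
rewrite normEZ gtr0_norm// -[t in X in X = _](sqr_sqrtr (ltW t0)).
by rewrite sqrtr_sqr gtr0_norm//; field; rewrite lt0r_neq0.
Qed.

Lemma cvg_gauss_ratio z :
  gauss_ratio t z * \1_(weyl_chamber Rp) (Num.sqrt t *: z + t *: lambda) @[t --> +oo]
  --> J x lambda * weight lambda.
Proof.
have [dl [c [s1 [dl0 c0 s10 H]]]] :=
  dunkl_psi_slow_variation rootR posR multk dunklE lambda_gt0.
have r0 := @cvg_invsqrt_pinfty R.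
have vl : (lambda + (Num.sqrt t)^-1 *: z) @[t --> +oo] --> lambda.
  have : continuous (fun r : R => lambda + r *: z).
    apply: continuous_mx => i j.
    rewrite (_ : (fun _ => _) = fun r : R => lambda i j + r * z i j); last first.
      by apply/funext => r; rewrite !mxE.
    move=> r; apply: cvgD; first exact: cvg_cst.
    by apply: cvgM; [exact: cvg_id|exact: cvg_cst].
  by move=> /(_ 0); rewrite /continuous_at scale0r addr0 => h; exact: (cvg_comp _ _ r0 h).
have zr : normE z * (Num.sqrt t)^-1 @[t --> +oo] --> (0 : R).
  by rewrite -[0](mulr0 (normE z)); apply: cvgM => //; exact: cvg_cst.
have near_t : \forall t \near +oo, s1 <= t /\ normE (Num.sqrt t *: z) <= dl * t.
  near=> t; split; first by near: t; apply: nbhs_pinfty_ge; exact: num_real.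
  have t0 : 0 < t by near: t; apply: nbhs_pinfty_gt; exact: num_real.
  rewrite -ler_pdivrMr// scaled_norm//; apply/ltW; near: t.
  exact: (cvgr_lt 0 zr).
have ratio1 : psi (Num.sqrt t *: z + t *: lambda) / psi (t *: lambda) @[t --> +oo] --> (1 : R).
  have cexp (e : R) : expR (e * (normE z * (Num.sqrt t)^-1)) @[t --> +oo] --> (1 : R).
    rewrite -expR0; apply: (cvg_comp _ expR); last exact: continuous_expR.
    by rewrite -[0](mulr0 e); apply: cvgM => //; exact: cvg_cst.
  apply: squeeze_cvgr (cexp (- c)) (cexp c).
  near=> t; have [s1t zt] : s1 <= t /\ normE (Num.sqrt t *: z) <= dl * t.
    by near: t.
  have t0 : 0 < t by exact: lt_le_trans s1t.
  have psi0 : 0 < psi (t *: lambda) by exact: (dunkl_psi_gt0 rootR posR multk dunklE).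
  have [_ h1 h2] := H _ _ s1t zt.
  rewrite addrC ler_pdivlMr// ler_pdivrMr// mulrC mulNr -scaled_norm// mulrA.
  by rewrite h1 mulrC h2.
have ind1 : \forall t \near +oo,
    \1_(weyl_chamber Rp) (Num.sqrt t *: z + t *: lambda) = 1 :> R.
  near=> t; have [s1t zt] : s1 <= t /\ normE (Num.sqrt t *: z) <= dl * t.
    by near: t.
  by have [Cy _ _] := H _ _ s1t zt; rewrite indicE mem_set// addrC.
have lim : gauss_ratio t z @[t --> +oo] --> J x lambda * weight lambda.
  rewrite -[_ * weight _]mulr1; apply: cvgM => //; apply: cvgM.
    apply: (cvg_comp _ (J x)); first exact: vl.
    exact: (continuous_bessel_funR2 rootR posR multk dunklE).
  exact: cvg_weight.
apply: cvg_trans lim; apply: near_eq_cvg.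
by apply: filterS ind1 => t ->; rewrite mulr1.
Unshelve. all: by end_near. Qed.

Lemma gauss_ratio_dominated : exists M T : R, [/\ 0 <= M, 0 < T & forall t z, T <= t ->
  gauss_ratio t z * \1_(weyl_chamber Rp) (Num.sqrt t *: z + t *: lambda) *
    expR (- (normE z ^+ 2 / 2)) <= M * expR (- (normE z ^+ 2 / 4))].
Proof.
have [dl [c [s1 [dl0 c0 s10 H]]]] :=
  dunkl_psi_slow_variation rootR posR multk dunklE lambda_gt0.
(* Far from [t lambda] one has [dl^2 t <= |z|^2], so dividing by [psi (t lambda)] at this rate costs
   at most [e^{|z|^2 / 16}]. *)
have e0 : 0 < dl ^+ 2 / 16 by rewrite divr_gt0// exprn_gt0.
have [c' [s2 [c'0 s20 H']]] := dunkl_psi_ray_ge rootR posR multk dunklE lambda e0.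
have [cw cw0 weightP] := weight_le posR multk.
have psi_gt0 y : 0 < psi y by exact: (dunkl_psi_gt0 rootR posR multk dunklE).
pose q z := normE z; have q0 z : 0 <= q z by exact: normE_ge0.
pose nxw := normE x + cw.
have nxw0 : 0 <= nxw by rewrite addr_ge0// normE_ge0.
(* The 1 serves the points near [t lambda], where the ratio is at most [e^{c |z|}]; the quotient
   serves the far points, [#|WF|] bounding [psi] and [c'] coming from the lower bound on the ray. *)
pose D := 1 + #|` WF|%:R / c'.
have D0 : 0 <= #|` WF|%:R / c' by rewrite divr_ge0// ltW.
exists (D * expR (nxw * normE lambda + 4 * (nxw + c) ^+ 2)), (1 + s1 + s2).
split; [by rewrite mulr_ge0 ?expR_ge0// addr_ge0|lra|].
move=> t z Tt.
have t1 : 1 <= t by lra.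
have t0 : 0 < t by lra.
set s := Num.sqrt t; have s_ge1 : 1 <= s by rewrite -sqrtr1 ler_sqrt// ltW.
have s0 : 0 < s by lra.
have ss : s * s = t by rewrite -expr2 sqr_sqrtr// ltW.
have r1 : s^-1 <= 1 by rewrite invf_le1.
have bound1 : J x (lambda + s^-1 *: z) * weight (lambda + s^-1 *: z) <=
    expR (nxw * (normE lambda + q z)).
  have nv : normE (lambda + s^-1 *: z) <= normE lambda + q z.
    apply: le_trans (ler_normED _ _) _; rewrite lerD2l normEZ gtr0_norm ?invr_gt0//.
    by rewrite ler_piMl.
  rewrite /nxw mulrDl expRD; apply: ler_pM.
  - by apply/ltW; exact: (bessel_funR_gt0 rootR posR multk dunklE).
  - exact: weight_ge0.
  - apply: le_trans (bessel_funR_le rootR posR multk dunklE _ _) _.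
    by rewrite ler_expR ler_wpM2l ?normE_ge0.
  - by apply: le_trans (weightP _) _; rewrite ler_expR ler_wpM2l.
have bound2 : psi (s *: z + t *: lambda) / psi (t *: lambda) *
    \1_(weyl_chamber Rp) (s *: z + t *: lambda) <= D * expR (c * q z + q z ^+ 2 / 16).
  have [zt|zt] := leP (normE (s *: z)) (dl * t).
    have [|Cy _ h2] := H t (s *: z) _ zt; first lra.
    rewrite addrC indicE mem_set// mulr1 ler_pdivrMr// (le_trans h2)//.
    rewrite [leRHS]mulrC ler_wpM2l ?(ltW (psi_gt0 _))//.
    apply: (@le_trans _ _ (expR (c * q z + q z ^+ 2 / 16))); last first.
      by rewrite ler_peMl ?expR_ge0// /D lerDl.
    rewrite ler_expR -mulrA scaled_norm// ler_wpDr ?divr_ge0 ?sqr_ge0//.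
    by rewrite ler_wpM2l// ler_piMr.
  rewrite indicE; case: (boolP (_ \in _)) => [|_]; last first.
    by rewrite mulr0 mulr_ge0 ?expR_ge0// addr_ge0.
  rewrite mulr1 => /set_mem Cy.
  have num := dunkl_psi_le rootR posR multk dunklE lambda_gt0 Cy.
  have s2t : s2 <= t by lra.
  have den := H' t s2t.
  have zt' : dl ^+ 2 * t <= q z ^+ 2.
    have : (dl * t) ^+ 2 <= normE (s *: z) ^+ 2.
      by rewrite ler_pXn2r ?nnegrE ?normE_ge0 ?mulr_ge0// ltW.
    rewrite normEZ gtr0_norm// !exprMn [s ^+ 2]expr2 ss -/(q z) => h.
    by rewrite -(ler_pM2l t0); apply: le_trans h; rewrite le_eqVlt; apply/orP; left; apply/eqP; ring.
  rewrite ler_pdivrMr//; apply: le_trans num _.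
  apply: (@le_trans _ _ (D * expR (c * q z + q z ^+ 2 / 16) * (c' * expR (- (dl ^+ 2 / 16 * t))))); last first.
    by rewrite ler_wpM2l// mulr_ge0 ?expR_ge0// addr_ge0.
  rewrite mulrACA -expRD.
  have h1 : #|` WF|%:R <= D * c' :> R.
    by rewrite /D mulrDl mul1r divfK ?lt0r_neq0// lerDr ltW.
  apply: le_trans h1 _; rewrite ler_peMr ?mulr_ge0 ?addr_ge0 ?(ltW c'0)//.
  rewrite -[leLHS]expR0 ler_expR; have : 0 <= c * q z by rewrite mulr_ge0.
  lra.
have G0 := gauss_ratio_ge0 t z.
rewrite /gauss_ratio -/s -[X in X * expR _ <= _]mulrA.
apply: (@le_trans _ _ (expR (nxw * (normE lambda + q z)) *
   (D * expR (c * q z + q z ^+ 2 / 16)) * expR (- (normE z ^+ 2 / 2)))).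
  rewrite ler_wpM2r ?expR_ge0//; apply: ler_pM => //.
    by rewrite mulr_ge0 ?weight_ge0//; apply/ltW; exact: (bessel_funR_gt0 rootR posR multk dunklE).
  by rewrite mulr_ge0 ?divr_ge0 ?(ltW (psi_gt0 _))// indicE.
rewrite mulrCA -!mulrA ler_wpM2l ?addr_ge0// -!expRD ler_expR -/(q z).
(* With [A = nxw + c] the square gives [A q <= q^2 / 16 + 4 A^2]; the total coefficient of [q^2] is
   then [1/16 + 1/16 - 1/2], below [-1/4]. *)
have := sqr_ge0 (q z - 8 * (nxw + c)); nra.
Qed.

Lemma measurable_gauss_ratio t :
  measurable_fun [set: borelRV R N]
    ((fun z => gauss_ratio t z * \1_(weyl_chamber Rp) (Num.sqrt t *: z + t *: lambda))
       : borelRV R N -> measurableTypeR R).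
Proof.
have mpsi : measurable_fun [set: borelRV R N] (psi : borelRV R N -> measurableTypeR R).
  rewrite /dunkl_psi; apply: measurable_funM.
    apply: measurableT_comp => //; apply: measurableT_comp => //.
    under eq_fun do rewrite dotC; exact: measurable_dot.
  apply: continuous_measurableRV; apply: continuous_bigsum => g _.
  exact: (dunkl_real_continuous dunklE).
have maff c v : measurable_fun setT ((fun z => c *: z + v) : borelRV R N -> borelRV R N).
  exact: measurable_affineRV.
have maff' : measurable_fun setT ((fun z => lambda + (Num.sqrt t)^-1 *: z) : borelRV R N -> borelRV R N).
  by under eq_fun do rewrite addrC; exact: maff.
apply: measurable_funM; last first.
  apply: measurableT_comp (maff _ _); apply: measurable_indic.
  exact: measurable_chamber.
apply: measurable_funM.
  apply: measurable_funM; last exact: measurableT_comp (measurable_weight _ _) maff'.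
  apply: measurableT_comp maff'; apply: continuous_measurableRV.
  exact: (continuous_bessel_funR2 rootR posR multk dunklE).
by apply: measurable_funM => //; exact: measurableT_comp mpsi (maff _ _).
Qed.

End bessel_density_asymptotics.

(** * The law of the process and the limit theorem *)

Section bessel_law.
Context {R : realType} {N : nat}.
Local Notation C := (Num.NumField.sort [the numFieldType of R[i]]).
Variables (Rts Rp : {fset 'rV[R]_N}) (k : 'rV[R]_N -> R).
Variable E : 'rV[C]_N -> 'rV[C]_N -> C.
Variables lambda x : 'rV[R]_N.
Context {d : measure_display} {T : measurableType d}.
Variables (P : probability T R) (X : R -> T -> 'rV[R]_N).
Hypothesis besselX : is_bessel_process Rts Rp k E lambda x P X.
Local Notation density := (bessel_density Rts Rp k E lambda).
Local Open Scope ereal_scope.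

Lemma bessel_measurable t : (0 <= t)%R ->
  measurable_fun [set: T] (X t : T -> borelRV R N).
Proof. by case: besselX => _ mX _ _ _ /mX[]. Qed.

Lemma measurable_set1RV (y : 'rV[R]_N) : measurable ([set y] : set (borelRV R N)).
Proof.
rewrite -[X in measurable X]setCK; apply: measurableC; apply: open_measurableRV.
by apply: closed_openC; apply: accessible_closed_set1; apply: hausdorff_accessible; exact: norm_hausdorff.
Qed.

(* The Markov property at time 0, applied to the event X_0 = x. *)
Lemma bessel_law t (A : set (borelRV R N)) : (0 < t)%R -> measurable A ->
  P (X t @^-1` A) =
  \int[lebesgueRV R N]_(y in A) (density t x y * \1_(weyl_chamber Rp) y)%:E.
Proof.
move=> t0 mA; case: besselX => _ mX _ X0 markov.
have mC := @measurable_chamber R N Rp.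
pose B := X 0%R @^-1` [set x].
have mpre s (D : set (borelRV R N)) : (0 <= s)%R -> measurable D -> measurable (X s @^-1` D).
  by move=> s0 mD; rewrite -[Y in measurable Y]setTI; apply: bessel_measurable.
have mB : measurable B by apply: mpre => //; exact: measurable_set1RV.
have PB0 : P (~` B) = 0 by apply/negligibleP; [exact: measurableC|exact: X0].
have PB D : measurable D -> P (B `&` D) = P D.
  move=> mD; apply/eqP; rewrite eq_le; apply/andP; split.
    by apply: le_measure; rewrite ?inE//; exact: measurableI.
  rewrite -[leRHS]adde0 -PB0; apply: (@le_trans _ _ (P ((B `&` D) `|` ~` B))).
    apply: le_measure; rewrite ?inE//.
      by apply: measurableU; [exact: measurableI|exact: measurableC].
    by move=> w Dw; have [Bw|Bw] := pselect (B w); [left|right].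
  by apply: measureU2; [exact: measurableI|exact: measurableC].
have -> : X t @^-1` A = X t @^-1` (A `&` weyl_chamber Rp).
  apply/seteqP; split => w /= => [Aw|[]//]; split => //.
  by have [_] := mX t (ltW t0); exact.
have mAC : measurable (A `&` weyl_chamber Rp) by exact: measurableI.
rewrite -PB; last by apply: mpre => //; exact: ltW.
have -> : X t = X (0 + t)%R by rewrite add0r.
rewrite markov//; last first.
  apply: sub_sigma_algebra; exists 0%R, [set x]; split=> //.
    by rewrite lexx.
  exact: measurable_set1RV.
transitivity (\int[P]_(w in B) cst (bessel_kernel Rts Rp k E lambda t x (A `&` weyl_chamber Rp)) w).
  by apply: eq_integral => w; rewrite inE => ->.
have PB1 : P B = 1 by rewrite -[B]setIT PB// probability_setT.
rewrite integral_cst// [X in _ * X]PB1 mule1.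
rewrite /bessel_kernel integral_mkcondr; apply: eq_integral => y _.
by rewrite patchE indicE; case: ifP => _; rewrite ?mulr1 ?mulr0.
Qed.

End bessel_law.

(** * Convergence of expectations *)

Section bessel_gauss.
Context {R : realType} {N : nat}.
Local Notation C := (Num.NumField.sort [the numFieldType of R[i]]).
Variables (Rts Rp : {fset 'rV[R]_N}) (k : 'rV[R]_N -> R).
Variable E : 'rV[C]_N -> 'rV[C]_N -> C.
Hypothesis rootR : is_root_system Rts.
Hypothesis posR : is_positive_subsystem Rts Rp.
Hypothesis multk : is_multiplicity Rts k.
Hypothesis dunklE : is_dunkl_kernel Rp k E.
Variables lambda x : 'rV[R]_N.
Hypothesis lambda_gt0 : forall a, a \in Rp -> (0 < dot lambda a)%R.
Context {d : measure_display} {T : measurableType d}.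
Variables (P : probability T R) (X : R -> T -> 'rV[R]_N).
Hypothesis besselX : is_bessel_process Rts Rp k E lambda x P X.
Local Notation leb := (lebesgueRV R N).
Local Notation density := (bessel_density Rts Rp k E lambda).
Local Notation Z t w := ((Num.sqrt t)^-1 *: (X t w - t *: lambda))%R.
Implicit Types (g : 'rV[R]_N -> R) (t : R) (z : 'rV[R]_N).
Local Open Scope ereal_scope.

Let G t z : R := (gauss_ratio Rts Rp k E lambda x t z *
  \1_(weyl_chamber Rp) (Num.sqrt t *: z + t *: lambda))%R.
Let e z : R := expR (- (normE z ^+ 2 / 2)).

Let G0 t z : (0 <= G t z)%R.
Proof.
apply: mulr_ge0; last by rewrite indicE.
exact: (gauss_ratio_ge0 rootR posR multk dunklE).
Qed.

Let e0 z : (0 <= e z)%R. Proof. exact: expR_ge0. Qed.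

Let Ge0 t z : (0 <= G t z * e z)%R.
Proof. by apply: mulr_ge0; [exact: G0|exact: e0]. Qed.

Let mG t : measurable_fun [set: borelRV R N] (G t : borelRV R N -> measurableTypeR R).
Proof. exact: (measurable_gauss_ratio rootR posR multk dunklE). Qed.

Let me : measurable_fun [set: borelRV R N] (e : borelRV R N -> measurableTypeR R).
Proof. exact: measurable_gaussRV. Qed.

(** The factor [b] is chosen before [g], so the case [g = 1], where the left side is the total mass,
    determines it for all [g]. *)
Lemma expectation_gauss t : (0 < t)%R -> exists b : R, forall g,
  measurable_fun [set: borelRV R N] (g : borelRV R N -> measurableTypeR R) ->
  (forall z, 0 <= g z)%R ->
  \int[P]_w (g (Z t w))%:E = b%:E * \int[leb]_z (g z * (G t z * e z))%:E.
Proof.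
move=> t0; set s := Num.sqrt t.
have s0 : (0 < s)%R by rewrite sqrtr_gt0.
have [B B0 densityE] := bessel_density_gauss rootR posR multk dunklE lambda x t0.
exists (s ^+ N * B)%R => g mg g0.
pose p y : R := (density t x y * \1_(weyl_chamber Rp) y)%R.
pose z_ (y : 'rV[R]_N) := (s^-1 *: y + - (s^-1 * t) *: lambda)%R.
have z_K y : (s *: z_ y + t *: lambda = y)%R.
  rewrite /z_ scalerDr !scalerA mulfV ?lt0r_neq0// scale1r mulrN mulrA.
  by rewrite mulfV ?lt0r_neq0// mul1r scaleNr subrK.
have z_K' z : z_ (s *: z + t *: lambda)%R = z.
  rewrite /z_ scalerDr !scalerA mulVf ?lt0r_neq0// scale1r scaleNr.
  by rewrite addrK.
have mz : measurable_fun setT (z_ : borelRV R N -> borelRV R N).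
  exact: measurable_affineRV.
have pz z : p (s *: z + t *: lambda)%R = (B * (G t z * e z))%R.
  by rewrite /p densityE /G /e; ring.
have pE y : p y = (B * (G t (z_ y) * e (z_ y)))%R by rewrite -pz z_K.
have p0 y : (0 <= p y)%R by rewrite pE; apply: mulr_ge0 => //; exact: Ge0.
have mp : measurable_fun [set: borelRV R N] (p : borelRV R N -> measurableTypeR R).
  rewrite (_ : p = fun y => B * (G t (z_ y) * e (z_ y)))%R; last exact/funext.
  apply: measurable_funM => //; apply: measurable_funM.
    exact: measurableT_comp (mG t) mz.
  exact: measurableT_comp me mz.
have mX := bessel_measurable besselX (ltW t0).
pose push_ : {measure set (borelRV R N) -> \bar R} := pushforward P (X t : T -> borelRV R N).
pose nu := push_ mX.
have nuE A : measurable A -> nu A = \int[leb]_(y in A) (p y)%:E.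
  by move=> mA; exact: (bessel_law besselX).
have mgz : measurable_fun [set: borelRV R N] (EFin \o g \o z_ : borelRV R N -> \bar R).
  by apply: measurableT_comp mz; exact/measurable_EFinP.
have gz0 y : 0 <= (EFin \o g \o z_) y by rewrite lee_fin.
transitivity (\int[nu]_y (EFin \o g \o z_) y).
  rewrite ge0_integral_pushforward// preimage_setT; apply: eq_integral => w _ /=.
  by congr (g _)%:E; rewrite /z_ scalerBr scalerA scaleNr.
rewrite (ge0_integral_density mp p0 nuE)//.
rewrite (@ge0_integral_lebesgueRV_affine _ _
  (fun y => (EFin \o g \o z_) y * (p y)%:E) _ (t *: lambda) s0); last 2 first.
- by apply: emeasurable_funM => //; exact/measurable_EFinP.
- by move=> y; apply: mule_ge0; rewrite ?lee_fin.
rewrite EFinM -muleA; congr (_ * _).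
rewrite -ge0_integralZl//; last 2 first.
- apply/measurable_EFinP; apply: measurable_funM => //.
  exact: (measurable_funM (mG t) me).
- by move=> z _; rewrite lee_fin; apply: mulr_ge0 => //; exact: Ge0.
apply: eq_integral => z _; rewrite -EFinM /= z_K' pz -EFinM; congr EFin.
by rewrite mulrCA.
Qed.

Lemma cvg_gauss_integral g (K : R) :
  measurable_fun [set: borelRV R N] (g : borelRV R N -> measurableTypeR R) ->
  (forall z, 0 <= g z <= K)%R ->
  \int[leb]_z (g z * (G t z * e z))%:E @[t --> +oo%R] -->
  \int[leb]_z (g z * (bessel_funR Rts E x lambda * dunkl_weight Rp k lambda * e z))%:E.
Proof.
move=> mg gK.
have [M [T0 [M0 T00 GM]]] :=
  gauss_ratio_dominated rootR posR multk dunklE x lambda_gt0.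
apply/cvge_pinftyP => u uoo.
(* Domination is available only from [T0] on; the finitely many earlier indices of the sequence are
   replaced by 0. *)
pose f n z : \bar R := if (T0 <= u n)%R then (g z * (G (u n) z * e z))%:E else 0.
have H : (forall n, measurable_fun [set: borelRV R N] (f n)).
  move=> n; rewrite /f; case: (T0 <= u n)%R => //.
  apply/measurable_EFinP; apply: measurable_funM => //.
  exact: (measurable_funM (mG _) me).
have Tu : \forall n \near \oo, (T0 <= u n)%R by move/cvgryPge : uoo; exact.
have [||||_ _ lim] := @dominated_convergence _ _ _ leb setT measurableT f
  (fun z => (g z * (bessel_funR Rts E x lambda * dunkl_weight Rp k lambda * e z))%:E)
  (fun z => (K * M * expR (- (normE z ^+ 2 / 4)))%:E) H.
- apply/measurable_EFinP; apply: measurable_funM => //.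
  exact: measurable_funM.
- apply: aeW => z _.
  have h : (g z * (G (u n) z * e z))%:E @[n --> \oo] -->
     (g z * (bessel_funR Rts E x lambda * dunkl_weight Rp k lambda * e z))%:E.
    apply: cvg_EFin; first by near=> n.
    apply: cvgM; first exact: cvg_cst.
    apply: cvgM; last exact: cvg_cst.
    have hG : G t z @[t --> +oo%R] --> (bessel_funR Rts E x lambda * dunkl_weight Rp k lambda)%R.
      exact: (cvg_gauss_ratio rootR posR multk dunklE).
    by move/cvg_pinftyP : hG; exact.
  apply: cvg_trans h; apply: near_eq_cvg.
  by apply: filterS Tu => n Tn; rewrite /f Tn.
- under eq_fun do rewrite EFinM; apply: integrableZl => //.
  by apply: integrable_gaussRV.
- apply: aeW => z n _; have /andP[g0 gzK] := gK z.
  have K0 : (0 <= K)%R by exact: le_trans gzK.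
  rewrite /f; case: ifPn => Tn; last first.
    rewrite abse0 lee_fin; apply: mulr_ge0; last exact: expR_ge0.
    exact: mulr_ge0.
  rewrite abse_EFin lee_fin ger0_norm; last by apply: mulr_ge0 => //; exact: Ge0.
  rewrite -[leRHS]mulrA; by apply: ler_pM; [exact: g0|exact: Ge0|exact: gzK|exact: GM].
- apply: cvg_trans lim; apply: near_eq_cvg; apply: filterS Tu => n Tn /=.
  by apply: eq_integral => z _; rewrite /f Tn.
Unshelve. all: by end_near. Qed.

Lemma gauss_integral_lt_pinfty g (K : R) :
  measurable_fun [set: borelRV R N] (g : borelRV R N -> measurableTypeR R) ->
  (forall z, 0 <= g z <= K)%R ->
  0 <= \int[leb]_z (g z * e z)%:E < +oo.
Proof.
move=> mg gK.
have g0 z : (0 <= g z)%R by have /andP[] := gK z.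
have gleK z : (g z <= K)%R by have /andP[] := gK z.
have K0 : (0 <= K)%R by exact: le_trans (g0 0%R) (gleK 0%R).
apply/andP; split; first by apply: integral_ge0 => z _; rewrite lee_fin mulr_ge0.
apply: (@le_lt_trans _ _ (\int[leb]_z (K%:E * (e z)%:E))).
  apply: ge0_le_integral => //.
  - by move=> z _; rewrite lee_fin mulr_ge0.
  - apply: measurableT_comp => //; exact: measurable_funM.
  - by apply: emeasurable_funM => //; apply: measurableT_comp.
  - by move=> z _; rewrite -EFinM lee_fin ler_wpM2r.
rewrite ge0_integralZl// ?lee_fin//; first by rewrite integral_gaussRV -EFinM ltry.
- exact: measurableT_comp.
- by move=> z _; rewrite lee_fin.
Qed.

(** The expectation is the quotient of the weighted integrals of [g] and of 1. The limiting constant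
    [H] occurs in both and cancels, leaving the normalised gaussian integral. *)
Lemma cvg_expectation_nneg g (K : R) : continuous g -> (forall z, 0 <= g z <= K)%R ->
  (\int[P]_w g (Z t w) @[t --> +oo] --> \int[@std_normal R N]_z g z)%R.
Proof.
move=> cg gK; have mg := continuous_measurableRV cg.
have g0 z : (0 <= g z)%R by have /andP[] := gK z.
pose H := (bessel_funR Rts E x lambda * dunkl_weight Rp k lambda)%R.
have H0 : (0 < H)%R.
  by apply: mulr_gt0; [exact: (bessel_funR_gt0 rootR posR multk dunklE)|exact: weight_gt0].
have lim g' K' : measurable_fun [set: borelRV R N] (g' : borelRV R N -> measurableTypeR R) ->
    (forall z, 0 <= g' z <= K')%R ->
    fine (\int[leb]_z (g' z * (G t z * e z))%:E) @[t --> +oo%R] -->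
    (H * fine (\int[leb]_z (g' z * e z)%:E))%R.
  move=> mg' gK'; have := cvg_gauss_integral mg' gK'.
  have g'0 z : (0 <= g' z)%R by have /andP[] := gK' z.
  have -> : \int[leb]_z (g' z * (bessel_funR Rts E x lambda * dunkl_weight Rp k lambda * e z))%:E
     = (H * fine (\int[leb]_z (g' z * e z)%:E))%:E.
    have /andP[i0 ioo] := gauss_integral_lt_pinfty mg' gK'.
    rewrite EFinM fineK ?ge0_fin_numE// -ge0_integralZl ?lee_fin ?(ltW H0)//.
    - by apply: eq_integral => z _; rewrite -EFinM mulrCA.
    - apply: measurableT_comp => //; exact: measurable_funM.
    - by move=> z _; rewrite lee_fin mulr_ge0.
  exact: fine_cvg.
have gauss1 : fine (\int[leb]_z (1 * e z)%:E) = (Num.sqrt (2 * pi) ^+ N)%R.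
  by under eq_integral do rewrite mul1r; rewrite integral_gaussRV.
have pi0 : (0 < Num.sqrt (2 * pi) ^+ N :> R)%R by rewrite exprn_gt0// sqrtr_gt0 mulr_gt0// pi_gt0.
have nuE : (\int[@std_normal R N]_z g z = (Num.sqrt (2 * pi) ^+ N)^-1 *
    fine (\int[leb]_z (g z * e z)%:E))%R.
  rewrite /Rintegral (ge0_integral_density (@measurable_std_normal_pdf R N) (mu := leb))//.
  - transitivity (fine (((Num.sqrt (2 * pi) ^+ N)^-1)%:E * \int[leb]_z (g z * e z)%:E)).
      congr fine; rewrite -ge0_integralZl ?lee_fin ?invr_ge0 ?(ltW pi0)//.
      + by apply: eq_integral => z _; rewrite -!EFinM std_normal_pdfE mulrCA.
      + apply: measurableT_comp => //; exact: measurable_funM.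
      + by move=> z _; rewrite lee_fin mulr_ge0.
    have /andP[h1 h2] := gauss_integral_lt_pinfty mg gK.
    by rewrite fineM// ge0_fin_numE.
  - by move=> y; rewrite std_normal_pdfE mulr_ge0 ?expR_ge0// invr_ge0 ltW.
  - exact/measurable_EFinP.
have limg := lim g K mg gK.
rewrite nuE.
have -> : ((Num.sqrt (2 * pi) ^+ N)^-1 * fine (\int[leb]_z (g z * e z)%:E) =
    (H * fine (\int[leb]_z (g z * e z)%:E)) / (H * Num.sqrt (2 * pi) ^+ N))%R.
  by field; rewrite !lt0r_neq0.
have {}lim1 : fine (\int[leb]_z (1 * (G t z * e z))%:E) @[t --> +oo%R] -->
    (H * Num.sqrt (2 * pi) ^+ N)%R.
  rewrite -gauss1; apply: (lim (cst 1%R) 1%R) => // z.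
  by rewrite ler01 lexx.
have h : (fine (\int[leb]_z (g z * (G t z * e z))%:E) /
    fine (\int[leb]_z (1 * (G t z * e z))%:E) @[t --> +oo] -->
    (H * fine (\int[leb]_z (g z * e z)%:E)) / (H * Num.sqrt (2 * pi) ^+ N))%R.
  by apply: cvgM => //; apply: cvgV => //; rewrite lt0r_neq0// mulr_gt0.
apply: cvg_trans h; apply: near_eq_cvg; near=> t.
have t0 : (0 < t)%R by near: t; apply: nbhs_pinfty_gt; exact: num_real.
have [b bE] := expectation_gauss t0.
have b1 : (1 : \bar R) = b%:E * \int[leb]_z (1 * (G t z * e z))%:E.
  rewrite -(bE (cst 1%R))//.
  apply/esym; apply: etrans (integral_cst P measurableT 1) _.
  by rewrite mul1e; exact: probability_setT.
have b0 : b != 0%R.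
  by apply/eqP => b0; move: b1; rewrite b0 mul0e => /eqP; rewrite onee_eq0.
(* At infinite [i] both sides are 0, since [fine] sends infinities to 0 and [b] is nonzero; so no
   finiteness at the given [t] has to be checked first. *)
have fineM' i : fine (b%:E * i) = (b * fine i)%R.
  case: i => [r| |] //=; rewrite mulr0; move: b0; rewrite neq_lt => /orP[bn|bp].
  - by rewrite lt0_muley ?lte_fin.
  - by rewrite gt0_muley ?lte_fin.
  - by rewrite lt0_muleNy ?lte_fin.
  - by rewrite gt0_muleNy ?lte_fin.
have {}b1 : (1 = b * fine (\int[leb]_z (1 * (G t z * e z))%:E))%R.
  by rewrite -fineM' -b1.
rewrite /Rintegral bE// fineM'.
set i1 := fine (\int[leb]_z (1 * _)%:E) in b1 *.
have i10 : i1 != 0%R by apply: contra_eq_neq b1 => ->; rewrite mulr0 oner_eq0.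
by apply: (mulIf i10); rewrite divfK// mulrAC -b1 mul1r.
Unshelve. all: by end_near. Qed.

End bessel_gauss.

Lemma std_normal_setT (R : realType) n : @std_normal R n setT = 1%E.
Proof.
have pi0 : 0 < Num.sqrt (2 * pi) ^+ n :> R.
  by rewrite exprn_gt0// sqrtr_gt0 mulr_gt0// pi_gt0.
rewrite /std_normal; under eq_integral do rewrite std_normal_pdfE EFinM.
rewrite ge0_integralZl//=.
- by rewrite integral_gaussRV -EFinM mulVf// lt0r_neq0.
- by apply/measurable_EFinP; exact: measurable_gaussRV.
Qed.

Lemma Rintegral_addc {d : measure_display} {T : measurableType d} (R : realType)
    (mu : {measure set T -> \bar R}) (f : T -> R) (M : R) :
  mu setT = 1%E -> measurable_fun setT (f : T -> measurableTypeR R) ->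
  (forall w, `|f w| <= M) ->
  \int[mu]_w (f w + M) = \int[mu]_w f w + M.
Proof.
move=> mu1 mf fM.
have ic (c : R) : mu.-integrable setT (EFin \o cst c).
  apply/integrableP; split; first exact/measurable_EFinP.
  by rewrite /= integral_cst//= mu1 mule1 ltry.
have fi : mu.-integrable setT (EFin \o f).
  apply: le_integrable (ic M) => //; first exact/measurable_EFinP.
  by move=> w _; rewrite /= lee_fin (le_trans (fM w))// ler_norm.
rewrite (RintegralD measurableT fi (ic M)).
congr (_ + _); rewrite /Rintegral (integral_cst mu measurableT M%:E).
by rewrite [X in fine (_ * X)]mu1 mule1.
Qed.

Theorem theorem1p7 (R : realType) (N : nat) (Rts Rp : {fset 'rV[R]_N})
    (k : 'rV[R]_N -> R) (E : 'rV[R[i]]_N -> 'rV[R[i]]_N -> R[i])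
    (lambda x : 'rV[R]_N) (d : measure_display) (T : measurableType d)
    (P : probability T R) (X : R -> T -> 'rV[R]_N)
    (N_ge1 : (1 <= N)%N)
    (rootR : is_root_system Rts) (posR : is_positive_subsystem Rts Rp)
    (multk : is_multiplicity Rts k) (dunklE : is_dunkl_kernel Rp k E)
    (Clambda : weyl_chamber Rp lambda)
    (reg_lambda : regular_vector Rts Rp lambda)
    (Cx : weyl_chamber Rp x)
    (besselX : is_bessel_process Rts Rp k E lambda x P X) :
  tends_in_distribution P
    (fun t w => (Num.sqrt t)^-1 *: (X t w - t *: lambda))
    (@std_normal R N).
Proof.
case: (posR) => beta b0 RpE.
have lambda_gt0 := regular_dot_gt0 rootR RpE Clambda reg_lambda.
move=> f cf [M fM].
(* Adding the bound [M] makes the test function nonnegative; as both measures have mass 1, this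
   shifts both integrals by [M]. *)
have cg : continuous (fun z => f z + M).
  by move=> z; apply: (@continuousD R R^o 'rV[R]_N f (fun=> M)); [exact: cf|exact: cst_continuous].
have g0 z : 0 <= f z + M <= M + M.
  by have := fM z; rewrite ler_norml => /andP[? ?]; rewrite lerD2r; lra.
have mf := continuous_measurableRV cf.
have lim := cvg_expectation_nneg rootR posR multk dunklE lambda_gt0 besselX cg g0.
rewrite -[X in _ --> X](addrK M) -(Rintegral_addc (std_normal_setT R N) mf fM).
have lim' : \int[P]_w (f ((Num.sqrt t)^-1 *: (X t w - t *: lambda)) + M) - M
    @[t --> +oo] --> \int[@std_normal R N]_z (f z + M) - M.
  by apply: cvgB lim _; exact: cvg_cst.
apply: cvg_trans lim'; apply: near_eq_cvg; near=> t.
have t0 : 0 < t by near: t; apply: nbhs_pinfty_gt; exact: num_real.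
rewrite /= (Rintegral_addc (f := fun w => f ((Num.sqrt t)^-1 *: (X t w - t *: lambda)))) ?addrK//.
  exact: probability_setT.
apply: measurableT_comp mf _.
under eq_fun do rewrite scalerBr -scaleNr.
apply: measurableT_comp (measurable_affineRV _ _) _.
exact: (bessel_measurable besselX (ltW t0)).
Unshelve. all: by end_near. Qed.
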